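(* Let $\mathfrak{g}$ be a four-dimensional real Lie algebra which has three-dimensional generating subspaces. 1. If $\mathfrak{g}$ has an infinite number of two-dimensional ideals, then any two three-dimensional subspaces generating $\mathfrak{g}$ are equivalent. 2. If $\mathfrak{g}$ has a finite number (possibly zero) of two-dimensional ideals and $\mathfrak{g}$ is different from (not isomorphic to) the Lie algebras $2\mathfrak{g}_{2,1}$ and $\mathfrak{g}_{3,6}\oplus\mathfrak{g}_1$, then $\mathfrak{g}$ has a finite number $m$, $0\le m\le3$, of pairwise nonequivalent one-dimensional ideals $\mathfrak{L}_1,\dots,\mathfrak{L}_m$ (representatives of all the equivalence classes of one-dimensional ideals). There exist exactly $m+1$ equivalence classes of three-dimensional subspaces generating $\mathfrak{g}$; such a subspace $\mathfrak{q}$ belongs to the $i$-th equivalence class ($i=1,\dots,m$) if $\mathfrak{L}_i\subset\mathfrak{q}$, and $\mathfrak{q}$ belongs to the $(m+1)$-th equivalence class if $\mathfrak{q}$ contains no one-dimensional ideal of $\mathfrak{g}$.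
   Context: A subspace of $\mathfrak{g}$ generates $\mathfrak{g}$ (is generating) if the smallest Lie subalgebra containing it is $\mathfrak{g}$. Two subspaces $\mathfrak{q}_1,\mathfrak{q}_2\subset\mathfrak{g}$ are equivalent if $\mathfrak{q}_2=\xi(\mathfrak{q}_1)$ for some automorphism $\xi$ of the Lie algebra $\mathfrak{g}$. $2\mathfrak{g}_{2,1}$ has a basis $E_1,\dots,E_4$ with nonzero commutators $[E_1,E_2]=E_1$, $[E_3,E_4]=E_3$ (up to antisymmetry); $\mathfrak{g}_{3,6}\oplus\mathfrak{g}_1$ has a basis $E_1,\dots,E_4$ with nonzero commutators $[E_2,E_3]=E_1$, $[E_3,E_1]=E_2$, $[E_1,E_2]=-E_3$ (i.e. it is $\mathfrak{sl}(2,\mathbb{R})\oplus\mathbb{R}$). *)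

(* Defs.v *)
From HB Require Import structures.
From mathcomp Require Import all_boot all_order all_algebra.
From mathcomp Require Import boolp classical_sets functions cardinality reals.

Set Implicit Arguments.
Unset Strict Implicit.
Unset Printing Implicit Defensive.

Import GRing.Theory.
Local Open Scope ring_scope.
Local Open Scope classical_set_scope.

HB.mixin Record Lmodule_hasBracket (K : nzRingType) (V : Type)
    of GRing.Lmodule K V := {
  bracket : V -> V -> V;
  bracket_linear_l : forall y : V, linear (bracket^~ y);
  bracket_linear_r : forall x : V, linear (bracket x);
  bracketxx : forall x : V, bracket x x = 0;
  jacobi : forall x y z : V,
    bracket x (bracket y z) + bracket y (bracket z x)
      + bracket z (bracket x y) = 0
}.

(* Finite-dimensional Lie algebras over K. *)
#[short(type="lieAlgType")]
HB.structure Definition LieAlgebra (K : nzRingType) :=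
  { V of Lmodule_hasBracket K V & Vector K V }.

Section LieAlgebraTheory.

Variables (K : fieldType) (g : lieAlgType K).

Implicit Types (I L S q : {vspace g}).

Definition lie_subalgebra S :=
  forall x y : g, x \in S -> y \in S -> bracket x y \in S.

Definition lie_ideal I :=
  forall x y : g, y \in I -> bracket x y \in I.

Definition generating q :=
  forall S, lie_subalgebra S -> (q <= S)%VS -> S = fullv.

Definition lie_automorphism (xi : 'End(g)) :=
  bijective xi /\ forall x y : g, xi (bracket x y) = bracket (xi x) (xi y).

Definition equivalent q1 q2 :=
  exists2 xi : 'End(g), lie_automorphism xi & q2 = (xi @: q1)%VS.

Definition ideal_of_dim (d : nat) I := \dim I = d /\ lie_ideal I.

Definition generating3 q := \dim q = 3%N /\ generating q.

(* The set of equivalence classes of three-dimensional generating subspaces;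
   a class is a set of subspaces. *)
Definition generating3_classes : set (set {vspace g}) :=
  [set [set q' | generating3 q' /\ equivalent q q'] | q in generating3].

(* L_0, ..., L_(m-1) represent each equivalence class of one-dimensional
   ideals exactly once. *)
Definition ideal1_representatives (m : nat) (L : 'I_m -> {vspace g}) :=
  [/\ forall i, ideal_of_dim 1 (L i),
      forall i j, equivalent (L i) (L j) -> i = j
    & forall I, ideal_of_dim 1 I -> exists i, equivalent (L i) I].

Definition is_2g21 :=
  exists E1 E2 E3 E4 : g,
    basis_of fullv [:: E1; E2; E3; E4] /\
    [/\ bracket E1 E2 = E1, bracket E3 E4 = E3 &
        [/\ bracket E1 E3 = 0, bracket E1 E4 = 0,
            bracket E2 E3 = 0 & bracket E2 E4 = 0]].

Definition is_g36_g1 :=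
  exists E1 E2 E3 E4 : g,
    basis_of fullv [:: E1; E2; E3; E4] /\
    [/\ bracket E2 E3 = E1, bracket E3 E1 = E2, bracket E1 E2 = - E3 &
        [/\ bracket E1 E4 = 0, bracket E2 E4 = 0 & bracket E3 E4 = 0]].

End LieAlgebraTheory.

Arguments is_2g21 {K} g.
Arguments is_g36_g1 {K} g.
Arguments generating3_classes {K} g.

(* Main.v *)
Require Import Defs.
From HB Require Import structures.
From mathcomp Require Import all_boot all_order all_algebra.
From mathcomp Require Import boolp classical_sets functions cardinality reals.
From mathcomp Require Import ring.

(* A three-dimensional subspace [q] generates iff it is not a subalgebra.  In particular it
   contains at most one line that is an ideal, and the classes are told apart by that line.
   That [q] is determined up to automorphism by it rests on a coarse classification of [g].
   The 2-forms [d phi] with [phi] in the dual of [g] are pairwise orthogonal for the wedge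
   product when the traces of [ad] vanish, so they span at most half of the six-dimensional
   space of 2-forms; hence [g] is never perfect, and it has a three-dimensional ideal [n] with
   [[g, g] <= n].  According to [dim [n, n]], either [g] has an abelian or a Heisenberg ideal of
   dimension three, or it is the affine algebra of the complex line, [so(3) + R], [2g_{2,1}] or
   [sl(2, R) + R].  Except in the last two, a generating [q] has a fixed position with respect to
   some basis of [g] whose structure constants depend only on [g] and on the ideal line in [q]. *)

Set Implicit Arguments.
Unset Strict Implicit.
Unset Printing Implicit Defensive.

Import Order.TTheory GRing.Theory Num.Theory.
Local Open Scope ring_scope.
Local Open Scope classical_set_scope.

(** Automorphism groups are never computed. An automorphism is obtained as the linear map between
    two bases with the same structure constants, the first three vectors of each spanning the given
    hyperplanes; the task is thus to find normal forms for the pair of algebra and hyperplane. The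
    wedge product is a nondegenerate symmetric pairing on 2-forms in dimension four, so a subspace
    orthogonal to itself has dimension at most 3. The dual of [g] has dimension 4, hence some
    nonzero [phi] has [d phi = 0], that is, vanishes on all brackets. If the traces of [ad] do not
    vanish, the trace is itself such a form. The bound 3 comes from the abelian case: with finitely
    many plane ideals, the lines that are ideals are eigenlines of an operator on a
    three-dimensional space, one for each eigenvalue. Infinitely many plane ideals occur when that
    operator has no cyclic vector, or when [g] acts by scalars on the Heisenberg ideal modulo its
    centre. For so(3) the invariant form is definite and all directions are alike up to rotation;
    for sl(2, R) it is indefinite, and directions of different sign are not exchanged by
    automorphisms. *)

Section LinearAlgebra.

Variables (K : fieldType) (V : vectType K).
Implicit Types (u v x y z t : V) (U W : {vspace V}).

(** Turns an identity of vectors into one of scalars, in which each [f x] is an atom for [ring] and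
    [field]; [vring] rests on it. *)
Lemma scalar_ext u v : (forall f : {scalar V}, f u = f v) -> u = v.
Proof.
move=> fuv; rewrite (coord_vbasis (memvf u)) (coord_vbasis (memvf v)).
by apply: eq_bigr => i _; rewrite (fuv (coord (vbasis fullv) i)).
Qed.

Lemma in_span1 u x : u \in <<[:: x]>>%VS <-> exists a, u = a *: x.
Proof. by rewrite span_seq1; split=> /vlineP. Qed.

Lemma in_span_cons u x s :
  u \in <<x :: s>>%VS <-> exists a, exists2 w, w \in <<s>>%VS & u = a *: x + w.
Proof.
rewrite span_cons; split.
  by case/memv_addP=> _ /vlineP [a ->] [w ws ->]; exists a, w.
by case=> a [w ws ->]; rewrite memv_add // memvZ // memv_line.
Qed.

Lemma in_span2 u x y :
  u \in <<[:: x; y]>>%VS <-> exists a b, u = a *: x + b *: y.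
Proof.
rewrite in_span_cons; split.
  by case=> a [w /in_span1 [b ->] ->]; exists a, b.
by case=> a [b ->]; exists a, (b *: y) => //; apply/in_span1; exists b.
Qed.

Lemma in_span3 u x y z :
  u \in <<[:: x; y; z]>>%VS <-> exists a b c, u = a *: x + b *: y + c *: z.
Proof.
rewrite in_span_cons; split.
  by case=> a [w /in_span2 [b [c ->]] ->]; exists a, b, c; rewrite addrA.
case=> a [b [c ->]]; exists a, (b *: y + c *: z); last by rewrite addrA.
by apply/in_span2; exists b, c.
Qed.

Lemma dim1_line U : \dim U = 1%N -> exists2 x, x != 0 & U = <[x]>%VS.
Proof.
move=> dU; have := vbasisP U; move: (vbasis U) (size_tuple (vbasis U)).
rewrite dU => -[[|x [|]]] //= _ _ b; exists x.
  by rewrite -seq1_free; apply: basis_free b.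
by rewrite -(span_basis b) span_seq1.
Qed.

Lemma dim2_span U : \dim U = 2%N ->
  exists x y, free [:: x; y] /\ U = <<[:: x; y]>>%VS.
Proof.
move=> dU; have := vbasisP U; move: (vbasis U) (size_tuple (vbasis U)).
rewrite dU => -[[|x [|y [|]]]] //= _ _ b; exists x, y.
by rewrite (span_basis b) (basis_free b).
Qed.

Lemma dim3_span U : \dim U = 3%N ->
  exists x y z, free [:: x; y; z] /\ U = <<[:: x; y; z]>>%VS.
Proof.
move=> dU; have := vbasisP U; move: (vbasis U) (size_tuple (vbasis U)).
rewrite dU => -[[|x [|y [|z [|]]]]] //= _ _ b; exists x, y, z.
by rewrite (span_basis b) (basis_free b).
Qed.

Lemma free_span_eq (s : seq V) U :
  free s -> {subset s <= U} -> \dim U = size s -> U = <<s>>%VS.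
Proof.
move=> /eqP fs /span_subvP sU dU; apply/esym/eqP.
by rewrite eqEdim sU /= dU fs.
Qed.

Lemma free_consP x (s : seq V) :
  free (x :: s) <-> free s /\ forall a w, w \in <<s>>%VS -> a *: x + w = 0 -> a = 0.
Proof.
rewrite free_cons; split=> [/andP [xs fs]|[fs H]].
  split=> // a w ws E; apply: contraNeq xs => a0.
  by rewrite -[x](scalerK a0) memvZ // -[a *: x](addrK w) E sub0r memvN.
rewrite fs andbT; apply/negP; rewrite -memvN => xs.
have /eqP : (1 : K) = 0 by apply: (H 1 _ xs); rewrite scale1r subrr.
by rewrite oner_eq0.
Qed.

Lemma free2P x y : free [:: x; y] <->
  (forall a b, a *: x + b *: y = 0 -> a = 0 /\ b = 0).
Proof.
rewrite free_consP seq1_free; split=> [[y0 H] a b E|H].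
  have a0 : a = 0 by apply: H E; apply/in_span1; exists b.
  move: E; rewrite a0 scale0r add0r => /eqP.
  by rewrite scaler_eq0 (negPf y0) orbF => /eqP.
split=> [|a w /in_span1 [b ->] /H [] //]; apply/eqP => y0.
have [|_ /eqP] := H 0 1; first by rewrite y0 scaler0 scale0r addr0.
by rewrite oner_eq0.
Qed.

Lemma free3P x y z : free [:: x; y; z] <->
  (forall a b c, a *: x + b *: y + c *: z = 0 -> [/\ a = 0, b = 0 & c = 0]).
Proof.
rewrite free_consP free2P; split=> [[H2 H] a b c E|H].
  have a0 : a = 0.
    by apply: (H a (b *: y + c *: z)); [apply/in_span2; exists b, c | rewrite addrA].
  by have [|-> ->] := H2 b c; first by rewrite -E a0 scale0r add0r.
split=> [b c E|a w /in_span2 [b [c ->]]]; last by rewrite addrA => /H [].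
by have [|_ -> ->] := H 0 b c; first by rewrite scale0r add0r.
Qed.

Lemma free4P x y z t : free [:: x; y; z; t] <->
  (forall a b c d, a *: x + b *: y + c *: z + d *: t = 0 ->
     [/\ a = 0, b = 0, c = 0 & d = 0]).
Proof.
rewrite free_consP free3P; split=> [[H3 H] a b c d E|H].
  have a0 : a = 0.
    apply: (H a (b *: y + c *: z + d *: t)); last by rewrite !addrA.
    by apply/in_span3; exists b, c, d.
  by have [|-> -> ->] := H3 b c d; first by rewrite -E a0 scale0r add0r.
split=> [b c d E|a w /in_span3 [b [c [d ->]]]]; last by rewrite !addrA => /H [].
by have [|_ -> -> ->] := H 0 b c d; first by rewrite scale0r add0r.
Qed.

Lemma free4_dual x y z t : \dim {:V} = 4%N -> free [:: x; y; z; t] ->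
  exists f1 f2 f3 f4 : {scalar V},
  [/\ forall u, u = f1 u *: x + f2 u *: y + f3 u *: z + f4 u *: t,
      [/\ f1 x = 1, f1 y = 0, f1 z = 0 & f1 t = 0],
      [/\ f2 x = 0, f2 y = 1, f2 z = 0 & f2 t = 0],
      [/\ f3 x = 0, f3 y = 0, f3 z = 1 & f3 t = 0] &
      [/\ f4 x = 0, f4 y = 0, f4 z = 0 & f4 t = 1]].
Proof.
move=> dV fr; pose X := in_tuple [:: x; y; z; t].
have bX : basis_of fullv X by rewrite basisEfree fr subvf dV.
pose o k (lt : (k < 4)%N) : 'I_4 := Ordinal lt.
pose o0 := @o 0%N isT; pose o1 := @o 1%N isT.
pose o2 := @o 2%N isT; pose o3 := @o 3%N isT.
have cE i j : coord X i X`_(val j) = (i == j)%:R by rewrite coord_free // eq_sym.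
exists (coord X o0), (coord X o1), (coord X o2), (coord X o3).
split; try by split;
  [exact: (cE _ o0) | exact: (cE _ o1) | exact: (cE _ o2) | exact: (cE _ o3)].
move=> u; rewrite {1}(coord_basis bX (memvf u)) !big_ord_recl big_ord0 /= addr0 !addrA.
by do ![congr (_ + _)]; congr (coord _ _ _ *: _); apply: val_inj.
Qed.

Lemma hyperplane_scalar U : \dim {:V} = 4%N -> \dim U = 3%N ->
  exists f : {scalar V}, forall u, (u \in U) = (f u == 0).
Proof.
move=> dV dU; have [x [y [z [fr eU]]]] := dim3_span dU.
have /subvPn [t _ tU] : ~~ (fullv <= U)%VS.
  by apply/negP => /dimvS; rewrite dU dV.
have fr4 : free [:: t; x; y; z] by rewrite free_cons fr -eU tU.
have [f1 [f2 [f3 [f4 [dec [f1t f1x f1y f1z] _ _ _]]]]] := free4_dual dV fr4.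
exists f1 => u; apply/idP/eqP.
  rewrite eU => /in_span3 [a [b [c ->]]].
  by rewrite !(linearD, linearZ) /= f1x f1y f1z; ring.
move=> f0; rewrite (dec u) f0 scale0r add0r eU.
by apply/in_span3; exists (f2 u), (f3 u), (f4 u).
Qed.

Lemma dim4_full U : \dim {:V} = 4%N -> \dim U = 4%N -> U = fullv.
Proof. by move=> dV dU; apply/eqP; rewrite eqEdim subvf dV dU. Qed.

Lemma free4_hyperplane U x y z t : free [:: x; y; z; t] -> \dim U = 3%N ->
  x \in U -> y \in U -> z \in U -> U = <<[:: x; y; z]>>%VS.
Proof.
move=> fr dU xU yU zU; apply: free_span_eq => //.
  by apply: (@catl_free _ _ [:: t]); rewrite cat_cons.
by move=> u; rewrite !inE => /or3P [] /eqP ->.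
Qed.

End LinearAlgebra.

Ltac vring :=
  apply: scalar_ext => ?; rewrite !(linearD, linearN, linearZ, linear0) /=; ring.

(** * Bracket calculus, generating hyperplanes and isomorphisms of frames *)

Section Bracket.

Variables (K : fieldType) (g : lieAlgType K).
Implicit Types (u v w x y z t : g) (U W q : {vspace g}).

Lemma brDl x y z : bracket (x + y) z = bracket x z + bracket y z.
Proof. by have := bracket_linear_l z 1 x y; rewrite !scale1r. Qed.

Lemma brDr x y z : bracket x (y + z) = bracket x y + bracket x z.
Proof. by have := bracket_linear_r x 1 y z; rewrite !scale1r. Qed.

Lemma br0l x : bracket 0 x = 0.
Proof. by apply/(addrI (bracket 0 x)); rewrite -brDl !addr0. Qed.

Lemma br0r x : bracket x 0 = 0.
Proof. by apply/(addrI (bracket x 0)); rewrite -brDr !addr0. Qed.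

Lemma brZl a x y : bracket (a *: x) y = a *: bracket x y.
Proof. by have := bracket_linear_l y a x 0; rewrite !addr0 br0l addr0. Qed.

Lemma brZr a x y : bracket x (a *: y) = a *: bracket x y.
Proof. by have := bracket_linear_r x a y 0; rewrite !addr0 br0r addr0. Qed.

Lemma brC x y : bracket x y = - bracket y x.
Proof.
apply/eqP; rewrite -addr_eq0; have := bracketxx (x + y).
by rewrite brDl !brDr !bracketxx add0r addr0 => ->.
Qed.

Lemma brNl x y : bracket (- x) y = - bracket x y.
Proof. by rewrite -scaleN1r brZl scaleN1r. Qed.

Lemma brNr x y : bracket x (- y) = - bracket x y.
Proof. by rewrite -scaleN1r brZr scaleN1r. Qed.

Definition brE := (brDl, brDr, brZl, brZr, brNl, brNr, br0l, br0r, @bracketxx K g).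

Lemma brJ x y z :
  bracket x (bracket y z) = bracket (bracket x y) z + bracket y (bracket x z).
Proof.
have /eqP := jacobi x y z; rewrite addr_eq0 => /eqP.
rewrite [bracket z x]brC [bracket z (bracket _ _)]brC opprK brNr => <-.
by rewrite subrK.
Qed.

Lemma bracket_in_span3 x y z U :
  bracket x y \in U -> bracket x z \in U -> bracket y z \in U ->
  forall u v, u \in <<[:: x; y; z]>>%VS -> v \in <<[:: x; y; z]>>%VS ->
  bracket u v \in U.
Proof.
move=> xy xz yz u v /in_span3 [a [b [c ->]]] /in_span3 [a' [b' [c' ->]]].
rewrite !brE ![bracket y x]brC ![bracket z x]brC ![bracket z y]brC.
by rewrite !(scalerN, rpredD, rpredN, rpredZ, rpred0, scaler0).
Qed.

Hypothesis dim_g : \dim {:g} = 4%N.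

(** Nothing fits strictly between dimensions 3 and 4: a proper subalgebra containing [q] is [q]
    itself. *)
Lemma generating3P q : generating3 q <-> \dim q = 3%N /\ ~ lie_subalgebra q.
Proof.
split=> -[dq gq]; split=> //.
  by move=> sq; have qf := gq q sq (subvv q); rewrite qf dim_g in dq.
move=> S sS qS; apply: dim4_full => //; apply/eqP; rewrite eqn_leq.
rewrite -{1}dim_g dimvS ?subvf //= ltnNge; apply/negP => S3.
by apply: gq; rewrite (_ : q = S) //; apply/eqP; rewrite eqEdim qS dq.
Qed.

Lemma generating3_span x y z :
  free [:: x; y; z] -> bracket x y \notin <<[:: x; y; z]>>%VS ->
  generating3 <<[:: x; y; z]>>%VS.
Proof.
move=> fr xy; apply/generating3P; split; first exact/eqP.
by move=> H; move/negP: xy; apply; apply: H; rewrite memv_span ?inE ?eqxx ?orbT.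
Qed.

Lemma generating3_bracket x y z : generating3 <<[:: x; y; z]>>%VS ->
  [\/ bracket x y \notin <<[:: x; y; z]>>%VS, bracket x z \notin <<[:: x; y; z]>>%VS
    | bracket y z \notin <<[:: x; y; z]>>%VS].
Proof.
move=> /generating3P [_ ns].
have [xy|] := boolP (bracket x y \in <<[:: x; y; z]>>%VS); last by constructor 1.
have [xz|] := boolP (bracket x z \in <<[:: x; y; z]>>%VS); last by constructor 2.
have [yz|] := boolP (bracket y z \in <<[:: x; y; z]>>%VS); last by constructor 3.
by case: ns => u v; apply: bracket_in_span3.
Qed.

(** The source of all nontrivial equivalences below. The condition on brackets is quantified over
    [xi] so that each use can expand the brackets in the two bases and push [xi] through by
    linearity. *)
Lemma frame_iso x y z t x' y' z' t' :
  free [:: x; y; z; t] -> free [:: x'; y'; z'; t'] ->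
  (forall xi : {linear g -> g}, xi x = x' -> xi y = y' -> xi z = z' -> xi t = t' ->
     [/\ xi (bracket x y) = bracket x' y', xi (bracket x z) = bracket x' z',
         xi (bracket x t) = bracket x' t' &
         [/\ xi (bracket y z) = bracket y' z', xi (bracket y t) = bracket y' t'
            & xi (bracket z t) = bracket z' t']]) ->
  equivalent <<[:: x; y; z]>>%VS <<[:: x'; y'; z']>>%VS.
Proof.
move=> fr fr' H.
have [xi xiE] := linear_of_free [:: x; y; z; t] [:: x'; y'; z'; t'].
have [eta etaE] := linear_of_free [:: x'; y'; z'; t'] [:: x; y; z; t].
have [xx xy xz xt] := xiE fr erefl.
have [ex ey ez et] := etaE fr' erefl.
have [f1 [f2 [f3 [f4 [dec _ _ _ _]]]]] := free4_dual dim_g fr.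
have [f1' [f2' [f3' [f4' [dec' _ _ _ _]]]]] := free4_dual dim_g fr'.
have [Hxy Hxz Hxt [Hyz Hyt Hzt]] := H xi xx xy xz xt.
exists (linfun xi); last by rewrite limg_span /= !lfunE /= xx xy xz.
split.
  exists (linfun eta) => u; rewrite !lfunE /=.
    by rewrite (dec u) !(linearD, linearZ) /= xx xy xz xt ex ey ez et.
  by rewrite (dec' u) !(linearD, linearZ) /= ex ey ez et xx xy xz xt.
move=> u v; rewrite !lfunE /= (dec u) (dec v).
rewrite !brE ![bracket y x]brC ![bracket z x]brC ![bracket z y]brC.
rewrite ![bracket t x]brC ![bracket t y]brC ![bracket t z]brC.
rewrite !(linearD, linearN, linearZ, linear0) /=.
rewrite ?Hxy ?Hxz ?Hxt ?Hyz ?Hyt ?Hzt xx xy xz xt.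
rewrite !brE ![bracket y' x']brC ![bracket z' x']brC ![bracket z' y']brC.
by rewrite ![bracket t' x']brC ![bracket t' y']brC ![bracket t' z']brC.
Qed.

End Bracket.

(** * Automorphisms, one-dimensional ideals and the abstract classification *)

Section Equivalence.

Variables (K : fieldType) (g : lieAlgType K).
Implicit Types (u v w x y z t : g) (U W q L I : {vspace g}) (xi : 'End(g)).

Lemma lie_automorphism_lker0 xi : lie_automorphism xi -> lker xi == 0%VS.
Proof. by case=> /bij_inj inj _; apply/lker0P. Qed.

Lemma lie_automorphismV xi : lie_automorphism xi -> lie_automorphism (xi^-1)%VF.
Proof.
move=> axi; have k0 := lie_automorphism_lker0 axi; case: (axi) => _ xiB.
have [xiK xiVK] := (lker0_lfunK k0, lker0_lfunVK k0).
split; first by exists xi.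
by move=> x y; apply: (can_inj xiK); rewrite xiB !xiVK.
Qed.

Lemma equivalent_refl q : equivalent q q.
Proof.
exists \1%VF; last by rewrite lim1g.
by split; [exists \1%VF => u; rewrite !id_lfunE | move=> u v; rewrite !id_lfunE].
Qed.

Lemma equivalent_sym q1 q2 : equivalent q1 q2 -> equivalent q2 q1.
Proof.
case=> xi axi ->; exists (xi^-1)%VF; first exact: lie_automorphismV.
by rewrite -limg_comp lker0_compVf ?lim1g // lie_automorphism_lker0.
Qed.

Lemma equivalent_trans q1 q2 q3 :
  equivalent q1 q2 -> equivalent q2 q3 -> equivalent q1 q3.
Proof.
case=> xi [bx xB] -> [eta [be eB] ->]; exists (eta \o xi)%VF; last by rewrite limg_comp.
split; last by move=> u v; rewrite !comp_lfunE xB eB.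
have [a Ka Kb] := bx; have [b Kc Kd] := be.
by exists (a \o b) => u; rewrite !comp_lfunE /= ?Kc ?Ka ?Kb ?Kd.
Qed.

Lemma mem_limg_automorphism xi U u :
  lie_automorphism xi -> (xi u \in (xi @: U)%VS) = (u \in U).
Proof.
by move=> a; rewrite !memvE -limg_line limg_ker0 // lie_automorphism_lker0.
Qed.

Lemma dim_limg_automorphism xi U : lie_automorphism xi -> \dim (xi @: U) = \dim U.
Proof.
move=> a; apply: limg_dim_eq; apply/eqP.
by rewrite (eqP (lie_automorphism_lker0 a)) capv0.
Qed.

Lemma limg_ideal xi d L :
  lie_automorphism xi -> ideal_of_dim d L -> ideal_of_dim d (xi @: L).
Proof.
move=> a [dL iL]; split; first by rewrite dim_limg_automorphism.
move=> x y /memv_imgP [v vL ->].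
have xE : x = xi ((xi^-1)%VF x) by rewrite lker0_lfunVK // lie_automorphism_lker0.
by rewrite xE -(proj2 a) memv_img // iL.
Qed.

Hypothesis dim_g : \dim {:g} = 4%N.

Lemma limg_generating3 xi q :
  lie_automorphism xi -> generating3 q -> generating3 (xi @: q).
Proof.
move=> a /(generating3P dim_g) [dq ns]; apply/(generating3P dim_g).
split; first by rewrite dim_limg_automorphism.
move=> H; apply: ns => u v uq vq.
by rewrite -(mem_limg_automorphism _ _ a) (proj2 a) H // memv_img.
Qed.

Lemma ideal1P L : ideal_of_dim 1 L <->
  exists2 l, l != 0 & L = <[l]>%VS /\ forall x, exists a, bracket x l = a *: l.
Proof.
split.
  case=> /dim1_line [l l0 ->] iL; exists l => //; split=> // x.
  by apply/vlineP; apply: iL; rewrite memv_line.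
case=> l l0 [-> il]; split; first by rewrite dim_vline l0.
move=> x y /vlineP [b ->]; have [a la] := il x.
by rewrite brZr la !memvZ // memv_line.
Qed.

Definition contains_no_ideal1 q :=
  forall I, ideal_of_dim 1 I -> ~~ (I <= q)%VS.

(* Two distinct lines of [q] that are ideals commute, so that [q] would be a subalgebra. *)
Lemma generating3_ideal1_unique q L1 L2 : generating3 q ->
  ideal_of_dim 1 L1 -> ideal_of_dim 1 L2 -> (L1 <= q)%VS -> (L2 <= q)%VS -> L1 = L2.
Proof.
move=> gq iL1 iL2 L1q L2q; apply/eqP; apply: contraT => L12.
have /ideal1P [l1 l10 [E1 b1]] := iL1; have /ideal1P [l2 l20 [E2 b2]] := iL2.
move: L1q L2q L12; rewrite E1 E2 -!memvE => l1q l2q L12.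
have fr2 : free [:: l1; l2].
  rewrite free_cons seq1_free l20 andbT span_seq1; apply: contra L12 => /vlineP [a la].
  rewrite eqEdim !dim_vline l10 l20 andbT la; apply/subvP => u /vlineP [b ->].
  by rewrite !memvZ // memv_line.
have dq : \dim q = 3%N by case: gq.
have /subvPn [x xq xl] : ~~ (q <= <<[:: l1; l2]>>)%VS.
  by apply/negP => /dimvS; rewrite dq (eqP fr2).
have fr3 : free [:: x; l1; l2] by rewrite free_cons xl.
have qE : q = <<[:: x; l1; l2]>>%VS.
  by apply: free_span_eq => // u; rewrite !inE => /or3P [] /eqP ->.
have [a1 ba1] := b1 x; have [a2 ba2] := b2 x.
have l12 : bracket l1 l2 = 0.
  have [c1 bc1] := b1 l2; have [c2 bc2] := b2 l1.
  have e : c2 *: l2 = - (c1 *: l1) by rewrite -bc1 -bc2 brC.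
  have /free2P H := fr2.
  have [] := H c1 c2; first by rewrite e subrr.
  by rewrite bc2 => _ ->; rewrite scale0r.
move: gq; rewrite qE => /(generating3_bracket dim_g).
by case=> /negP []; rewrite -qE ?ba1 ?ba2 ?l12 ?memvZ ?mem0v.
Qed.

(** What each type of algebra has to supply in the finite case. Lines are compared by equality here;
    the passage to lines up to equivalence is left to [ideal1_classification]. *)
Definition ideal1_classifies : Prop :=
  [/\ exists2 s : seq {vspace g}, (size s <= 3)%N & forall L, ideal_of_dim 1 L -> L \in s,
      forall L q1 q2, ideal_of_dim 1 L -> generating3 q1 -> generating3 q2 ->
        (L <= q1)%VS -> (L <= q2)%VS -> equivalent q1 q2,
      forall q1 q2, generating3 q1 -> generating3 q2 ->
        contains_no_ideal1 q1 -> contains_no_ideal1 q2 -> equivalent q1 q2,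
      forall L, ideal_of_dim 1 L -> exists2 q, generating3 q & (L <= q)%VS &
      exists2 q, generating3 q & contains_no_ideal1 q].

End Equivalence.

Lemma equivalence_representatives (T : eqType) (e : T -> T -> Prop) (P : T -> Prop)
    (s : seq T) :
  (forall x, e x x) -> (forall x y z, e x y -> e y z -> e x z) ->
  exists r : seq T, [/\ (size r <= size s)%N, forall x, x \in r -> P x, uniq r,
    forall x y, x \in r -> y \in r -> e x y -> x = y &
    forall x, x \in s -> P x -> exists2 y, y \in r & e y x].
Proof.
move=> e_refl e_trans; elim: s => [|x s [r [szr rP ur re sr]]].
  by exists [::]; split=> // x; rewrite in_nil.
have [Px|nPx] := pselect (P x); last first.
  exists r; split=> //; first exact: leqW.
  move=> y; rewrite inE => /predU1P [->|] //; exact: sr.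
have [[y yr exy]|nr] := pselect (exists2 y, y \in r & e y x).
  exists r; split=> //; first exact: leqW.
  by move=> z; rewrite inE => /predU1P [-> _|]; [exists y | exact: sr].
(* As [e] need not be symmetric, [x] may reach an old representative that does not reach [x]. Such
   representatives are dropped, and by transitivity [x] takes over what they represented. *)
pose r' := [seq y <- r | ~~ `[< e x y >]].
have r'P y : y \in r' -> y \in r /\ ~ e x y.
  by rewrite mem_filter => /andP [/asboolPn ? ->].
exists (x :: r'); split.
- by rewrite /= ltnS (leq_trans _ szr) // size_filter count_size.
- by move=> y; rewrite inE => /predU1P [->|/r'P [/rP]].
- rewrite /= filter_uniq // andbT; apply/negP => /r'P [_]; apply; exact: e_refl.
- move=> y z; rewrite !inE => /predU1P [->|/r'P [yr nxy]] /predU1P [->|/r'P [zr nxz]] //.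
  + by move=> eyx; case: nr; exists y.
  exact: re.
move=> y; rewrite inE => /predU1P [-> _|ys Py]; first by exists x; rewrite ?inE ?eqxx.
have [z zr ezy] := sr y ys Py.
have [exz|nexz] := pselect (e x z).
  by exists x; rewrite ?inE ?eqxx //; apply: e_trans ezy.
by exists z => //; rewrite inE mem_filter zr (introT (asboolPn _) nexz) orbT.
Qed.

Lemma ideal1_classification (K : fieldType) (g : lieAlgType K) :
  \dim {:g} = 4%N -> ideal1_classifies g ->
  exists m : nat, (m <= 3)%N /\
     (exists L : 'I_m -> {vspace g}, ideal1_representatives L) /\
     forall L : 'I_m -> {vspace g}, ideal1_representatives L ->
       exists C : 'I_m.+1 -> set {vspace g},
         [/\ injective C,
             range C = generating3_classes g,
             forall (i : 'I_m) (q : {vspace g}), generating3 q ->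
               (L i <= q)%VS -> C (widen_ord (leqnSn m) i) q
           & forall q : {vspace g}, generating3 q ->
               (forall I : {vspace g}, ideal_of_dim 1 I -> ~~ (I <= q)%VS) ->
               C ord_max q].
Proof.
move=> dim_g [[s szs sP] eqL eqN exL exN].
have [r [szr rP ur re sr]] := equivalence_representatives (ideal_of_dim 1) s
  (@equivalent_refl _ g) (@equivalent_trans _ g).
exists (size r); split; first exact: leq_trans szr szs.
split.
  exists (fun i => nth 0%VS r i); split.
  - by move=> i; apply: rP; rewrite mem_nth.
  - move=> i j /re; rewrite !mem_nth // => /(_ isT isT) /eqP.
    by rewrite nth_uniq // => /eqP /val_inj.
  - move=> I iI; have [y yr eyI] := sr I (sP I iI) iI.
    have yi : (index y r < size r)%N by rewrite index_mem.
    by exists (Ordinal yi); rewrite /= nth_index.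
(* The constructed list is forgotten: the classes must be described for every system of
   representatives of this size. *)
move: (size r) => {r szr rP ur re sr} m L [Li Linj Lall].
(* Asking for a line equivalent to [L i], and not for [L i] itself, makes the class stable under
   automorphisms. *)
pose contains_equivalent i q := exists2 I, ideal_of_dim 1 I & equivalent (L i) I /\ (I <= q)%VS.
(* [insub] fails only at the last index [m], which is kept for the hyperplanes without ideal
   line. *)
pose C (k : 'I_m.+1) := if insub (val k) is Some i
  then [set q | generating3 q /\ contains_equivalent i q]
  else [set q | generating3 q /\ contains_no_ideal1 q].
have Cw i : C (widen_ord (leqnSn m) i) = [set q | generating3 q /\ contains_equivalent i q].
  by rewrite /C /= valK.
have Cm : C ord_max = [set q | generating3 q /\ contains_no_ideal1 q].
  by rewrite /C /= insubF // ltnn.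
have kP (k : 'I_m.+1) : k = ord_max \/ exists i, k = widen_ord (leqnSn m) i.
  case: (ltnP k m) => km; last first.
    by left; apply/val_inj/eqP; rewrite /= eqn_leq km -ltnS ltn_ord.
  by right; exists (Ordinal km); apply: val_inj.
have Cgen k q : C k q -> generating3 q by case: (kP k) => [->|[i ->]]; rewrite ?Cm ?Cw => -[].
have Cne k : exists q, C k q.
  case: (kP k) => [->|[i ->]]; rewrite ?Cm ?Cw; first by have [q gq nq] := exN; exists q.
  have [q gq Lq] := exL _ (Li i); exists q; split=> //.
  by exists (L i) => //; split=> //; apply: equivalent_refl.
have Cinj k l q : C k q -> C l q -> k = l.
  case: (kP k) => [->|[i ->]]; case: (kP l) => [->|[j ->]] //; rewrite ?Cm ?Cw.
  - by move=> [_ nq] [_ [I /nq nI [_ Iq]]]; rewrite Iq in nI.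
  - by move=> [_ [I iI [_ Iq]]] [_ /(_ I iI)]; rewrite Iq.
  move=> [gq [I iI [eI Iq]]] [_ [J iJ [eJ Jq]]]; congr (widen_ord _ _); apply: Linj.
  rewrite -(generating3_ideal1_unique dim_g gq iI iJ Iq Jq) in eJ.
  exact: equivalent_trans eI (equivalent_sym eJ).
have Ceq k q1 q2 : C k q1 -> C k q2 -> equivalent q1 q2.
  case: (kP k) => [->|[i ->]]; rewrite ?Cm ?Cw.
    by move=> [gq1 n1] [gq2 n2]; apply: eqN.
  move=> [gq1 [I iI [eI Iq]]] [gq2 [J iJ [eJ Jq]]].
  (* The automorphism carrying [I] to [J] reduces to two hyperplanes through the same line [J]. *)
  have [xi axi JE] := equivalent_trans (equivalent_sym eI) eJ.
  apply: (@equivalent_trans _ _ _ (xi @: q1)%VS); first by exists xi.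
  by apply: (eqL J) => //; [exact: limg_generating3 | rewrite JE limgS].
have Cequiv k q1 q2 : C k q1 -> equivalent q1 q2 -> C k q2.
  move=> + [xi axi ->]; case: (kP k) => [->|[i ->]]; rewrite ?Cm ?Cw.
    move=> [gq nq]; split; first exact: limg_generating3.
    move=> I iI; have := nq _ (limg_ideal (lie_automorphismV axi) iI).
    apply: contra => Iq; apply/(subv_trans (limgS _ Iq)).
    by rewrite -limg_comp lker0_compVf ?lim1g // lie_automorphism_lker0.
  move=> [gq [I iI [eI Iq]]]; split; first exact: limg_generating3.
  exists (xi @: I)%VS; first exact: limg_ideal.
  by split; [apply: equivalent_trans eI _; exists xi | rewrite limgS].
have Call q : generating3 q -> exists k, C k q.
  move=> gq; have [[I iI Iq]|nI] := pselect (exists2 I, ideal_of_dim 1 I & (I <= q)%VS).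
    have [i ei] := Lall I iI; exists (widen_ord (leqnSn m) i); rewrite Cw.
    by split=> //; exists I.
  exists ord_max; rewrite Cm; split=> // I iI; apply/negP => Iq; apply: nI; by exists I.
have Cclass k q : C k q -> C k = [set q' | generating3 q' /\ equivalent q q'].
  move=> Ckq; apply/seteqP; split=> q' /=.
    by move=> Ckq'; split; [exact: Cgen Ckq' | exact: Ceq Ckq Ckq'].
  by move=> [_ /(Cequiv _ _ _ Ckq)].
exists C; split.
- by move=> k l kl; have [q Ckq] := Cne k; apply: (Cinj k l q) => //; rewrite -kl.
- apply/seteqP; split=> A /=.
    by case=> k _ <-; have [q Ckq] := Cne k; exists q;
      [exact: Cgen Ckq | rewrite -(Cclass _ _ Ckq)].
  by case=> q gq <-; have [k Ckq] := Call q gq; exists k => //; apply: Cclass.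
- move=> i q gq Lq; rewrite Cw; split=> //; exists (L i) => //; split=> //.
  exact: equivalent_refl.
by move=> q gq nq; rewrite Cm.
Qed.

(** * Changes of basis, and finiteness from roots of polynomials *)

(** Four vectors are free as soon as their span has dimension 4, so it is enough to recover the old
    basis inside any subspace that contains the new vectors. This avoids determinants in changes of
    basis. *)
Lemma free4_sub (K : fieldType) (V : vectType K) (x y z t x' y' z' t' : V) :
  free [:: x; y; z; t] ->
  (forall U : {vspace V}, x' \in U -> y' \in U -> z' \in U -> t' \in U ->
     [/\ x \in U, y \in U, z \in U & t \in U]) ->
  free [:: x'; y'; z'; t'].
Proof.
move=> fr H; rewrite /free eqn_leq dim_span /= -(eqP fr : _ = 4%N).
apply: dimvS; apply/span_subvP.
have [] := H <<[:: x'; y'; z'; t']>>%VS; try by rewrite memv_span // !inE eqxx ?orbT.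
by move=> xU yU zU tU u; rewrite !inE => /or4P [] /eqP ->.
Qed.

Lemma free3_sub (K : fieldType) (V : vectType K) (x y z x' y' z' : V) :
  free [:: x; y; z] ->
  (forall U : {vspace V}, x' \in U -> y' \in U -> z' \in U ->
     [/\ x \in U, y \in U & z \in U]) ->
  free [:: x'; y'; z'].
Proof.
move=> fr H; rewrite /free eqn_leq dim_span /= -(eqP fr : _ = 3%N).
apply: dimvS; apply/span_subvP.
have [] := H <<[:: x'; y'; z']>>%VS; try by rewrite memv_span // !inE eqxx ?orbT.
by move=> xU yU zU u; rewrite !inE => /or3P [] /eqP ->.
Qed.

Lemma mem_span3 (K : fieldType) (V : vectType K) (x y z : V) (U := <<[:: x; y; z]>>%VS) :
  [/\ x \in U, y \in U & z \in U].
Proof. by split; rewrite memv_span // !inE eqxx ?orbT. Qed.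

Lemma dim_ge3 (K : fieldType) (V : vectType K) (x y z : V) (U : {vspace V}) :
  free [:: x; y; z] -> x \in U -> y \in U -> z \in U -> (3 <= \dim U)%N.
Proof.
move=> fr xU yU zU; rewrite -(eqP fr : _ = 3%N); apply/dimvS/span_subvP => u.
by rewrite !inE => /or3P [] /eqP ->.
Qed.

Lemma plane_complement (K : fieldType) (V : vectType K) (U I : {vspace V}) (w u : V) :
  \dim U = 3%N -> \dim I = 2%N -> (I <= U)%VS -> w \in U -> w \notin I -> u \in U ->
  exists k, u - k *: w \in I.
Proof.
move=> dU dI IU wU wI uU; have UE : U = (<[w]> + I)%VS.
  have w0 : w != 0 by apply: contraNneq wI => ->; rewrite mem0v.
  apply/esym/eqP; rewrite eqEdim subv_add -memvE wU IU dU dimv_disjoint_sum ?dI ?dim_vline ?w0 //.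
  apply/eqP; rewrite -subv0; apply/subvP => x /memv_capP [/vlineP [k ->]].
  have [->|k0] := eqVneq k 0; first by rewrite scale0r !mem0v.
  by move/(memvZ k^-1); rewrite scalerK // (negPf wI).
move: uU; rewrite UE => /memv_addP [_ /vlineP [k ->] [i iI ->]].
by exists k; rewrite addrC addKr.
Qed.

Lemma poly_root_seq (K : fieldType) (p : {poly K}) : p != 0 ->
  exists2 s : seq K, (size s < size p)%N & forall x, root p x -> x \in s.
Proof.
elim: {p}(size p) {-2}p (leqnn (size p)) => [|n IHn] p.
  by rewrite leqn0 size_poly_eq0 => ->.
move=> szp p0; have [[x px]|npx] := pselect (exists x, root p x); last first.
  exists [::]; first by rewrite lt0n size_poly_eq0.
  by move=> x px; case: npx; exists x.
have [q pE] := factor_theorem _ _ px.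
have q0 : q != 0 by apply: contraNneq p0 => q0; rewrite pE q0 mul0r.
have szq : size p = (size q).+1 by rewrite pE size_Mmonic ?monicXsubC // size_XsubC addn2.
have [s szs sP] : exists2 s : seq K, (size s < size q)%N & forall y, root q y -> y \in s.
  by apply: IHn => //; rewrite -ltnS -szq.
exists (x :: s); first by rewrite szq ltnS.
by move=> y; rewrite pE rootM root_XsubC inE => /orP [/sP ->|->] //; rewrite orbT.
Qed.

(** For an explicit list of coefficients, constant term first, [horner_rec] unfolds by computation
    to a nested expression in [x], which the later eigenvalue equations match directly. *)
Lemma horner_rec_root_seq (K : fieldType) (s : seq K) : s != [::] -> last 0 s != 0 ->
  exists2 r : seq K, (size r <= (size s).-1)%N &
    forall x, horner_rec s x = 0 -> x \in r.
Proof.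
case: s => [|a s] // _ s0.
have sE : Poly (a :: s) = a :: s :> seq K by rewrite (PolyK (c := 0)).
have [|r szr rP] := @poly_root_seq K (Poly (a :: s)).
  by rewrite -size_poly_eq0 sE.
exists r; first by move: szr; rewrite sE.
by move=> x hx; apply: rP; rewrite /root horner_Poly hx.
Qed.

(** Each normal form decides on which side of the dichotomy it falls and proves the claim of that
    side. *)
Definition hyperplanes_classified (K : fieldType) (g : lieAlgType K) : Prop :=
  finite_set [set I | @ideal_of_dim K g 2 I] /\ ideal1_classifies g \/
  infinite_set [set I | @ideal_of_dim K g 2 I] /\
    forall q1 q2 : {vspace g}, generating3 q1 -> generating3 q2 -> equivalent q1 q2.

Lemma infinite_set_nat_inj (T : Type) (A : set T) (F : nat -> T) :
  (forall n, A (F n)) -> injective F -> infinite_set A.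
Proof.
move=> AF Finj fA; apply: infinite_nat.
apply: (@sub_finite_set _ _ (F @^-1` A)); first by move=> n _; exact: AF.
by apply: finite_preimage fA => m n _ _; exact: Finj.
Qed.

(** * Algebras with an abelian ideal of dimension three *)

Section AbelianIdeal.

Variables (K : realFieldType) (g : lieAlgType K).
Hypothesis dim_g : \dim {:g} = 4%N.
Variables (V : {vspace g}) (e0 : g).
Hypothesis dim_V : \dim V = 3%N.
Hypothesis abelian_V : forall u w : g, u \in V -> w \in V -> bracket u w = 0.
Hypothesis e0_notin_V : e0 \notin V.
Hypothesis A_stable : forall u, u \in V -> bracket e0 u \in V.

Implicit Types (u v w x y z e l : g) (q L I : {vspace g}).
Local Notation A := (bracket e0).

Let decomposition x : exists s, exists2 v, v \in V & x = s *: e0 + v.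
Proof.
have [f fV] := hyperplane_scalar dim_g dim_V.
have f0 : f e0 != 0 by rewrite -fV.
exists (f x / f e0), (x - (f x / f e0) *: e0); last by rewrite addrC subrK.
by rewrite fV linearB linearZ /= divfK // subrr.
Qed.

Let bracket_mod e u : e - e0 \in V -> u \in V -> bracket e u = A u.
Proof. by move=> eV uV; rewrite -{1}[e](subrK e0) brDl (abelian_V eV uV) add0r. Qed.

Let free_e0 e x y z : e - e0 \in V -> x \in V -> y \in V -> z \in V ->
  free [:: x; y; z] -> free [:: e; x; y; z].
Proof.
move=> eV xV yV zV fr; rewrite free_cons fr andbT.
rewrite -(@free_span_eq _ _ _ V fr) //; last by move=> u; rewrite !inE => /or3P [] /eqP ->.
by apply: contra e0_notin_V => eV'; rewrite -[e0](subKr e) memvB.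
Qed.

Let span_V x y z : x \in V -> y \in V -> z \in V -> free [:: x; y; z] ->
  V = <<[:: x; y; z]>>%VS.
Proof.
by move=> *; apply: free_span_eq => // u; rewrite !inE => /or3P [] /eqP ->.
Qed.

(** The abelian [V] is a subalgebra, so [q] differs from it, meets it in a plane and contains a
    vector congruent to [e0] modulo [V]. *)
Let hyperplane_frame q : generating3 q -> exists e p1 p2,
  [/\ e - e0 \in V, p1 \in V, p2 \in V, free [:: e; p1; p2] & q = <<[:: e; p1; p2]>>%VS].
Proof.
move=> gq; have [dq _] := gq.
have /subvPn [x xq xV] : ~~ (q <= V)%VS.
  apply/negP => qV; have qE : q = V by apply/eqP; rewrite eqEdim qV dim_V dq.
  by move: gq => /(generating3P dim_g) [_ []] u v; rewrite qE => uV vV; rewrite abelian_V ?mem0v.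
have [s [v vV xE]] := decomposition x.
have s0 : s != 0 by apply: contraNneq xV => s0; rewrite xE s0 scale0r add0r.
have dcap : \dim (q :&: V) = 2%N.
  have := dimv_sum_cap q V; suff -> : (q + V)%VS = fullv by rewrite dim_g dq dim_V; case.
  apply: dim4_full => //; apply/eqP; rewrite eqn_leq -{1}dim_g dimvS ?subvf //= -dim_V.
  rewrite ltn_neqAle (dimv_leqif_sup (addvSr q V)) dimvS ?addvSr // andbT.
  by apply/negP => /subvP /(_ x); rewrite (subvP (addvSl q V)) // => /(_ isT); apply/negP.
have [p1 [p2 [fr pE]]] := dim2_span dcap.
have /memv_capP [p1q p1V] : p1 \in (q :&: V)%VS by rewrite pE memv_span // inE eqxx.
have /memv_capP [p2q p2V] : p2 \in (q :&: V)%VS by rewrite pE memv_span // !inE eqxx orbT.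
exists (s^-1 *: x), p1, p2.
have fr3 : free [:: s^-1 *: x; p1; p2].
  rewrite free_cons fr andbT -pE; apply: contra xV => /memv_capP [_].
  by move=> /(memvZ s); rewrite scalerA divff // scale1r.
split=> //.
  by rewrite xE scalerDr scalerA mulVf // scale1r addrC addKr memvZ.
by apply: free_span_eq => // u; rewrite !inE => /or3P [] /eqP ->; rewrite ?memvZ.
Qed.

(** The plane [P] in which [q] meets [V] is not stable under [A], so the vectors of [P] that [A]
    keeps in [P] form a line, spanned by some [v]. Here [A v] is off this line, and [v], [A v] span
    [P]. *)
Definition cyclic_hyperplane q := exists e v,
  [/\ e - e0 \in V, v \in V, free [:: v; A v; A (A v)] & q = <<[:: e; v; A v]>>%VS].

(** The other alternative: [v] is an eigenvector. The quotient of [V] by [v] carries the polynomial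
    [X^2 - c X - b], and [d] records how the eigenline is glued to that quotient. *)
Definition eigen_hyperplane (lam b c d : K) v q := exists e y,
  [/\ e - e0 \in V, v \in V /\ A v = lam *: v,
      [/\ y \in V, free [:: v; y; A y] & A (A y) = b *: y + c *: A y + d *: v]
    & q = <<[:: e; v; y]>>%VS].

Let hyperplane_type_aux q e y p : e - e0 \in V -> y \in V -> p \in V ->
  \dim q = 3%N -> q = <<[:: e; y; p]>>%VS -> A y \notin q ->
  cyclic_hyperplane q \/ exists lam b c d v, eigen_hyperplane lam b c d v q.
Proof.
move=> eV yV pV dq qE Ayq.
have frq : free [:: e; y; p] by rewrite /free -qE dq.
have fr : free [:: A y; y; p].
  rewrite free_cons (catr_free (frq : free ([:: e] ++ _))) andbT.
  by apply: contra Ayq => Ay; rewrite qE span_cons (subvP (addvSr _ _)).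
have yE : V = <<[:: A y; y; p]>>%VS by apply: span_V => //; exact: A_stable.
have [c [a [b ApE]]] : exists c a b, A p = c *: A y + a *: y + b *: p.
  by apply/in_span3; rewrite -yE A_stable.
(* Subtracting [c *: y] cancels the component of [A p] along [A y], so that [A v] stays in the plane
   of [y] and [p]. *)
pose v := p - c *: y.
have vV : v \in V by rewrite memvB // memvZ.
have pE : p = v + c *: y by rewrite subrK.
have AvE : A v = (a + b * c) *: y + b *: v.
  by rewrite /v !brE ApE; vring.
have [eq yq pq] : [/\ e \in q, y \in q & p \in q] by rewrite qE; apply: mem_span3.
have vq : v \in q by rewrite memvB // memvZ.
have qE' U : U = <<[:: e; v; y]>>%VS -> q = U.
  move=> ->; apply: free_span_eq => //.
    apply: (free3_sub frq) => W eW vW yW.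
    by split=> //; rewrite pE memvD // memvZ.
  by move=> u; rewrite !inE => /or3P [] /eqP ->.
have [k0|k0] := eqVneq (a + b * c) 0.
  right; rewrite k0 scale0r add0r in AvE.
  have fr' : free [:: v; y; A y].
    apply: (free3_sub fr) => W vW yW AW; split=> //; by rewrite pE memvD // memvZ.
  have [d [b' [c' AAyE]]] : exists d b c, A (A y) = d *: v + b *: y + c *: A y.
    by apply/in_span3; rewrite -(span_V _ _ _ fr') ?A_stable.
  exists b, b', c', d, v, e, y; split=> //; last exact: qE'.
  by split=> //; rewrite AAyE addrAC addrC -addrA addrC -addrA addrC addrAC addrC addrA.
left; exists e, v.
have ydef : y = (a + b * c)^-1 *: (A v - b *: v) by rewrite AvE addrK scalerK.
have AAvE : A (A v) = (a + b * c) *: A y + b *: A v by rewrite [in LHS]AvE !brE.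
have Aydef : A y = (a + b * c)^-1 *: (A (A v) - b *: A v) by rewrite AAvE addrK scalerK.
split=> //.
  apply: (free3_sub fr) => W vW AvW AAvW.
  have yW : y \in W by rewrite ydef memvZ // memvB // memvZ.
  by split=> //; [rewrite Aydef memvZ // memvB // memvZ | rewrite pE memvD // memvZ].
apply: free_span_eq => //.
  apply: (free3_sub frq) => W eW vW AvW.
  have yW : y \in W by rewrite ydef memvZ // memvB // memvZ.
  by split=> //; rewrite pE memvD // memvZ.
by move=> u; rewrite !inE => /or3P [] /eqP -> //; rewrite AvE memvD // memvZ.
Qed.

Lemma hyperplane_type q : generating3 q ->
  cyclic_hyperplane q \/ exists lam b c d v, eigen_hyperplane lam b c d v q.
Proof.
move=> gq; have [e [p1 [p2 [eV p1V p2V fr qE]]]] := hyperplane_frame gq.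
have dq : \dim q = 3%N by case: gq.
move: (gq); rewrite {1}qE => /(generating3_bracket dim_g).
rewrite -qE (bracket_mod eV p1V) (bracket_mod eV p2V).
case=> [ny|ny|]; last by rewrite (abelian_V p1V p2V) mem0v.
  exact: (@hyperplane_type_aux q e p1 p2).
apply: (@hyperplane_type_aux q e p2 p1) => //; rewrite qE; apply: eq_span => u.
by rewrite !inE [(u == p1) || _]orbC.
Qed.

(** A relation polynomial in [A] that holds at a cyclic vector holds on all of [V], since [A]
    commutes with its powers. *)
Lemma cubic_relation v : v \in V -> free [:: v; A v; A (A v)] ->
  exists a b c, forall u, u \in V -> A (A (A u)) = a *: u + b *: A u + c *: A (A u).
Proof.
move=> vV fr; have VE : V = <<[:: v; A v; A (A v)]>>%VS.
  by apply: span_V => //; rewrite !A_stable.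
have [a [b [c E]]] : exists a b c, A (A (A v)) = a *: v + b *: A v + c *: A (A v).
  by apply/in_span3; rewrite -VE !A_stable.
exists a, b, c => u; rewrite VE => /in_span3 [p [r [s ->]]].
by rewrite !(brE, E); vring.
Qed.

(** In the basis [e], [v], [A v], [A (A v)] the only structure constants besides 0 and 1 are the
    coefficients of the characteristic polynomial of [A], the same for all [v]. *)
Lemma cyclic_hyperplane_equivalent q1 q2 :
  cyclic_hyperplane q1 -> cyclic_hyperplane q2 -> equivalent q1 q2.
Proof.
move=> [e1 [v1 [e1V v1V fr1 ->]]] [e2 [v2 [e2V v2V fr2 ->]]].
have [a [b [c E]]] := cubic_relation v1V fr1.
apply: (frame_iso dim_g (t := A (A v1)) (t' := A (A v2))).
- by apply: free_e0; rewrite ?A_stable.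
- by apply: free_e0; rewrite ?A_stable.
have [Av1 Av2] := (A_stable v1V, A_stable v2V).
have [AAv1 AAv2] := (A_stable Av1, A_stable Av2).
move=> xi xe xv xA xAA.
rewrite !(bracket_mod e1V v1V, bracket_mod e1V Av1, bracket_mod e1V AAv1).
rewrite !(bracket_mod e2V v2V, bracket_mod e2V Av2, bracket_mod e2V AAv2).
rewrite (abelian_V v1V Av1) (abelian_V v1V AAv1) (abelian_V Av1 AAv1).
rewrite (abelian_V v2V Av2) (abelian_V v2V AAv2) (abelian_V Av2 AAv2) !E //.
by rewrite !(linearD, linearZ, linear0) /= xv xA xAA.
Qed.

Lemma eigen_hyperplane_equivalent lam b c d v1 v2 q1 q2 :
  eigen_hyperplane lam b c d v1 q1 -> eigen_hyperplane lam b c d v2 q2 ->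
  equivalent q1 q2.
Proof.
move=> [e1 [y1 [e1V [v1V Av1] [y1V fr1 AAy1] ->]]].
move=> [e2 [y2 [e2V [v2V Av2] [y2V fr2 AAy2] ->]]].
apply: (frame_iso dim_g (t := A y1) (t' := A y2)).
- by apply: free_e0; rewrite ?A_stable.
- by apply: free_e0; rewrite ?A_stable.
have [Ay1 Ay2] := (A_stable y1V, A_stable y2V).
move=> xi xe xv xy xA.
rewrite !(bracket_mod e1V v1V, bracket_mod e1V y1V, bracket_mod e1V Ay1).
rewrite !(bracket_mod e2V v2V, bracket_mod e2V y2V, bracket_mod e2V Ay2).
rewrite (abelian_V v1V y1V) (abelian_V v1V Ay1) (abelian_V y1V Ay1) Av1 AAy1.
rewrite (abelian_V v2V y2V) (abelian_V v2V Ay2) (abelian_V y2V Ay2) Av2 AAy2.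
by rewrite !(linearD, linearZ, linear0) /= xv xy xA.
Qed.

(** Replacing [y] by [y + w *: v] leaves [q] alone and adds [w * (lam^2 - c * lam - b)] to [d]; when
    that factor is invertible the eigenline splits off. *)
Lemma eigen_hyperplane_kill lam b c d v q : lam ^+ 2 != c * lam + b ->
  eigen_hyperplane lam b c d v q -> eigen_hyperplane lam b c 0 v q.
Proof.
move=> k0 [e [y [eV [vV Av] [yV fr AAy] ->]]].
pose w := - d / (lam ^+ 2 - c * lam - b).
have k0' : lam ^+ 2 - c * lam - b != 0 by rewrite -addrA -opprD subr_eq0.
have AyE : A (y + w *: v) = A y + (w * lam) *: v by rewrite !brE Av; vring.
exists e, (y + w *: v); split=> //.
  split; first by rewrite memvD // memvZ.
    apply: (free3_sub fr) => W vW yW AW.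
    have yW' : y \in W by rewrite -[y](addrK (w *: v)) memvB // memvZ.
    by split=> //; rewrite -[A y](addrK ((w * lam) *: v)) -AyE memvB // memvZ.
  rewrite AyE !brE AAy Av.
  by apply: scalar_ext => f; rewrite !(linearD, linearN, linearZ, linear0) /= /w; field.
have [e1 v1 y1] := mem_span3 e v y; have [e2 v2 y2] := mem_span3 e v (y + w *: v).
apply/eqP; rewrite eqEsubv; apply/andP; split; apply/span_subvP => u.
  rewrite !inE => /or3P [] /eqP -> //.
  by rewrite -[X in X \in _](addrK (w *: v)) memvB // memvZ.
by rewrite !inE => /or3P [] /eqP -> //; rewrite memvD // memvZ.
Qed.

Lemma eigen_hyperplane_scale lam b c d v q : d != 0 ->
  eigen_hyperplane lam b c d v q -> eigen_hyperplane lam b c 1 (d *: v) q.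
Proof.
move=> d0 [e [y [eV [vV Av] [yV fr AAy] ->]]]; exists e, y; split=> //.
- by split; [rewrite memvZ | rewrite brZr Av; vring].
- split=> //; last by rewrite AAy scale1r.
  by apply: (free3_sub fr) => W /(memvZ d^-1); rewrite scalerK.
have [e1 v1 y1] := mem_span3 e v y; have [e2 v2 y2] := mem_span3 e (d *: v) y.
apply/eqP; rewrite eqEsubv; apply/andP; split; apply/span_subvP => u.
  rewrite !inE => /or3P [] /eqP -> //.
  by rewrite -[X in X \in _](scalerK d0) memvZ.
by rewrite !inE => /or3P [] /eqP -> //; rewrite memvZ.
Qed.

(** If [d] is nonzero, [y] is cyclic. Otherwise [lam] is not a root of the polynomial of the
    quotient, and [y + v] is cyclic as a sum of generators of two summands with coprime
    polynomials. *)
Lemma eigen_hyperplane_cyclic lam b c d v q :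
  lam ^+ 2 != c * lam + b \/ d != 0 -> eigen_hyperplane lam b c d v q ->
  exists2 w, w \in V & free [:: w; A w; A (A w)].
Proof.
move=> nd [e [y [eV [vV Av] [yV fr AAy] _]]].
have [d0|d0] := eqVneq d 0; last first.
  exists y => //; apply: (free3_sub fr) => W yW AyW AAyW; split=> //.
  rewrite -[v](scalerK d0) memvZ // -(addKr (b *: y + c *: A y) (d *: v)) -AAy addrC.
  by rewrite memvB // memvD // memvZ.
have k0 : lam ^+ 2 - c * lam - b != 0.
  by case: nd; rewrite ?d0 ?eqxx // => k0; rewrite -addrA -opprD subr_eq0.
exists (y + v); first by rewrite memvD.
apply: (free3_sub fr) => W; rewrite !brE AAy d0 Av !brE Av => m0 m1 m2.
have vW : v \in W.
  rewrite -[v](scalerK k0) memvZ //.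
  rewrite (_ : _ *: v = (b *: y + c *: A y + 0 *: v + lam *: (lam *: v))
    - c *: (A y + lam *: v) - b *: (y + v)).
    by rewrite !memvB // memvZ.
  by vring.
split=> //; first by rewrite -[y](addrK v) memvB.
by rewrite -[A y](addrK (lam *: v)) memvB // memvZ.
Qed.

Lemma eigen_ideal1 v lam : v \in V -> v != 0 -> A v = lam *: v -> ideal_of_dim 1 <[v]>%VS.
Proof.
move=> vV v0 Av; apply/ideal1P; exists v => //; split=> // x.
have [s [w wV ->]] := decomposition x.
by exists (s * lam); rewrite !brE Av (abelian_V wV vV) addr0 scalerA.
Qed.

(** If [l] had a component along [e0], its bracket with [w] would be a nonzero multiple both of [l]
    and of [A w], which lies in [V]. *)
Lemma ideal1_eigen L w : w \in V -> A w != 0 -> ideal_of_dim 1 L ->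
  exists l lam, [/\ l != 0, l \in V, A l = lam *: l & L = <[l]>%VS].
Proof.
move=> wV Aw0 /ideal1P [l l0 [-> il]].
have [lam Al] := il e0; exists l, lam; split=> //.
have [s [v vV lE]] := decomposition l.
have [a] := il w; rewrite {1}lE !brE (abelian_V wV vV) addr0 brC => E.
have [s0|s0] := eqVneq s 0; first by rewrite lE s0 scale0r add0r.
have [a0|a0] := eqVneq a 0.
  by case/eqP: Aw0; rewrite -[A w]opprK -[- A w](scalerK s0) E a0 scale0r scaler0 oppr0.
by rewrite -[l](scalerK a0) -E !memvZ // memvN A_stable.
Qed.

(** An eigenvector in the plane of [w] and [A w] would be an annihilator of [w] of degree at most
    2. *)
Lemma eigen_free_cyclic w l lam : w \in V -> free [:: w; A w; A (A w)] ->
  l != 0 -> A l = lam *: l -> free [:: l; w; A w].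
Proof.
move=> wV fr l0 Al; rewrite free_cons.
have fr2 : free [:: w; A w] by apply: (@catl_free _ _ [:: A (A w)]).
rewrite fr2 andbT; apply: contra l0 => /in_span2 [a [b lE]].
have /free3P H := fr; move: Al; rewrite lE !brE => E.
have [] := H (- lam * a) (a - lam * b) b.
  transitivity ((a *: A w + b *: A (A w)) - lam *: (a *: w + b *: A w)); first by vring.
  by rewrite E subrr.
by move=> _ E1 b0; move: E1; rewrite b0 mulr0 subr0 => ->; rewrite !scale0r addr0.
Qed.

(** A plane ideal [I] lies in [V], is stable under [A] and misses [w]. It is therefore determined by
    the scalar [k] by which [A] acts on the quotient of [V] by [I], an eigenvalue of [A]. *)
Lemma cyclic_finite_ideal2 w : w \in V -> free [:: w; A w; A (A w)] ->
  finite_set [set I | @ideal_of_dim K g 2 I].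
Proof.
move=> wV fr; have [a [b [c E]]] := cubic_relation wV fr.
have [AwV AAwV] : A w \in V /\ A (A w) \in V by rewrite !A_stable.
(* The list is minus the characteristic polynomial of [A]. *)
have [|r _ rP] := @horner_rec_root_seq K [:: a; b; c; -1] isT.
  by rewrite /= oppr_eq0 oner_eq0.
pose F k := <<[:: A w - k *: w; A (A w) - k *: A w]>>%VS.
apply: (@sub_finite_set _ _ (F @` [set` r])); last exact/finite_image/finite_seq.
move=> I [dI iI].
have IV : (I <= V)%VS.
  (* An element [x] of [I] outside [V] would bring the whole image of [A] into [I], hence the three
     independent vectors [x], [A w], [A (A w)]. *)
  apply/subvP => x xI; apply: contraT => xV.
  have [s [v vV xE]] := decomposition x.
  have s0 : s != 0 by apply: contraNneq xV => s0; rewrite xE s0 scale0r add0r.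
  have mI u : u \in V -> A u \in I.
    move=> uV; have := iI u x xI; rewrite xE !brE (abelian_V uV vV) addr0 brC => /(memvZ s^-1).
    by rewrite scalerK // memvN.
  have [AwI AAwI] := (mI w wV, mI (A w) AwV).
  have fr2 : free [:: A w; A (A w)] by apply: (catr_free (fr : free ([:: w] ++ _))).
  have := @dim_ge3 _ _ x (A w) (A (A w)) I; rewrite dI free_cons fr2 andbT.
  move=> H; have : (3 <= 2)%N; last by [].
  apply: H => //; apply: contra xV => /in_span2 [p [q ->]].
  by rewrite memvD // memvZ.
have wI : w \notin I.
  apply/negP => wI; have AwI := iI e0 _ wI; have AAwI := iI e0 _ AwI.
  by have := dim_ge3 fr wI AwI AAwI; rewrite dI.
have [k kI] := plane_complement dim_V dI IV wV wI AwV.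
have AkI : A (A w) - k *: A w \in I by have := iI e0 _ kI; rewrite !brE.
exists k; last first.
  rewrite /F; apply/esym/free_span_eq => //; last by move=> u; rewrite !inE => /orP [] /eqP ->.
  apply/free2P => p q pq0; have /free3P H := fr.
  have [] := H (- k * p) (p - k * q) q.
    by rewrite -pq0; vring.
  by move=> _ + q0; rewrite q0 mulr0 subr0.
apply: rP => /=; apply: contraNeq wI => h0.
have := iI e0 _ AkI; rewrite !brE E // => m1.
have hI : ((((0 * k + -1) * k + c) * k + b) * k + a) *: w \in I.
  rewrite (_ : _ *: w = (a *: w + b *: A w + c *: A (A w) - k *: A (A w))
    - (c - k) *: (A (A w) - k *: A w) - (b + (c - k) * k) *: (A w - k *: w)); last by vring.
  by apply: memvB; [apply: memvB m1 _; exact: memvZ | exact: memvZ].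
by rewrite -[w](scalerK h0) memvZ.
Qed.

(** With a cyclic vector each eigenvalue has a single eigenline, so there are at most three ideal
    lines. A generating hyperplane through such a line is of eigen type; the line fixes [lam], [b]
    and [c], and [d] can be normalised to 0 or 1. *)
Lemma cyclic_ideal1_classifies w : w \in V -> free [:: w; A w; A (A w)] ->
  ideal1_classifies g.
Proof.
move=> wV fr; have [a [b [c E]]] := cubic_relation wV fr.
have [AwV AAwV] : A w \in V /\ A (A w) \in V by rewrite !A_stable.
have Aw0 : A w != 0 by apply: free_not0 fr _; rewrite !inE eqxx orbT.
have e0e0 : e0 - e0 \in V by rewrite subrr mem0v.
have no_eigen_in_cyclic q l : cyclic_hyperplane q -> l \in V -> l != 0 ->
    (exists lam, A l = lam *: l) -> l \notin q.
  move=> [e [v [eV vV frv ->]]] lV l0 [lam Al].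
  have := eigen_free_cyclic vV frv l0 Al => frl.
  have : free [:: e; l; v; A v] by apply: free_e0; rewrite ?A_stable.
  move=> fr4; have : free [:: l; e; v; A v].
    by apply: (free4_sub fr4) => U ? ? ? ?; split.
  by rewrite free_cons => /andP [].
(* Failing both conditions, [A] would satisfy a quadratic equation, against the existence of a
   cyclic vector. *)
have nondegenerate lam b' c' d' v q : eigen_hyperplane lam b' c' d' v q ->
    lam ^+ 2 != c' * lam + b' \/ d' != 0.
  move=> [e [y [eV [vV Av] [yV fry AAy] _]]].
  have [lamE|] := eqVneq (lam ^+ 2) (c' * lam + b'); last by left.
  right; apply/eqP => d0.
  have VE : V = <<[:: v; y; A y]>>%VS by apply: span_V => //; rewrite A_stable.
  have [p [r [s wE]]] : exists p r s, w = p *: v + r *: y + s *: A y by apply/in_span3; rewrite -VE.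
  have /free3P /(_ (- b') (- c') 1) := fr; case=> [|_ _ /eqP]; last by rewrite oner_eq0.
  rewrite wE !(brE, Av, AAy) d0.
  rewrite (_ : p *: (lam *: (lam *: v)) = (p * lam ^+ 2) *: v); last by vring.
  by rewrite lamE; vring.
split.
- have [|r szr rP] := @horner_rec_root_seq K [:: a; b; c; -1] isT.
    by rewrite /= oppr_eq0 oner_eq0.
  (* The eigenvector for [k] is the value at [w] of the characteristic polynomial divided by
     [X - k]. *)
  exists [seq <[(k ^+ 2 - c * k - b) *: w + (k - c) *: A w + A (A w)]>%VS | k <- r].
    by rewrite size_map.
  move=> L /(ideal1_eigen wV Aw0) [l [k [l0 lV Al LE]]].
  have VE : V = <<[:: w; A w; A (A w)]>>%VS by apply: span_V.
  have [p [t [s lE]]] : exists p t s, l = p *: w + t *: A w + s *: A (A w).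
    by apply/in_span3; rewrite -VE.
  have /free3P /(_ (s * a - k * p) (p + s * b - k * t) (t + s * c - k * s)) := fr.
  case=> [|E1 E2 E3].
    transitivity (A l - k *: l); last by rewrite Al subrr.
    by rewrite lE !brE E //; vring.
  have tE : t = s * (k - c) by rewrite -[LHS]subr0 -E3; ring.
  have pE : p = s * (k ^+ 2 - c * k - b).
    have -> : p = (p + s * b - k * t) + k * t - s * b by ring.
    by rewrite E2 tE; ring.
  have s0 : s != 0.
    by apply: contraNneq l0 => s0; rewrite lE pE tE s0 !mul0r !scale0r !addr0.
  apply/mapP; exists k.
    apply: rP => /=; apply: (mulfI s0); rewrite mulr0.
    by transitivity (s * a - k * p); [rewrite pE; ring | exact: E1].
  rewrite LE lE pE tE; apply/eqP; rewrite eqEsubv; apply/andP; split; rewrite -memvE; apply/vlineP.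
    by exists s; vring.
  exists s^-1; rewrite -!scalerA -!scalerDr scalerK //.
- move=> L q1 q2 iL g1 g2 Lq1 Lq2.
  have [l [lam [l0 lV Al LE]]] := ideal1_eigen wV Aw0 iL.
  have eigen q : generating3 q -> (L <= q)%VS ->
      exists b c d v, eigen_hyperplane lam b c d v q /\ exists2 s, s != 0 & v = s *: l.
    move=> gq; rewrite LE -memvE => lq; case: (hyperplane_type gq) => [/no_eigen_in_cyclic|].
      by move=> /(_ l lV l0) H; move: lq; rewrite (negPf (H _)) //; exists lam.
    move=> [mu [b' [c' [d' [v H]]]]]; exists b', c', d', v.
    have [e [y [eV [vV Av] [yV fry AAy] qE]]] := H.
    have v0 : v != 0 by apply: free_not0 fry _; rewrite inE eqxx.
    have vq : (<[v]> <= q)%VS by rewrite -memvE qE memv_span // !inE eqxx orbT.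
    have := generating3_ideal1_unique dim_g gq iL (eigen_ideal1 vV v0 Av).
    rewrite {1}LE -memvE => /(_ lq vq); rewrite LE => lv.
    have /vlineP [s vE] : v \in <[l]>%VS by rewrite lv memv_line.
    have s0 : s != 0 by apply: contraNneq v0 => s0; rewrite vE s0 scale0r.
    suff <- : mu = lam by split=> //; exists s.
    apply/eqP; rewrite -subr_eq0; apply: contraNT v0 => k0.
    by rewrite -[v](scalerK k0) scalerBl -Av vE brZr Al scalerA mulrC -scalerA subrr scaler0.
  have [b1 [c1 [d1 [v1 [H1 [s1 s10 v1E]]]]]] := eigen q1 g1 Lq1.
  have [b2 [c2 [d2 [v2 [H2 [s2 s20 v2E]]]]]] := eigen q2 g2 Lq2.
  (* Both pairs are the coefficients of the operator induced by [A] on the quotient of [V] by the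
     common line [L]. *)
  have [bE cE] : b1 = b2 /\ c1 = c2.
    have [e1' [y1 [e1V [v1V Av1] [y1V fr1 AAy1] q1E]]] := H1.
    have [e2' [y2 [e2V [v2V Av2] [y2V fr2 AAy2] q2E]]] := H2.
    have VE : V = <<[:: v2; y2; A y2]>>%VS by apply: span_V => //; rewrite A_stable.
    have [p [r [s y1E]]] : exists p r s, y1 = p *: v2 + r *: y2 + s *: A y2.
      by apply/in_span3; rewrite -VE.
    have AA2 : exists m, A (A y1) = b2 *: y1 + c2 *: A y1 + m *: v1.
      have v2E' : v2 = (s2 / s1) *: v1 by rewrite v2E v1E scalerA divfK.
      exists ((p * (lam ^+ 2 - c2 * lam - b2) + r * d2 + s * d2 * lam) * (s2 / s1)).
      by rewrite -[(_ * (s2 / s1)) *: v1]scalerA -v2E' y1E !(brE, Av2, AAy2); vring.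
    have [m AAm] := AA2.
    have /free3P /(_ (d1 - m) (b1 - b2) (c1 - c2)) := fr1; case.
      transitivity (A (A y1) - A (A y1)); last by rewrite subrr.
      by rewrite {1}AAy1 AAm; vring.
    by move=> _ /eqP; rewrite subr_eq0 => /eqP ? /eqP; rewrite subr_eq0 => /eqP ?.
  subst b2 c2.
  (* Off the roots of the quotient polynomial [d] is reduced to 0; at a root it is nonzero and is
     rescaled to 1. *)
  have [lamE|lamE] := eqVneq (lam ^+ 2) (c1 * lam + b1); last first.
    have H1' := eigen_hyperplane_kill lamE H1; have H2' := eigen_hyperplane_kill lamE H2.
    exact: (eigen_hyperplane_equivalent H1' H2').
  have d10 : d1 != 0 by case: (nondegenerate _ _ _ _ _ _ H1) => //; rewrite lamE eqxx.
  have d20 : d2 != 0 by case: (nondegenerate _ _ _ _ _ _ H2) => //; rewrite lamE eqxx.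
  exact: (eigen_hyperplane_equivalent (eigen_hyperplane_scale d10 H1)
    (eigen_hyperplane_scale d20 H2)).
- have cyc q : generating3 q -> contains_no_ideal1 q -> cyclic_hyperplane q.
    move=> gq nq; case: (hyperplane_type gq) => // -[mu [b' [c' [d' [v H]]]]].
    have [e [y [eV [vV Av] [yV fry AAy] qE]]] := H.
    have v0 : v != 0 by apply: free_not0 fry _; rewrite inE eqxx.
    by have := nq _ (eigen_ideal1 vV v0 Av); rewrite -memvE qE memv_span // !inE eqxx orbT.
  by move=> q1 q2 g1 g2 n1 n2; apply: cyclic_hyperplane_equivalent; apply: cyc.
- move=> L /(ideal1_eigen wV Aw0) [l [k [l0 lV Al ->]]].
  have frl := eigen_free_cyclic wV fr l0 Al.
  have fr4 : free [:: A w; e0; w; l].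
    apply: (free4_sub (free_e0 e0e0 lV wV AwV frl)) => U *; by split.
  exists <<[:: e0; w; l]>>%VS; last by rewrite -memvE memv_span // !inE eqxx !orbT.
  by move: fr4; rewrite free_cons => /andP [? ?]; apply: generating3_span.
have fr4 : free [:: A (A w); e0; A w; w].
  apply: (free4_sub (free_e0 e0e0 wV AwV AAwV fr)) => U *; by split.
have gq : generating3 <<[:: e0; A w; w]>>%VS.
  by move: fr4; rewrite free_cons => /andP [? ?]; apply: generating3_span.
exists <<[:: e0; A w; w]>>%VS => //.
have cq : cyclic_hyperplane <<[:: e0; A w; w]>>%VS.
  exists e0, w; split=> //; apply: eq_span => u.
  by rewrite !inE [(u == w) || _]orbC.
move=> L /(ideal1_eigen wV Aw0) [l [k [l0 lV Al ->]]].
by rewrite -memvE; apply: no_eigen_in_cyclic cq _ _ _ => //; exists k.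
Qed.

Lemma degenerate_relation lam b c v q : lam ^+ 2 = c * lam + b ->
  eigen_hyperplane lam b c 0 v q -> forall u, u \in V -> A (A u) = b *: u + c *: A u.
Proof.
move=> lamE [e [y [eV [vV Av] [yV fr AAy] _]]] u.
rewrite (span_V vV yV (A_stable yV) fr) => /in_span3 [p [r [s ->]]].
rewrite !(brE, Av, AAy) (_ : p *: (lam *: (lam *: v)) = (p * lam ^+ 2) *: v); last by vring.
by rewrite lamE; vring.
Qed.

(** Since [A] satisfies a quadratic equation, any vector of [V] and its image span a stable
    subspace; the vectors [y + n v] give pairwise different planes. *)
Lemma degenerate_infinite_ideal2 lam b c v q : lam ^+ 2 = c * lam + b ->
  eigen_hyperplane lam b c 0 v q -> infinite_set [set I | @ideal_of_dim K g 2 I].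
Proof.
move=> lamE H; have rel := degenerate_relation lamE H.
have [e [y [eV [vV Av] [yV fr AAy] _]]] := H.
have /free3P H3 := fr.
pose F (n : nat) : {vspace g} := (<<[:: (y + n%:R *: v)%R; (A y + (n%:R * lam) *: v)%R]>>)%VS.
have FE n : ideal_of_dim 2 (F n).
  split.
    apply/eqP; suff : free [:: y + n%:R *: v; A y + (n%:R * lam) *: v] by [].
    apply/free2P => p r pr0; have [|_ -> -> //] := H3 (p * n%:R + r * (n%:R * lam)) p r.
    by rewrite -pr0; vring.
  have yFV : y + n%:R *: v \in V by rewrite memvD // memvZ.
  have AyF : A (y + n%:R *: v) = A y + (n%:R * lam) *: v by rewrite !brE Av; vring.
  move=> x u uF; have uV : u \in V.
    by move: uF => /in_span2 [p [r ->]]; rewrite memvD // memvZ // memvD ?A_stable // memvZ.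
  have [s [w wV ->]] := decomposition x.
  rewrite !brE (abelian_V wV uV) addr0 memvZ //.
  move: uF yFV; rewrite /F -AyF; move: (y + n%:R *: v) => w0 /in_span2 [p [r ->]] w0V.
  by apply/in_span2; exists (r * b), (p + r * c); rewrite brDr !brZr rel //; vring.
apply: (infinite_set_nat_inj FE) => m n mn.
have : y + m%:R *: v \in F n by rewrite -mn memv_span // inE eqxx.
move=> /in_span2 [p [r E]].
have [|E0 E1 Er] := H3 (m%:R - p * n%:R - r * (n%:R * lam)) (1 - p) (- r).
  transitivity ((y + m%:R *: v) - (p *: (y + n%:R *: v) + r *: (A y + (n%:R * lam) *: v))).
    by vring.
  by rewrite E subrr.
have pE : p = 1 by rewrite -[RHS]subr0 -E1; ring.
have rE : r = 0 by rewrite -[LHS]opprK Er oppr0.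
move: E0; rewrite pE rE mul0r mul1r subr0 => /eqP.
by rewrite subr_eq0 eqr_nat => /eqP.
Qed.

(** The quadratic equation of [A] fixes [b] and [c] but might leave two candidates for [lam]. In
    either hyperplane [lam] has an eigenplane, and two planes of the three-dimensional [V] meet, so
    the eigenvalues agree. *)
Lemma degenerate_hyperplane_equivalent lam1 b1 c1 v1 q1 lam2 b2 c2 v2 q2 :
  lam1 ^+ 2 = c1 * lam1 + b1 -> lam2 ^+ 2 = c2 * lam2 + b2 ->
  eigen_hyperplane lam1 b1 c1 0 v1 q1 -> eigen_hyperplane lam2 b2 c2 0 v2 q2 ->
  equivalent q1 q2.
Proof.
move=> lam1E lam2E H1 H2.
have rel1 := degenerate_relation lam1E H1; have rel2 := degenerate_relation lam2E H2.
have [e1 [y1 [e1V [v1V Av1] [y1V fr1 AAy1] _]]] := H1.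
have [e2 [y2 [e2V [v2V Av2] [y2V fr2 AAy2] _]]] := H2.
have [bE cE] : b1 = b2 /\ c1 = c2.
  have /free3P /(_ 0 (b1 - b2) (c1 - c2)) := fr1; case.
    transitivity (A (A y1) - A (A y1)); last by rewrite subrr.
    by rewrite {1}rel1 // rel2 //; vring.
  by move=> _ /eqP; rewrite subr_eq0 => /eqP ? /eqP; rewrite subr_eq0 => /eqP ?.
subst b2 c2.
have plane lam v y : lam ^+ 2 = c1 * lam + b1 -> v \in V -> A v = lam *: v ->
    y \in V -> free [:: v; y; A y] -> exists P : {vspace g},
    [/\ \dim P = 2%N, (P <= V)%VS & forall u, u \in P -> A u = lam *: u].
  (* The other root of the quadratic equation is [c1 - lam], so [A - (c1 - lam)] sends [y] to an
     eigenvector for [lam]. *)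
  move=> lamE vV Av yV fr; exists <<[:: v; A y - (c1 - lam) *: y]>>%VS; split.
  - apply/eqP; suff : free [:: v; A y - (c1 - lam) *: y] by [].
    apply/free2P => p r E; have /free3P /(_ p (- (r * (c1 - lam))) r) := fr; case=> [|-> _ -> //].
    by rewrite -E; vring.
  - by apply/span_subvP => u; rewrite !inE => /orP [] /eqP -> //; rewrite memvB ?memvZ ?A_stable.
  move=> u /in_span2 [p [r ->]]; rewrite !(brE, Av, rel1) //.
  have b1E : b1 = lam ^+ 2 - c1 * lam by rewrite lamE; ring.
  by rewrite b1E; vring.
have [P1 [dP1 P1V P1E]] := plane _ _ _ lam1E v1V Av1 y1V fr1.
have [P2 [dP2 P2V P2E]] := plane _ _ _ lam2E v2V Av2 y2V fr2.
suff lamE : lam1 = lam2 by subst lam2; apply: (eigen_hyperplane_equivalent H1 H2).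
have [x xP x0] : exists2 x, x \in (P1 :&: P2)%VS & x != 0.
  exists (vpick (P1 :&: P2)); first exact: memv_pick.
  rewrite vpick0 -dimv_eq0; have := dimv_sum_cap P1 P2.
  have : (\dim (P1 + P2) <= 3)%N by rewrite -dim_V dimvS // subv_add P1V.
  by rewrite dP1 dP2; case: (\dim (_ :&: _)) => // + E; rewrite -[\dim _]addn0 E.
have /memv_capP [xP1 xP2] := xP.
apply/eqP; rewrite -subr_eq0; apply: contraNT x0 => k0.
by rewrite -[x](scalerK k0) scalerBl -P1E // -P2E // subrr scaler0.
Qed.

Theorem abelian_ideal_hyperplanes q : generating3 q -> hyperplanes_classified g.
Proof.
move=> gq.
(* The existence of a cyclic vector separates the finite from the infinite case. *)
have [[w wV fr]|nc] := pselect (exists2 w, w \in V & free [:: w; A w; A (A w)]).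
  by left; split; [apply: cyclic_finite_ideal2 fr | apply: cyclic_ideal1_classifies fr].
have deg q' : generating3 q' -> exists lam b c v,
    lam ^+ 2 = c * lam + b /\ eigen_hyperplane lam b c 0 v q'.
  case/hyperplane_type => [[e [v [_ vV fr _]]]|[lam [b [c [d [v H]]]]]].
    by case: nc; exists v.
  have [lamE|lamN] := eqVneq (lam ^+ 2) (c * lam + b); last first.
    by case: nc; apply: eigen_hyperplane_cyclic H; left.
  have [d0|dN] := eqVneq d 0; last by case: nc; apply: eigen_hyperplane_cyclic H; right.
  by exists lam, b, c, v; split=> //; rewrite -d0.
right; split.
  by have [lam [b [c [v [lamE H]]]]] := deg q gq; apply: degenerate_infinite_ideal2 H.
move=> q1 q2 /deg [lam1 [b1 [c1 [v1 [lam1E H1]]]]] /deg [lam2 [b2 [c2 [v2 [lam2E H2]]]]].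
exact: degenerate_hyperplane_equivalent lam1E lam2E H1 H2.
Qed.

End AbelianIdeal.

Lemma free4_coord (K : fieldType) (V : vectType K) (x y z t : V) :
  \dim {:V} = 4%N -> free [:: x; y; z; t] ->
  forall u, exists a b c d, u = a *: x + b *: y + c *: z + d *: t.
Proof.
move=> dV fr u; have [f1 [f2 [f3 [f4 [dec _ _ _ _]]]]] := free4_dual dV fr.
by exists (f1 u), (f2 u), (f3 u), (f4 u).
Qed.

(** * Algebras with a Heisenberg ideal of dimension three *)

Section HeisenbergIdeal.

Variables (K : realFieldType) (g : lieAlgType K).
Hypothesis dim_g : \dim {:g} = 4%N.
Implicit Types (e x y z u v w : g) (q L I : {vspace g}).

(** [e] acts on the Heisenberg algebra modulo its centre by a matrix with entries [a], [b], [c],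
    [d]; by the derivation rule it acts on the centre by the trace. *)
Definition heisenberg_frame (a b c d : K) e x y z :=
  [/\ free [:: e; x; y; z], bracket x y = z, bracket x z = 0, bracket y z = 0 &
      [/\ bracket e x = a *: x + b *: y, bracket e y = c *: x + d *: y
        & bracket e z = (a + d) *: z]].

(** Bracketing with [x] or [y] moves the ideal into its centre, so adding multiples of them to [e]
    removes the central components [k] and [m]. *)
Lemma heisenberg_frame_correct a b c d k m e x y z :
  free [:: e; x; y; z] -> bracket x y = z -> bracket x z = 0 -> bracket y z = 0 ->
  bracket e x = a *: x + b *: y + k *: z -> bracket e y = c *: x + d *: y + m *: z ->
  heisenberg_frame a b c d (e - m *: x + k *: y) x y z.
Proof.
move=> fr xy xz yz ex ey; have yx : bracket y x = - z by rewrite brC xy.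
have zx : bracket z x = 0 by rewrite brC xz oppr0.
have zy : bracket z y = 0 by rewrite brC yz oppr0.
have ez : bracket e z = (a + d) *: z.
  by rewrite -xy brJ ex ey !(brE, xy, xz, yz, zy); vring.
split=> //.
  apply: (free4_sub fr) => U eU xU yU zU; split=> //.
  have -> : e = (e - m *: x + k *: y) + m *: x - k *: y by vring.
  by apply: memvB; [apply: (memvD eU) |]; apply: memvZ.
by split; rewrite !(brE, ex, ey, ez, xy, yx, xz, yz); vring.
Qed.

Lemma heisenberg_frame_equivalent a b c d e x y z e' x' y' z' :
  heisenberg_frame a b c d e x y z -> heisenberg_frame a b c d e' x' y' z' ->
  equivalent <<[:: e; x; y]>>%VS <<[:: e'; x'; y']>>%VS /\
  equivalent <<[:: e; x; z]>>%VS <<[:: e'; x'; z']>>%VS.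
Proof.
move=> [fr xy xz yz [ex ey ez]] [fr' xy' xz' yz' [ex' ey' ez']]; split.
  apply: (frame_iso dim_g fr fr') => xi xe xx xy'' xz''.
  rewrite xy xz yz ex ey ez xy' xz' yz' ex' ey' ez'.
  by rewrite !(linearD, linearZ, linear0) /= xx xy'' xz''.
apply: (frame_iso dim_g (t := y) (t' := y')).
- by apply: (free4_sub fr) => U.
- by apply: (free4_sub fr') => U.
move=> xi xe xx xz'' xy''.
rewrite ![bracket z _]brC ![bracket z' _]brC.
rewrite xy xz yz ex ey ez xy' xz' yz' ex' ey' ez'.
by rewrite !(linearD, linearN, linearZ, linear0) /= xx xy'' xz''.
Qed.

(** Projecting the frame into [q] along [z] changes its brackets only by multiples of [z], and
    [heisenberg_frame_correct] absorbs the change without leaving [q]. *)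
Lemma heisenberg_hyperplane_notin a b c d e x y z q :
  heisenberg_frame a b c d e x y z -> \dim q = 3%N -> z \notin q ->
  equivalent <<[:: e; x; y]>>%VS q.
Proof.
move=> H dq; have [fr xy xz yz [ex ey ez]] := H.
have [f fq] := hyperplane_scalar dim_g dq; rewrite fq => fz.
pose pr u := u - (f u / f z) *: z.
have prq u : pr u \in q by rewrite fq linearB linearZ /= divfK // subrr.
have zx : bracket z x = 0 by rewrite brC xz oppr0.
have zy : bracket z y = 0 by rewrite brC yz oppr0.
have fr' : free [:: pr e; pr x; pr y; z].
  apply: (free4_sub fr) => U eU xU yU zU.
  have prU u : pr u \in U -> u \in U.
    by move=> H'; rewrite -[u](subrK ((f u / f z) *: z)) memvD // memvZ.
  by split=> //; apply: prU.
have xy' : bracket (pr x) (pr y) = z by rewrite !(brE, xy, zy, xz); vring.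
have xz' : bracket (pr x) z = 0 by rewrite !(brE, xz); vring.
have yz' : bracket (pr y) z = 0 by rewrite !(brE, yz); vring.
pose s u := f u / f z.
have ex' : bracket (pr e) (pr x) = a *: pr x + b *: pr y + (a * s x + b * s y - (a + d) * s x) *: z.
  by rewrite !(brE, ex, ez, zx) /pr -![f _ / f z]/(s _); vring.
have ey' : bracket (pr e) (pr y) = c *: pr x + d *: pr y + (c * s x + d * s y - (a + d) * s y) *: z.
  by rewrite !(brE, ey, ez, zy) /pr -![f _ / f z]/(s _); vring.
have H' := heisenberg_frame_correct fr' xy' xz' yz' ex' ey'.
have [E _] := heisenberg_frame_equivalent H H'.
case: H' => fr'' _ _ _ _.
rewrite (free4_hyperplane fr'' dq (memvD _ _) (prq x) (prq y)) //; last exact: memvZ.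
by rewrite memvB // memvZ.
Qed.

Section Scalar.

Variables (a : K) (e x y z : g).
Hypothesis H : heisenberg_frame a 0 0 a e x y z.

Lemma scalar_heisenberg_equivalent q1 q2 :
  generating3 q1 -> generating3 q2 -> equivalent q1 q2.
Proof.
have [fr xy xz yz [ex ey ez]] := H.
(* When [e] acts by a scalar modulo [z], the bracket of any [u] and [v] is a combination of [u], [v]
   and [z]: every hyperplane through [z] is a subalgebra. *)
suff nz q : generating3 q -> z \notin q.
  move=> g1 g2; apply: (@equivalent_trans _ _ _ <<[:: e; x; y]>>%VS).
    by apply/equivalent_sym/(heisenberg_hyperplane_notin H); [case: g1 | exact: nz].
  by apply/(heisenberg_hyperplane_notin H); [case: g2 | exact: nz].
move=> /(generating3P dim_g) [_ ns]; apply/negP => zq; apply: ns => u v uq vq.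
have [u1 [u2 [u3 [u4 uE]]]] := free4_coord dim_g fr u.
have [v1 [v2 [v3 [v4 vE]]]] := free4_coord dim_g fr v.
rewrite (_ : bracket u v = a *: (u1 *: v - v1 *: u) +
  (a * (u1 * v4 - v1 * u4) + (u2 * v3 - u3 * v2)) *: z).
  by rewrite memvD // memvZ // memvB // memvZ.
have [yx zx zy] : [/\ bracket y x = - z, bracket z x = 0 & bracket z y = 0].
  by rewrite brC xy brC xz brC yz oppr0.
have [xe ye ze] : [/\ bracket x e = - (a *: x), bracket y e = - (a *: y) &
    bracket z e = - ((a + a) *: z)].
  by rewrite brC ex [bracket y e]brC ey [bracket z e]brC ez !scale0r addr0 add0r.
rewrite uE vE !(brE, ex, ey, ez, xy, xz, yz, yx, zx, zy, xe, ye, ze); vring.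
Qed.

Lemma scalar_heisenberg_infinite_ideal2 : infinite_set [set I | @ideal_of_dim K g 2 I].
Proof.
have [fr xy xz yz [ex ey ez]] := H; have /free4P H4 := fr.
have [f1 [f2 [f3 [f4 [dec _ _ _ _]]]]] := free4_dual dim_g fr.
pose F (n : nat) : {vspace g} := (<<[:: z; (x + n%:R *: y)%R]>>)%VS.
have [yx zx zy] : [/\ bracket y x = - z, bracket z x = 0 & bracket z y = 0].
  by rewrite brC xy brC xz brC yz oppr0.
apply: (@infinite_set_nat_inj _ _ F) => [n | m n mn].
  split.
    apply/eqP; suff : free [:: z; x + n%:R *: y] by [].
    apply/free2P => p r E; have [|_ -> _ -> //] := H4 0 r (r * n%:R) p.
    by rewrite -E; vring.
  move=> u v /in_span2 [p [r ->]]; apply/in_span2; rewrite (dec u).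
  exists (f1 u * (a + a) * p + (f2 u * r * n%:R - f3 u * r)), (f1 u * a * r).
  by rewrite !(brE, ex, ey, ez, xy, xz, yz, yx, zx, zy); vring.
have : x + m%:R *: y \in F n by rewrite -mn memv_span // !inE eqxx orbT.
move=> /in_span2 [p [r E]].
have [|_ E1 E2 _] := H4 0 (1 - r) (m%:R - r * n%:R) (- p).
  transitivity ((x + m%:R *: y) - (p *: z + r *: (x + n%:R *: y))); first by vring.
  by rewrite E subrr.
have rE : r = 1 by rewrite -[RHS]subr0 -E1; ring.
by move: E2; rewrite rE mul1r => /eqP; rewrite subr_eq0 eqr_nat => /eqP.
Qed.

End Scalar.

(** A matrix of size 2 that is not scalar has a cyclic vector [p x + r y], hence a companion form
    with last coefficients minus the determinant and the trace. The determinant [k] of the change of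
    basis rescales [z]. *)
Lemma nonscalar_heisenberg_frame a b c d e x y z : (b != 0) || (c != 0) || (a != d) ->
  heisenberg_frame a b c d e x y z ->
  exists x' y' z' b' t, heisenberg_frame 0 1 b' t e x' y' z'.
Proof.
move=> nsc [fr xy xz yz [ex ey ez]].
have [p [r k0]] : exists p r, p * (p * b + r * d) - r * (p * a + r * c) != 0.
  move: nsc; have [b0|b0 _] := eqVneq b 0; last first.
    by exists 1, 0; rewrite !mul0r !mul1r subr0 addr0.
  have [c0 /= ad|c0 _] := eqVneq c 0; last first.
    by exists 0, 1; rewrite !mul0r !mul1r !add0r oppr_eq0.
  by exists 1, 1; rewrite b0 c0 !mul1r addr0 add0r subr_eq0 eq_sym.
set k := _ - _ in k0.
have [yx zx zy] : [/\ bracket y x = - z, bracket z x = 0 & bracket z y = 0].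
  by rewrite brC xy brC xz brC yz oppr0.
pose x' := p *: x + r *: y; pose y' := (p * a + r * c) *: x + (p * b + r * d) *: y.
exists x', y', (k *: z), (b * c - a * d), (a + d); split.
- apply: (free4_sub fr) => U eU xU yU zU.
  have xE : x = k^-1 *: ((p * b + r * d) *: x' - r *: y').
    apply: (scalerI k0); rewrite scalerA divff // scale1r; rewrite /k /x' /y'; vring.
  have yE : y = k^-1 *: (p *: y' - (p * a + r * c) *: x').
    apply: (scalerI k0); rewrite scalerA divff // scale1r; rewrite /k /x' /y'; vring.
  split=> //.
  + by rewrite xE memvZ // memvB // memvZ.
  + by rewrite yE memvZ // memvB // memvZ.
  by rewrite -[z](scalerK k0) memvZ.
- by rewrite !(brE, xy, yx) /k; vring.
- by rewrite !(brE, xz, yz); vring.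
- by rewrite !(brE, xz, yz); vring.
by split; rewrite !(brE, ex, ey, ez) /x' /y'; vring.
Qed.

Section Nonscalar.

Variables (b t : K) (e x y z : g).
Hypothesis H : heisenberg_frame 0 1 b t e x y z.

Let fr : free [:: e; x; y; z]. Proof. by case: H. Qed.
Let ex : bracket e x = y. Proof. by case: H => _ _ _ _ []; rewrite scale0r scale1r add0r. Qed.
Let ey : bracket e y = b *: x + t *: y. Proof. by case: H => _ _ _ _ []. Qed.
Let ez : bracket e z = t *: z. Proof. by case: H => _ _ _ _ []; rewrite add0r. Qed.
Let xy : bracket x y = z. Proof. by case: H. Qed.
Let xz : bracket x z = 0. Proof. by case: H. Qed.
Let yz : bracket y z = 0. Proof. by case: H. Qed.
Let yx : bracket y x = - z. Proof. by rewrite brC xy. Qed.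
Let zx : bracket z x = 0. Proof. by rewrite brC xz oppr0. Qed.
Let zy : bracket z y = 0. Proof. by rewrite brC yz oppr0. Qed.
Let xe : bracket x e = - y. Proof. by rewrite brC ex. Qed.
Let ye : bracket y e = - (b *: x + t *: y). Proof. by rewrite brC ey. Qed.
Let ze : bracket z e = - (t *: z). Proof. by rewrite brC ez. Qed.
Let tbl := (brE, ex, ey, ez, xy, xz, yz, yx, zx, zy, xe, ye, ze).

Let z_neq0 : z != 0.
Proof. by apply: free_not0 fr _; rewrite !inE eqxx !orbT. Qed.

(** [q] is spanned by [z], some [e1] congruent to [e] modulo the ideal, and the vector [w] of the
    plane of [x] and [y] that lies in [q]. As [q] is not a subalgebra, [w] is cyclic for [e1] modulo
    [z], and the companion coefficients are invariants. *)
Lemma heisenberg_hyperplane_in q : generating3 q -> z \in q ->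
  exists e' x' y' z', heisenberg_frame 0 1 b t e' x' y' z' /\ q = <<[:: e'; x'; z']>>%VS.
Proof.
move=> gq zq; have [dq _] := gq.
have [f fq] := hyperplane_scalar dim_g dq.
have fz : f z = 0 by apply/eqP; rewrite -fq.
have fxy : (f x != 0) || (f y != 0).
  rewrite -negb_and; apply/negP => /andP [/eqP fx0 /eqP fy0].
  have fr3 : free [:: x; y; z] by apply: (catr_free (fr : free ([:: e] ++ _))).
  have qE : q = <<[:: x; y; z]>>%VS.
    by apply: free_span_eq => // u; rewrite !inE fq => /or3P [] /eqP ->; rewrite ?fx0 ?fy0 ?fz.
  move: gq; rewrite qE => /(generating3_bracket dim_g); rewrite xy xz yz mem0v -qE zq.
  by case.
have [p [r fe]] : exists p r, f (e + p *: x + r *: y) = 0.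
  have [fx0|fx0] := eqVneq (f x) 0; last first.
    by exists (- (f e / f x)), 0; rewrite scale0r addr0 linearD linearZ /= mulNr divfK // subrr.
  move: fxy; rewrite fx0 eqxx /= => fy0.
  by exists 0, (- (f e / f y)); rewrite scale0r addr0 linearD linearZ /= mulNr divfK // subrr.
set e1 := _ + _ in fe.
pose w := f y *: x - f x *: y.
have fw : f w = 0 by rewrite linearB !linearZ /=; ring.
pose y1 := bracket e1 w.
(* [rho] is the value of [f] at [y1] and also the coefficient in [[w, y1] = rho z]; so [y1] outside
   [q] makes it invertible. *)
pose rho := f y ^+ 2 - f x * f y * t - b * f x ^+ 2.
have y1E : y1 = (- (f x * b)) *: x + (f y - f x * t) *: y - (p * f x + r * f y) *: z.
  by rewrite /y1 /e1 /w !tbl; vring.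
have fy1 : f y1 = rho by rewrite y1E !(linearD, linearN, linearZ) /= fz /rho; ring.
have e1z : bracket e1 z = t *: z by rewrite /e1 !tbl; vring.
have wz : bracket w z = 0 by rewrite /w !tbl; vring.
have [e1q wq] : e1 \in q /\ w \in q by rewrite !fq fe fw eqxx.
have fr3 : free [:: e1; w; z].
  apply/free3P => a c d E; have /free4P H4 := fr.
  have [|a0 cx cy dz] := H4 a (a * p + c * f y) (a * r - c * f x) d.
    by rewrite -E /e1 /w; vring.
  move: cx cy dz; rewrite a0 !mul0r add0r sub0r => /eqP + /eqP + ->.
  rewrite oppr_eq0 !mulf_eq0; case: eqP => // _ /= fy0 fx0.
  by move: fxy; rewrite fx0 fy0.
have qE : q = <<[:: e1; w; z]>>%VS.
  by apply: free_span_eq => // u; rewrite !inE => /or3P [] /eqP ->.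
have y1q : y1 \notin q.
  move: (gq); rewrite {1}qE => /(generating3_bracket dim_g).
  by rewrite -qE e1z wz mem0v memvZ //; case.
have rho0 : rho != 0 by rewrite -fy1 -fq.
have wy1 : bracket w y1 = rho *: z by rewrite y1E /w /rho !tbl; vring.
pose k := (p * (f y - f x * t) + r * (f x * b)) / rho.
have e1y1 : bracket e1 y1 = b *: w + t *: y1 + k *: (rho *: z).
  rewrite scalerA divfK // y1E /e1 /w !tbl; vring.
have y1z : bracket y1 z = 0 by rewrite y1E !tbl; vring.
have fr4 : free [:: e1; w; y1; rho *: z].
  have fr4' : free [:: y1; e1; w; z] by rewrite free_cons -qE y1q.
  apply: (free4_sub fr4') => U *; split=> //.
  by rewrite -[z](scalerK rho0) memvZ.
have wz' : bracket w (rho *: z) = 0 by rewrite brZr wz scaler0.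
have y1z' : bracket y1 (rho *: z) = 0 by rewrite brZr y1z scaler0.
have e1w : bracket e1 w = 0 *: w + 1 *: y1 + 0 *: (rho *: z) by rewrite -/y1; vring.
have H1 := heisenberg_frame_correct fr4 wy1 wz' y1z' e1w e1y1.
exists (e1 - k *: w + 0 *: y1), w, y1, (rho *: z); split=> //.
apply: free_span_eq => //.
  apply: (free3_sub fr3) => U; rewrite scale0r addr0 => eU wU zU.
  split=> //; first by rewrite -[e1](subrK (k *: w)) memvD // memvZ.
  by rewrite -[z](scalerK rho0) memvZ.
move=> u; rewrite !inE scale0r addr0 => /or3P [] /eqP -> //; last exact: memvZ.
by rewrite memvB // memvZ.
Qed.

Lemma heisenberg_ideal1 L : ideal_of_dim 1 L -> L = <[z]>%VS.
Proof.
move=> /ideal1P [l l0 [-> il]].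
have [p1 [p2 [p3 [p4 lE]]]] := free4_coord dim_g fr l; have /free4P H4 := fr.
have [[k xl] [m yl]] := (il x, il y).
have [|k1 _ k3 k4] := H4 (k * p1) (k * p2) (k * p3 + p1) (k * p4 - p3).
  by apply: etrans (subrr (k *: l)); rewrite -{2}xl lE !tbl; vring.
have [|_ m2 _ m4] := H4 (m * p1) (m * p2 + p1 * b) (m * p3 + t * p1) (m * p4 + p2).
  by apply: etrans (subrr (m *: l)); rewrite -{2}yl lE !tbl; vring.
have p10 : p1 = 0.
  have [kk|kk] := eqVneq k 0; first by move: k3; rewrite kk mul0r add0r.
  by apply: (mulfI kk); rewrite k1 mulr0.
have p30 : p3 = 0.
  move: k3 k4; rewrite p10 addr0 => /eqP; rewrite mulf_eq0 => /orP [/eqP -> /eqP|/eqP -> //].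
  by rewrite mul0r sub0r oppr_eq0 => /eqP.
have p20 : p2 = 0.
  move: m2 m4; rewrite p10 mul0r addr0 => /eqP; rewrite mulf_eq0 => /orP [/eqP -> /eqP|/eqP -> //].
  by rewrite mul0r add0r => /eqP.
move: lE; rewrite p10 p20 p30 !scale0r !add0r => lE.
have p40 : p4 != 0 by apply: contraNneq l0 => p40; rewrite lE p40 scale0r.
apply/eqP; rewrite eqEsubv -!memvE; apply/andP; split; apply/vlineP.
  by exists p4.
by exists p4^-1; rewrite lE scalerK.
Qed.

(** A plane ideal lies in the Heisenberg ideal and contains its centre; modulo [z] it is an
    eigenline of [e], spanned by [y - k x] for a root [k] of [b + t X - X^2]. *)
Lemma heisenberg_finite_ideal2 : finite_set [set I | @ideal_of_dim K g 2 I].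
Proof.
have [|r _ rP] := @horner_rec_root_seq K [:: b; t; -1] isT.
  by rewrite /= oppr_eq0 oner_eq0.
have [f1 [f2 [f3 [f4 [dec [f1e f1x f1y f1z] _ _ _]]]]] := free4_dual dim_g fr.
pose n := <<[:: x; y; z]>>%VS.
have fr3 : free [:: x; y; z] by apply: (catr_free (fr : free ([:: e] ++ _))).
have dn : \dim n = 3%N by apply/eqP.
pose F k := <<[:: z; y - k *: x]>>%VS.
apply: (@sub_finite_set _ _ (F @` [set` r])); last exact/finite_image/finite_seq.
move=> I [dI iI].
have In : (I <= n)%VS.
  apply/subvP => u uI; apply/in_span3; exists (f2 u), (f3 u), (f4 u).
  suff f0 : f1 u = 0 by rewrite [LHS]dec f0 scale0r add0r.
  (* A component along [e] would, by brackets with [x], put [z] and [y] into [I] besides [u]. *)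
  apply/eqP; apply: contraT => f0.
  have yzI : f1 u *: y - f3 u *: z \in I.
    rewrite -memvN (_ : - _ = bracket x u) ?iI //.
    by rewrite [in RHS](dec u) !tbl; vring.
  have zI : z \in I.
    rewrite -[z](scalerK f0) memvZ // (_ : _ *: z = bracket x (f1 u *: y - f3 u *: z)) ?iI //.
    by rewrite !tbl; vring.
  have yI : y \in I.
    by rewrite -[y](scalerK f0) memvZ // -[_ *: y](subrK (f3 u *: z)) memvD // memvZ.
  have := @dim_ge3 _ _ u y z I; rewrite dI => H3; have : (3 <= 2)%N; last by [].
  apply: H3 => //; rewrite free_cons (catr_free (fr3 : free ([:: x] ++ _))) andbT.
  apply: contra f0 => /in_span2 [p [s ->]].
  by rewrite linearD !linearZ /= f1y f1z !mulr0 addr0.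
have zI : z \in I.
  have : ~~ (I <= <[z]>)%VS by apply/negP => /dimvS; rewrite dI dim_vline; case: eqP.
  move=> /subvPn [u uI uz]; have /in_span3 [p [s [v uE]]] := subvP In u uI.
  have szI : s *: z \in I by rewrite (_ : _ *: z = bracket x u) ?iI // uE !tbl; vring.
  have pzI : p *: z \in I.
    by rewrite -memvN (_ : - _ = bracket y u) ?iI // uE !tbl; vring.
  have [s0|s0] := eqVneq s 0; last by rewrite -[z](scalerK s0) memvZ.
  have [p0|p0] := eqVneq p 0; last by rewrite -[z](scalerK p0) memvZ.
  by move: uz; rewrite uE s0 p0 !scale0r !add0r memvZ // memv_line.
have xI : x \notin I.
  apply/negP => xI; have yI := iI e _ xI; rewrite ex in yI.
  by have := dim_ge3 fr3 xI yI zI; rewrite dI.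
have [xn yn _] := mem_span3 x y z.
have [k kI] := plane_complement dn dI In xn xI yn.
exists k; last first.
  apply/esym/free_span_eq => //; last by move=> u; rewrite !inE => /orP [] /eqP ->.
  apply/free2P => p s E; have /free3P H3 := fr3.
  by have [|_ -> ->] := H3 (- (s * k)) s p; first by rewrite -E; vring.
apply: rP => /=; apply: contraNeq xI => h0.
rewrite -[x](scalerK h0) memvZ //.
rewrite (_ : _ *: x = bracket e (y - k *: x) - (t - k) *: (y - k *: x)); last first.
  by rewrite !tbl; vring.
by apply: memvB; [exact: iI | exact: memvZ].
Qed.

Lemma heisenberg_ideal1_classifies : ideal1_classifies g.
Proof.
have [f1 [f2 [f3 [f4 [dec _ _ _ _]]]]] := free4_dual dim_g fr.
have iz : ideal_of_dim 1 <[z]>%VS.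
  apply/ideal1P; exists z; [exact: z_neq0 | split=> // u; exists (f1 u * t)].
  by rewrite {1}(dec u) !tbl; vring.
have nz q : contains_no_ideal1 q -> z \notin q by move=> /(_ _ iz); rewrite -memvE.
split.
- by exists [:: <[z]>%VS] => // L /heisenberg_ideal1 ->; rewrite inE.
- move=> L q1 q2 /heisenberg_ideal1 ->; rewrite -!memvE => g1 g2 z1 z2.
  have [e1 [x1 [y1 [z1' [H1 ->]]]]] := heisenberg_hyperplane_in g1 z1.
  have [e2 [x2 [y2 [z2' [H2 ->]]]]] := heisenberg_hyperplane_in g2 z2.
  by case: (heisenberg_frame_equivalent H1 H2).
- move=> q1 q2 [d1 _] [d2 _] /nz n1 /nz n2.
  apply: equivalent_trans (heisenberg_hyperplane_notin H d2 n2).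
  exact/equivalent_sym/(heisenberg_hyperplane_notin H d1 n1).
- move=> L /heisenberg_ideal1 ->; exists <<[:: e; x; z]>>%VS.
    have : free [:: y; e; x; z] by apply: (free4_sub fr) => U *; split.
    by rewrite free_cons => /andP [? ?]; apply: generating3_span => //; rewrite ex.
  by rewrite -memvE memv_span // !inE eqxx !orbT.
have : free [:: z; x; y; e] by apply: (free4_sub fr) => U *; split.
rewrite free_cons => /andP [nq frq]; exists <<[:: x; y; e]>>%VS.
  by apply: generating3_span => //; rewrite xy.
by move=> L /heisenberg_ideal1 ->; rewrite -memvE.
Qed.

End Nonscalar.

Theorem heisenberg_ideal_hyperplanes a b c d e x y z :
  heisenberg_frame a b c d e x y z -> hyperplanes_classified g.
Proof.
move=> H; have [nsc|] := boolP ((b != 0) || (c != 0) || (a != d)).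
  have [x' [y' [z' [b' [t H']]]]] := nonscalar_heisenberg_frame nsc H.
  left; split; first exact: heisenberg_finite_ideal2 H'.
  exact: heisenberg_ideal1_classifies H'.
rewrite !negb_or !negbK => /andP [/andP [/eqP b0 /eqP c0] /eqP ad]; subst.
right; split; first exact: scalar_heisenberg_infinite_ideal2 H.
exact: scalar_heisenberg_equivalent H.
Qed.

End HeisenbergIdeal.

(** * The affine algebra of the complex line *)

Section ComplexAffine.

Variables (K : realFieldType) (g : lieAlgType K).
Hypothesis dim_g : \dim {:g} = 4%N.
Implicit Types (e f w u x y : g) (q L I : {vspace g}).

(* [w] and [u] span a complex line on which [e] acts as 1 and [f] as the imaginary unit. *)
Definition complex_affine_frame e f w u :=
  [/\ free [:: e; f; w; u], bracket e f = 0, bracket w u = 0 &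
      [/\ bracket e w = w, bracket e u = u, bracket f w = u & bracket f u = - w]].

Lemma complex_affine_frame_equivalent e f w u e' f' w' u' :
  complex_affine_frame e f w u -> complex_affine_frame e' f' w' u' ->
  equivalent <<[:: e; f; w]>>%VS <<[:: e'; f'; w']>>%VS.
Proof.
move=> [fr ef wu [ew eu fw fu]] [fr' ef' wu' [ew' eu' fw' fu']].
apply: (frame_iso dim_g fr fr') => xi xe xf xw xu.
rewrite ef ew eu fw fu wu ef' ew' eu' fw' fu' wu'.
by rewrite !(linearN, linear0) /= xw xu.
Qed.

(** A translation of the complex line: [e] is shifted by the complex number [r + i s] and [f] by [i]
    times it, with [w] as 1 and [u] as [i]. *)
Lemma complex_affine_frame_shift s r e f w u : complex_affine_frame e f w u ->
  complex_affine_frame (e + s *: u + r *: w) (f + r *: u - s *: w) w u.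
Proof.
move=> [fr ef wu [ew eu fw fu]].
have [wf uf uw] : [/\ bracket w f = - u, bracket u f = w & bracket u w = 0].
  by rewrite brC fw brC fu opprK brC wu oppr0.
split=> //.
- apply: (free4_sub fr) => U eU fU wU uU; split=> //.
    have -> : e = (e + s *: u + r *: w) - s *: u - r *: w by vring.
    by rewrite memvB ?(memvZ r) // memvB // memvZ.
  have -> : f = (f + r *: u - s *: w) - r *: u + s *: w by vring.
  by rewrite memvD ?(memvZ s) // memvB // memvZ.
- by rewrite !(brE, ef, ew, eu, uf, wf, wu, uw); vring.
by split; rewrite !(brE, ew, eu, fw, fu, wu, uw); vring.
Qed.

Variables (e f w u : g).
Hypothesis H : complex_affine_frame e f w u.

Let fr : free [:: e; f; w; u]. Proof. by case: H. Qed.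
Let ef : bracket e f = 0. Proof. by case: H. Qed.
Let wu : bracket w u = 0. Proof. by case: H. Qed.
Let ew : bracket e w = w. Proof. by case: H => _ _ _ []. Qed.
Let eu : bracket e u = u. Proof. by case: H => _ _ _ []. Qed.
Let fw : bracket f w = u. Proof. by case: H => _ _ _ []. Qed.
Let fu : bracket f u = - w. Proof. by case: H => _ _ _ []. Qed.
Let fe : bracket f e = 0. Proof. by rewrite brC ef oppr0. Qed.
Let uw : bracket u w = 0. Proof. by rewrite brC wu oppr0. Qed.
Let we : bracket w e = - w. Proof. by rewrite brC ew. Qed.
Let ue : bracket u e = - u. Proof. by rewrite brC eu. Qed.
Let wf : bracket w f = - u. Proof. by rewrite brC fw. Qed.
Let uf : bracket u f = w. Proof. by rewrite brC fu opprK. Qed.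
Let tbl := (brE, ef, wu, ew, eu, fw, fu, fe, uw, we, ue, wf, uf).

Let sum_sqr_neq0 (a b : K) : (a != 0) || (b != 0) -> a ^+ 2 + b ^+ 2 != 0.
Proof. by rewrite paddr_eq0 ?sqr_ge0 // !sqrf_eq0 -negb_and. Qed.

(** A hyperplane containing the complex line contains all brackets, so [h] is not zero on that line.
    A complex multiple of [w] is then in [q], and a translation brings [e] and [f] into [q]. *)
Lemma complex_affine_equivalent q : generating3 q -> equivalent <<[:: e; f; w]>>%VS q.
Proof.
move=> gq; have [dq _] := gq.
have [h hq] := hyperplane_scalar dim_g dq.
have hwu : (h u != 0) || (h w != 0).
  rewrite -negb_and; apply/negP => /andP [hu0 hw0].
  move: gq => /(generating3P dim_g) [_]; apply => x y _ _.
  have [x1 [x2 [x3 [x4 ->]]]] := free4_coord dim_g fr x.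
  have [y1 [y2 [y3 [y4 ->]]]] := free4_coord dim_g fr y.
  rewrite (_ : bracket _ _ = (x1 * y3 - x3 * y1 - x2 * y4 + x4 * y2) *: w +
    (x1 * y4 - x4 * y1 + x2 * y3 - x3 * y2) *: u); last by rewrite !tbl; vring.
  by rewrite memvD // memvZ // hq.
have N0 := sum_sqr_neq0 hwu; set N := _ + _ in N0.
(* [w'] is [w] times the complex number [h u - i h w], and [u'] is [i] times [w']. *)
pose w' := h u *: w - h w *: u; pose u' := h w *: w + h u *: u.
have hw' : h w' = 0 by rewrite linearB !linearZ /=; ring.
have hu' : h u' = N by rewrite linearD !linearZ /= /N; ring.
pose s := - (h e / N); pose r := - (h f / N).
pose e' := e + s *: u' + r *: w'; pose f' := f + r *: u' - s *: w'.
have he' : h e' = 0.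
  by rewrite 2!linearD 2!linearZ /= hw' hu' mulr0 addr0 mulNr divfK // subrr.
have hf' : h f' = 0.
  by rewrite linearB linearD 2!linearZ /= hw' hu' mulr0 subr0 mulNr divfK // subrr.
have H0 : complex_affine_frame e f w' u'.
  split.
  - apply: (free4_sub fr) => U eU fU wU uU; split=> //.
      rewrite -[w](scalerK N0) memvZ // (_ : _ *: w = h u *: w' + h w *: u').
        by rewrite memvD // memvZ.
      by rewrite /N /w' /u'; vring.
    rewrite -[u](scalerK N0) memvZ // (_ : _ *: u = h u *: u' - h w *: w').
      by rewrite memvB // memvZ.
    by rewrite /N /w' /u'; vring.
  - exact: ef.
  - by rewrite /w' /u' !tbl; vring.
  by split; rewrite /w' /u' !tbl; vring.
have H' : complex_affine_frame e' f' w' u' by apply: complex_affine_frame_shift H0.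
have [fr' _ _ _] := H'.
rewrite (free4_hyperplane fr' dq); [|by rewrite hq ?he' ?hf' ?hw'..].
exact: complex_affine_frame_equivalent H H'.
Qed.

Lemma complex_affine_no_ideal1 L : ~ ideal_of_dim 1 L.
Proof.
move=> /ideal1P [l l0 [_ il]]; move/eqP: l0; apply.
have [p1 [p2 [p3 [p4 lE]]]] := free4_coord dim_g fr l; have /free4P H4 := fr.
have [[k wl] [m fl]] := (il w, il f).
have [|k1 k2 k3 k4] := H4 (k * p1) (k * p2) (k * p3 + p1) (k * p4 + p2).
  by apply: etrans (subrr (k *: l)); rewrite -{2}wl lE !tbl; vring.
have [|_ _ m3 m4] := H4 (m * p1) (m * p2) (m * p3 + p4) (m * p4 - p3).
  by apply: etrans (subrr (m *: l)); rewrite -{2}fl lE !tbl; vring.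
have [p10 p20] : p1 = 0 /\ p2 = 0.
  have [k0|k0] := eqVneq k 0; first by rewrite k0 !mul0r !add0r in k3 k4.
  by split; apply: (mulfI k0); rewrite mulr0.
have m0 : 1 + m ^+ 2 != 0 by rewrite gt_eqF // ltr_pwDl // sqr_ge0.
have p3E : p3 = m * p4 by apply/esym/eqP; rewrite -subr_eq0 m4.
have p40 : p4 = 0 by apply: (mulfI m0); rewrite mulr0 -m3 p3E; ring.
by rewrite lE p3E p10 p20 p40 mulr0 !scale0r !addr0.
Qed.

(** An element outside the complex line acts on it as a nonzero complex number, so an ideal
    containing it contains the whole line and has dimension at least 3. *)
Lemma complex_affine_finite_ideal2 : finite_set [set I | @ideal_of_dim K g 2 I].
Proof.
apply: (@sub_finite_set _ _ [set <<[:: w; u]>>%VS]); last exact: finite_set1.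
move=> I [dI iI] /=.
have frwu : free [:: w; u] by apply: (catr_free (fr : free ([:: e; f] ++ _))).
suff IW : (I <= <<[:: w; u]>>)%VS by apply/eqP; rewrite eqEdim IW dI (eqP frwu).
apply/subvP => i iIn; apply: contraT => iW.
have [p1 [p2 [p3 [p4 iE]]]] := free4_coord dim_g fr i.
have p12 : (p1 != 0) || (p2 != 0).
  rewrite -negb_and; apply: contra iW => /andP [/eqP p10 /eqP p20].
  by apply/in_span2; exists p3, p4; rewrite iE p10 p20 !scale0r !add0r.
have N0 := sum_sqr_neq0 p12; set N := _ + _ in N0.
have wI : w \in I.
  rewrite -[w](scalerK N0) memvZ // (_ : _ *: w = p2 *: bracket u i - p1 *: bracket w i).
    by rewrite memvB // memvZ // iI.
  by rewrite iE !tbl /N; vring.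
have uI : u \in I by rewrite -fw iI.
have := @dim_ge3 _ _ i w u I; rewrite dI free_cons iW frwu => H3.
by have := H3 isT iIn wI uI.
Qed.

Theorem complex_affine_hyperplanes : hyperplanes_classified g.
Proof.
left; split; first exact: complex_affine_finite_ideal2.
split.
- by exists [::] => // L /complex_affine_no_ideal1.
- by move=> L q1 q2 /complex_affine_no_ideal1.
- move=> q1 q2 /complex_affine_equivalent E1 /complex_affine_equivalent E2 _ _.
  exact: equivalent_trans (equivalent_sym E1) E2.
- by move=> L /complex_affine_no_ideal1.
have : free [:: u; f; w; e] by apply: (free4_sub fr) => U *; split.
rewrite free_cons => /andP [nq frq]; exists <<[:: f; w; e]>>%VS.
  by apply: generating3_span => //; rewrite fw.
by move=> L /complex_affine_no_ideal1.
Qed.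

End ComplexAffine.

(** * Plane ideals of the exceptional algebra with two affine summands *)

Lemma finite_ideal2_2g21 (K : fieldType) (g : lieAlgType K) :
  is_2g21 g -> finite_set [set I | @ideal_of_dim K g 2 I].
Proof.
move=> [x [y [z [t [b [xy zt [xz xt yz yt]]]]]]].
have dim_g : \dim {:g} = 4%N by rewrite (size_basis (b : basis_of _ (in_tuple _))).
have fr := basis_free b.
have [yx tz zx tx] : [/\ bracket y x = - x, bracket t z = - z, bracket z x = 0 & bracket t x = 0].
  by split; rewrite brC ?xy ?zt ?xz ?xt ?oppr0.
have [zy ty] : bracket z y = 0 /\ bracket t y = 0 by split; rewrite brC ?yz ?yt oppr0.
pose S := [:: <<[:: x; z]>>%VS; <<[:: x; y]>>%VS; <<[:: z; t]>>%VS].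
apply: (@sub_finite_set _ _ [set` S]); last exact: finite_seq.
move=> I [dI iI] /=.
have sub2 v1 v2 : free [:: v1; v2] -> v1 \in I -> v2 \in I -> I = <<[:: v1; v2]>>%VS.
  by move=> fr2 m1 m2; apply: free_span_eq => // v; rewrite !inE => /orP [] /eqP ->.
have sup2 v1 v2 : free [:: v1; v2] -> (I <= <<[:: v1; v2]>>)%VS -> I = <<[:: v1; v2]>>%VS.
  by move=> fr2 s; apply/eqP; rewrite eqEdim s dI (eqP fr2).
have frxz : free [:: x; z].
  have : free [:: x; z; y; t] by apply: (free4_sub fr) => U *; split.
  by move=> fr'; apply: (catl_free (fr' : free ([:: _; _] ++ _))).
have frxy : free [:: x; y] by apply: (catl_free (fr : free ([:: _; _] ++ _))).
have frzt : free [:: z; t] by apply: (catr_free (fr : free ([:: _; _] ++ _))).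
have tbl := (brE, xy, zt, xz, xt, yz, yt, yx, tz, zx, tx, zy, ty).
(* If [I] misses [x], brackets with [x] and [y] kill the components of its elements on [x] and [y];
   likewise for [z]. The three listed planes are what remains. *)
have [xI|xI] := boolP (x \in I); last first.
  rewrite (@sup2 z t) ?inE ?eqxx ?orbT //; apply/subvP => i iIn.
  have [p1 [p2 [p3 [p4 iE]]]] := free4_coord dim_g fr i.
  have p2x : p2 *: x \in I by rewrite (_ : _ *: x = bracket x i) ?iI // iE !tbl; vring.
  have p1x : p1 *: x \in I.
    by rewrite -memvN (_ : - _ = bracket y i) ?iI // iE !tbl; vring.
  have p20 : p2 = 0 by apply: contraNeq xI => p0; rewrite -[x](scalerK p0) memvZ.
  have p10 : p1 = 0 by apply: contraNeq xI => p0; rewrite -[x](scalerK p0) memvZ.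
  by apply/in_span2; exists p3, p4; rewrite iE p10 p20 !scale0r !add0r.
have [zI|zI] := boolP (z \in I); first by rewrite (@sub2 x z) ?inE ?eqxx.
rewrite (@sup2 x y) ?inE ?eqxx ?orbT //; apply/subvP => i iIn.
have [p1 [p2 [p3 [p4 iE]]]] := free4_coord dim_g fr i.
have p4z : p4 *: z \in I by rewrite (_ : _ *: z = bracket z i) ?iI // iE !tbl; vring.
have p3z : p3 *: z \in I.
  by rewrite -memvN (_ : - _ = bracket t i) ?iI // iE !tbl; vring.
have p40 : p4 = 0 by apply: contraNeq zI => p0; rewrite -[z](scalerK p0) memvZ.
have p30 : p3 = 0 by apply: contraNeq zI => p0; rewrite -[z](scalerK p0) memvZ.
by apply/in_span2; exists p1, p2; rewrite iE p30 p40 !scale0r !addr0.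
Qed.

Lemma orthogonal_unit (K : rcfType) (k1 k2 k3 : K) : exists y1 y2 y3,
  y1 ^+ 2 + y2 ^+ 2 + y3 ^+ 2 = 1 /\ k1 * y1 + k2 * y2 + k3 * y3 = 0.
Proof.
have [k12|] := boolP ((k1 != 0) || (k2 != 0)); last first.
  rewrite negb_or !negbK => /andP [/eqP -> /eqP ->].
  by exists 1, 0, 0; split; ring.
have N0 : k1 ^+ 2 + k2 ^+ 2 != 0 by rewrite paddr_eq0 ?sqr_ge0 // !sqrf_eq0 negb_and.
have NE : Num.sqrt (k1 ^+ 2 + k2 ^+ 2) ^+ 2 = k1 ^+ 2 + k2 ^+ 2.
  by rewrite sqr_sqrtr // addr_ge0 ?sqr_ge0.
set N := Num.sqrt _ in NE.
exists (k2 / N), (- (k1 / N)), 0; split; last by ring.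
rewrite sqrrN !exprMn !exprVn NE expr0n /= addr0 -mulrDl addrC.
by rewrite divff.
Qed.

(** * Simple algebras of dimension three with a one-dimensional centre added *)

Section SimplePlusCenter.

Variables (K : rcfType) (g : lieAlgType K).
Hypothesis dim_g : \dim {:g} = 4%N.
Implicit Types (a b c h u v x y : g) (q L I : {vspace g}).

(** [mu = 1] gives so(3) and [mu = -1] gives sl(2, R), with centre [c]; in both [h] acts as a
    rotation on the plane of [a] and [b]. *)
Definition simple_frame (mu : K) h a b c :=
  [/\ free [:: h; a; b; c],
      [/\ bracket h c = 0, bracket a c = 0 & bracket b c = 0] &
      [/\ bracket h a = b, bracket h b = - a & bracket a b = mu *: h]].

(** There is no plane ideal at all: a noncentral element produces [a] by brackets, and [a] produces
    [b] and [h]. *)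
Lemma simple_frame_finite_ideal2 mu h a b c : mu != 0 -> simple_frame mu h a b c ->
  finite_set [set I | @ideal_of_dim K g 2 I].
Proof.
move=> mu0 [fr [hc ac bc] [ha hb ab]].
have [ah bh ba] : [/\ bracket a h = - b, bracket b h = a & bracket b a = - (mu *: h)].
  by rewrite brC ha brC hb opprK brC ab.
have [ch ca cb] : [/\ bracket c h = 0, bracket c a = 0 & bracket c b = 0].
  by split; rewrite brC ?hc ?ac ?bc oppr0.
have tbl := (brE, hc, ac, bc, ha, hb, ab, ah, bh, ba, ch, ca, cb).
suff noI I : ~ ideal_of_dim 2 I.
  by apply: (@sub_finite_set _ _ set0); [move=> I /noI | exact: finite_set0].
move=> [dI iI].
have haI : a \notin I.
  apply/negP => aI; have bI : b \in I by rewrite -ha iI.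
  have hI : h \in I by rewrite -[h](scalerK mu0) memvZ // -ab iI.
  have fr3 : free [:: h; a; b] by apply: (@catl_free _ _ [:: c]).
  by have := dim_ge3 fr3 hI aI bI; rewrite dI.
have : ~~ (I <= <[c]>)%VS by apply/negP => /dimvS; rewrite dI dim_vline; case: eqP.
move=> /subvPn [i iIn ic]; move/negP: haI; apply.
have [p1 [p2 [p3 [p4 iE]]]] := free4_coord dim_g fr i.
have [p23|] := boolP ((p2 != 0) || (p3 != 0)).
  have N0 : p2 ^+ 2 + p3 ^+ 2 != 0.
    by rewrite paddr_eq0 ?sqr_ge0 // !sqrf_eq0 negb_and.
  rewrite -[a](scalerK N0) memvZ //.
  (* Brackets with [h] strip [i] of its components on [h] and [c]; the rotation is then inverted, at
     the cost of the factor [p2^2 + p3^2]. *)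
  rewrite (_ : _ *: a = - (p2 *: bracket h (bracket h i)) - p3 *: bracket h i).
    by rewrite memvB ?memvN ?memvZ // ?iI // iI.
  by rewrite iE !tbl; vring.
rewrite negb_or !negbK => /andP [/eqP p20 /eqP p30].
have p10 : p1 != 0.
  apply: contraNneq ic => p10; rewrite iE p10 p20 p30 !scale0r !add0r.
  by apply/vlineP; exists p4.
rewrite -[a](scalerK p10) memvZ // (_ : _ *: a = - bracket h (- bracket a i)).
  by rewrite memvN iI // memvN iI.
by rewrite iE p20 p30 !tbl; vring.
Qed.

Lemma simple_frame_g36_g1 h a b c : simple_frame (-1) h a b c -> is_g36_g1 g.
Proof.
move=> [fr [hc ac bc] [ha hb ab]]; exists a, b, h, c; split.
  rewrite basisEfree subvf dim_g andbT; apply: (free4_sub fr) => U *; by split.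
by split; rewrite ?ab ?scaleN1r // brC hb opprK.
Qed.

Lemma finite_ideal2_g36_g1 : is_g36_g1 g -> finite_set [set I | @ideal_of_dim K g 2 I].
Proof.
move=> [a [b [h [c [bas [bh ha ab [ac bc hc]]]]]]].
apply: (@simple_frame_finite_ideal2 (-1) h a b c); first by rewrite oppr_eq0 oner_eq0.
split=> //; last by split=> //; [rewrite brC bh | rewrite ab scaleN1r].
by apply: (free4_sub (basis_free bas)) => U *; split.
Qed.

Section Compact.

Variables (h a b c : g).
Hypothesis H : simple_frame 1 h a b c.

Let fr : free [:: h; a; b; c]. Proof. by case: H. Qed.
Let hc : bracket h c = 0. Proof. by case: H => _ []. Qed.
Let ac : bracket a c = 0. Proof. by case: H => _ []. Qed.
Let bc : bracket b c = 0. Proof. by case: H => _ []. Qed.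
Let ha : bracket h a = b. Proof. by case: H => _ _ []. Qed.
Let hb : bracket h b = - a. Proof. by case: H => _ _ []. Qed.
Let ab : bracket a b = h. Proof. by case: H => _ _ []; rewrite scale1r. Qed.
Let ah : bracket a h = - b. Proof. by rewrite brC ha. Qed.
Let bh : bracket b h = a. Proof. by rewrite brC hb opprK. Qed.
Let ba : bracket b a = - h. Proof. by rewrite brC ab. Qed.
Let ch : bracket c h = 0. Proof. by rewrite brC hc oppr0. Qed.
Let ca : bracket c a = 0. Proof. by rewrite brC ac oppr0. Qed.
Let cb : bracket c b = 0. Proof. by rewrite brC bc oppr0. Qed.
Let tbl := (brE, hc, ac, bc, ha, hb, ab, ah, bh, ba, ch, ca, cb).

Let vec (x1 x2 x3 : K) := x1 *: h + x2 *: a + x3 *: b.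

(* In the coordinates of [vec] the bracket is the cross product, so that
   [x, [x, y]] = (x . y) x - (x . x) y. *)
Lemma compact_rotation (x1 x2 x3 y1 y2 y3 : K) :
  x1 ^+ 2 + x2 ^+ 2 + x3 ^+ 2 = 1 -> y1 ^+ 2 + y2 ^+ 2 + y3 ^+ 2 = 1 ->
  x1 * y1 + x2 * y2 + x3 * y3 = 0 ->
  simple_frame 1 (vec x1 x2 x3) (vec y1 y2 y3) (bracket (vec x1 x2 x3) (vec y1 y2 y3)) c.
Proof.
move=> xx yy xy; set x := vec x1 x2 x3; set y := vec y1 y2 y3; set z := bracket x y.
have zE : z = vec (x2 * y3 - x3 * y2) (x3 * y1 - x1 * y3) (x1 * y2 - x2 * y1).
  by rewrite /z /x /y /vec !tbl; vring.
have xz : bracket x z = - y.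
  transitivity ((x1 * y1 + x2 * y2 + x3 * y3) *: x - (x1 ^+ 2 + x2 ^+ 2 + x3 ^+ 2) *: y).
    by rewrite zE /x /y /vec !tbl; vring.
  by rewrite xx xy scale0r sub0r scale1r.
have yz : bracket y z = x.
  transitivity ((y1 ^+ 2 + y2 ^+ 2 + y3 ^+ 2) *: x - (x1 * y1 + x2 * y2 + x3 * y3) *: y).
    by rewrite zE /x /y /vec !tbl; vring.
  by rewrite yy xy scale0r subr0 scale1r.
have /free4P H4 := fr.
split; last by rewrite yz xz scale1r.
  apply/free4P => p q r s E.
  have [|e1 e2 e3 s0] := H4 (p * x1 + q * y1 + r * (x2 * y3 - x3 * y2))
      (p * x2 + q * y2 + r * (x3 * y1 - x1 * y3)) (p * x3 + q * y3 + r * (x1 * y2 - x2 * y1)) s.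
    by rewrite -E zE /x /y /vec; vring.
  have p0 : p = 0.
    transitivity (p * (x1 ^+ 2 + x2 ^+ 2 + x3 ^+ 2) + q * (x1 * y1 + x2 * y2 + x3 * y3)).
      by rewrite xx xy mulr1 mulr0 addr0.
    transitivity (x1 * (p * x1 + q * y1 + r * (x2 * y3 - x3 * y2)) + x2 *
      (p * x2 + q * y2 + r * (x3 * y1 - x1 * y3)) + x3 *
      (p * x3 + q * y3 + r * (x1 * y2 - x2 * y1))).
      by ring.
    by rewrite e1 e2 e3 !mulr0 !addr0.
  have q0 : q = 0.
    transitivity (p * (x1 * y1 + x2 * y2 + x3 * y3) + q * (y1 ^+ 2 + y2 ^+ 2 + y3 ^+ 2)).
      by rewrite yy xy mulr1 mulr0 add0r.
    transitivity (y1 * (p * x1 + q * y1 + r * (x2 * y3 - x3 * y2)) + y2 *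
      (p * x2 + q * y2 + r * (x3 * y1 - x1 * y3)) + y3 *
      (p * x3 + q * y3 + r * (x1 * y2 - x2 * y1))).
      by ring.
    by rewrite e1 e2 e3 !mulr0 !addr0.
  split=> //; transitivity (r * ((x1 ^+ 2 + x2 ^+ 2 + x3 ^+ 2) * (y1 ^+ 2 + y2 ^+ 2 + y3 ^+ 2) -
      (x1 * y1 + x2 * y2 + x3 * y3) ^+ 2)).
    by rewrite xx yy xy expr0n /= subr0 !mulr1.
  transitivity ((x2 * y3 - x3 * y2) * (p * x1 + q * y1 + r * (x2 * y3 - x3 * y2)) +
    (x3 * y1 - x1 * y3) * (p * x2 + q * y2 + r * (x3 * y1 - x1 * y3)) +
    (x1 * y2 - x2 * y1) * (p * x3 + q * y3 + r * (x1 * y2 - x2 * y1))); first by ring.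
  by rewrite e1 e2 e3 !mulr0 !addr0.
by split; rewrite ?zE /x /y /vec !tbl; vring.
Qed.

(** [h'] is the unit normal, inside so(3), of the restriction of [f]; the vectors [a'] and [b']
    orthogonal to it lie in [q]. The restriction is nonzero because so(3) itself is a subalgebra,
    and positivity of the sum of squares makes every direction normalisable. *)
Lemma compact_hyperplane_frame q : generating3 q ->
  exists h' a' b' c', [/\ simple_frame 1 h' a' b' c', c' \in <[c]>%VS,
    c \in q -> q = <<[:: a'; b'; c']>>%VS &
    c \notin q -> q = <<[:: a'; b'; (h' + c')%R]>>%VS].
Proof.
move=> gq; have [dq _] := gq.
have [f fq] := hyperplane_scalar dim_g dq.
have fk : [|| f h != 0, f a != 0 | f b != 0].
  rewrite -!negb_and; apply/negP => /and3P [fh fa fb].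
  have fr3 : free [:: h; a; b] by apply: (@catl_free _ _ [:: c]).
  have qE : q = <<[:: h; a; b]>>%VS.
    by apply: free_span_eq => // u; rewrite !inE fq => /or3P [] /eqP ->.
  have [hq aq bq] := mem_span3 h a b.
  move: gq; rewrite qE => /(generating3_bracket dim_g); rewrite ha hb ab memvN.
  by rewrite hq aq bq; case.
have S0 : 0 < f h ^+ 2 + f a ^+ 2 + f b ^+ 2.
  rewrite lt_def !addr_ge0 ?sqr_ge0 // andbT paddr_eq0 ?addr_ge0 ?sqr_ge0 //.
  by rewrite paddr_eq0 ?sqr_ge0 // !sqrf_eq0 !negb_and -orbA.
have NE : Num.sqrt (f h ^+ 2 + f a ^+ 2 + f b ^+ 2) ^+ 2 = f h ^+ 2 + f a ^+ 2 + f b ^+ 2.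
  by rewrite sqr_sqrtr // ltW.
have : 0 < Num.sqrt (f h ^+ 2 + f a ^+ 2 + f b ^+ 2) by rewrite sqrtr_gt0.
set N := Num.sqrt _ in NE * => N_gt0; have N0 : N != 0 by rewrite gt_eqF.
have [y1 [y2 [y3 [yy ky]]]] := orthogonal_unit (f h) (f a) (f b).
have xx : (f h / N) ^+ 2 + (f a / N) ^+ 2 + (f b / N) ^+ 2 = 1.
  by rewrite !exprMn exprVn -!mulrDl -NE divff // expf_neq0.
have xy : f h / N * y1 + f a / N * y2 + f b / N * y3 = 0.
  transitivity ((f h * y1 + f a * y2 + f b * y3) / N); first by ring.
  by rewrite ky mul0r.
have := compact_rotation xx yy xy.
set h' := vec _ _ _; set a' := vec y1 _ _; set b' := bracket _ _ => H'.
have fh' : f h' = N.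
  rewrite /h' /vec !linearD !linearZ /=.
  transitivity ((f h ^+ 2 + f a ^+ 2 + f b ^+ 2) / N); first by ring.
  by rewrite -NE expr2 mulfK.
have a'q : a' \in q.
  by rewrite fq /a' /vec !linearD !linearZ /=; apply/eqP; rewrite -[RHS]ky; ring.
have b'q : b' \in q.
  by rewrite fq /b' /h' /a' /vec !tbl !(linearD, linearN, linearZ, linear0) /=; apply/eqP; ring.
have [fr' [hc' ac' bc'] [ha' hb' ab']] := H'.
have [cq|cq] := boolP (c \in q).
  exists h', a', b', c; split=> //; first exact: memv_line.
  move=> _; apply: (@free4_hyperplane _ _ q a' b' c h') => //.
  by apply: (free4_sub fr') => U *; split.
have fc : f c != 0 by rewrite -fq.
(* The centre can be rescaled freely; this factor makes [f] vanish on [h' + s c]. *)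
pose s := - (N / f c); have s0 : s != 0 by rewrite oppr_eq0 mulf_neq0 ?invr_eq0.
have fr'' : free [:: h'; a'; b'; s *: c].
  apply: (free4_sub fr') => U hU aU bU cU; split=> //.
  by rewrite -[c](scalerK s0) memvZ.
exists h', a', b', (s *: c); split=> //.
- by split; [exact: fr'' | rewrite !brZr hc' ac' bc' scaler0 | ].
- by apply/vlineP; exists s.
move=> _; apply: (@free4_hyperplane _ _ q a' b' (h' + s *: c) h') => //.
  apply: (free4_sub fr'') => U aU bU hcU hU; split=> //.
  by rewrite -[s *: c](addKr h') memvD // memvN.
by rewrite fq linearD linearZ /= fh' /s mulNr divfK // subrr.
Qed.

Lemma compact_ideal1 L : ideal_of_dim 1 L -> L = <[c]>%VS.
Proof.
move=> /ideal1P [l l0 [-> il]].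
have [p1 [p2 [p3 [p4 lE]]]] := free4_coord dim_g fr l; have /free4P H4 := fr.
have [[k hl] [m al]] := (il h, il a).
have [|_ k2 k3 _] := H4 (k * p1) (k * p2 + p3) (k * p3 - p2) (k * p4).
  by apply: etrans (subrr (k *: l)); rewrite -{2}hl lE !tbl; vring.
have [|m1 _ m3 _] := H4 (m * p1 - p3) (m * p2) (m * p3 + p1) (m * p4).
  by apply: etrans (subrr (m *: l)); rewrite -{2}al lE !tbl; vring.
have k0 : 1 + k ^+ 2 != 0 by rewrite gt_eqF // ltr_pwDl // sqr_ge0.
have p30 : p3 = 0.
  apply: (mulfI k0); rewrite mulr0.
  transitivity ((k * p2 + p3) + k * (k * p3 - p2)); first by ring.
  by rewrite k2 k3 mulr0 addr0.
have p20 : p2 = 0 by move: k3; rewrite p30 mulr0 sub0r => /eqP; rewrite oppr_eq0 => /eqP.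
have p10 : p1 = 0 by move: m3; rewrite p30 mulr0 add0r.
move: lE; rewrite p10 p20 p30 !scale0r !add0r => lE.
have p40 : p4 != 0 by apply: contraNneq l0 => p40; rewrite lE p40 scale0r.
apply/eqP; rewrite eqEsubv -!memvE; apply/andP; split; apply/vlineP.
  by exists p4.
by exists p4^-1; rewrite lE scalerK.
Qed.

Theorem compact_hyperplanes : hyperplanes_classified g.
Proof.
left; split.
  by apply: (simple_frame_finite_ideal2 _ H); rewrite oner_eq0.
have c0 : c != 0 by apply: free_not0 fr _; rewrite !inE eqxx !orbT.
have ic : ideal_of_dim 1 <[c]>%VS.
  apply/ideal1P; exists c => //; split=> // u; exists 0.
  have [u1 [u2 [u3 [u4 ->]]]] := free4_coord dim_g fr u.
  by rewrite !tbl; vring.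
(* The two normal forms, with third vector [c] or [h + c], are compared at once: either way the map
   sends [c1] to [c2]. *)
have iso (z z' x1 y1 c1 h1 x2 y2 c2 h2 : g) : simple_frame 1 h1 x1 y1 c1 ->
    simple_frame 1 h2 x2 y2 c2 ->
    z = h1 + c1 /\ z' = h2 + c2 \/ z = c1 /\ z' = c2 ->
    equivalent <<[:: x1; y1; z]>>%VS <<[:: x2; y2; z']>>%VS.
  move=> [fr1 [hc1 ac1 bc1] [ha1 hb1 ab1]] [fr2 [hc2 ac2 bc2] [ha2 hb2 ab2]] zE.
  apply: (frame_iso dim_g (t := h1) (t' := h2)).
  - apply: (free4_sub fr1) => U xU yU zU hU; split=> //.
    case: zE => -[zE _]; rewrite zE in zU => //.
    by rewrite -[c1](addKr h1) memvD // memvN.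
  - apply: (free4_sub fr2) => U xU yU zU hU; split=> //.
    case: zE => -[_ zE]; rewrite zE in zU => //.
    by rewrite -[c2](addKr h2) memvD // memvN.
  move=> xi xx xy xz xh; have xc : xi c1 = c2.
    case: zE => -[z1 z2]; move: xz; rewrite z1 z2 // linearD xh => /addrI //.
  have [[ah1 bh1] [ah2 bh2]] : (bracket x1 h1 = - y1 /\ bracket y1 h1 = x1) /\
      (bracket x2 h2 = - y2 /\ bracket y2 h2 = x2).
    by rewrite brC ha1 brC hb1 brC ha2 brC hb2 !opprK.
  have [ch1 ch2] : bracket c1 h1 = 0 /\ bracket c2 h2 = 0.
    by rewrite brC hc1 brC hc2 oppr0.
  rewrite ab1 ab2 ah1 ah2 bh1 bh2.
  by case: zE => -[-> ->]; rewrite ?brE ?ah1 ?ah2 ?bh1 ?bh2 ?ac1 ?ac2 ?bc1 ?bc2 ?ch1 ?ch2 ?addr0;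
    rewrite ?(linearN, linearZ, linear0) /= ?xx ?xy ?xh ?xc ?addr0.
split.
- by exists [:: <[c]>%VS] => // L /compact_ideal1 ->; rewrite inE.
- move=> L q1 q2 /compact_ideal1 ->; rewrite -!memvE => g1 g2 cq1 cq2.
  have [h1 [x1 [y1 [c1 [H1 _ E1 _]]]]] := compact_hyperplane_frame g1.
  have [h2 [x2 [y2 [c2 [H2 _ E2 _]]]]] := compact_hyperplane_frame g2.
  by rewrite E1 // E2 //; apply: iso H1 H2 _; right.
- move=> q1 q2 g1 g2 /(_ _ ic) + /(_ _ ic); rewrite -!memvE => cq1 cq2.
  have [h1 [x1 [y1 [c1 [H1 _ _ E1]]]]] := compact_hyperplane_frame g1.
  have [h2 [x2 [y2 [c2 [H2 _ _ E2]]]]] := compact_hyperplane_frame g2.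
  by rewrite E1 // E2 //; apply: iso H1 H2 _; left.
- move=> L /compact_ideal1 ->; exists <<[:: a; b; c]>>%VS.
    have : free [:: h; a; b; c] by [].
    by rewrite free_cons => /andP [? ?]; apply: generating3_span => //; rewrite ab.
  by rewrite -memvE memv_span // !inE eqxx !orbT.
exists <<[:: a; b; (h + c)%R]>>%VS.
  have : free [:: h; a; b; h + c].
    apply: (free4_sub fr) => U hU aU bU hcU; split=> //.
    by rewrite -[c](addKr h) memvD // memvN.
  by rewrite free_cons => /andP [? ?]; apply: generating3_span => //; rewrite ab.
have : free [:: c; a; b; h + c].
  apply: (free4_sub fr) => U cU aU bU hcU; split=> //.
  by rewrite -[h](addrK c) memvB.
by rewrite free_cons => /andP [? _] L /compact_ideal1 ->; rewrite -memvE.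
Qed.

End Compact.

End SimplePlusCenter.

Lemma scalar_of_fun (K : fieldType) (V : vectType K) (F : V -> K) :
  scalar F -> exists f : {scalar V}, f =1 F.
Proof.
move=> linF; pose m := GRing.isLinear.Build K V K _ F linF.
by pose f : {scalar V} := HB.pack F m; exists f.
Qed.

Lemma scalar_hyperplane (K : fieldType) (V : vectType K) (f : {scalar V}) (u : V) :
  \dim {:V} = 4%N -> f u != 0 ->
  exists2 U : {vspace V}, \dim U = 3%N & forall v, (v \in U) = (f v == 0).
Proof.
move=> dV fu0.
pose F : 'Hom(V, K^o) := linfun (f : V -> K^o).
have FE v : F v = f v by rewrite lfunE.
have kP v : (v \in lker F) = (f v == 0) by rewrite memv_ker FE.
exists (lker F) => //.
have := limg_ker_dim F fullv; rewrite capfv dV => E.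
have l1 : \dim (limg F) = 1%N.
  apply/eqP; rewrite eqn_leq; apply/andP; split.
    by apply: leq_trans (dimvS (subvf _)) _; rewrite dimvf.
  rewrite lt0n dimv_eq0; apply: contra fu0 => /eqP l0.
  by have := memv_img F (memvf u); rewrite l0 memv0 FE.
by move: E; rewrite l1 addn1 => -[].
Qed.

Lemma dim4_free (K : fieldType) (V : vectType K) : \dim {:V} = 4%N ->
  exists x y z t : V, free [:: x; y; z; t].
Proof.
move=> dV; have := vbasisP {:V}; move: (vbasis {:V}) (size_tuple (vbasis {:V})).
rewrite dV => -[[|x [|y [|z [|t [|]]]]]] //= _ _ b; exists x, y, z, t.
exact: basis_free b.
Qed.

(** * A three-dimensional ideal containing all brackets *)

Section DerivedSubalgebra.

Variables (K : realFieldType) (g : lieAlgType K).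
Hypothesis dim_g : \dim {:g} = 4%N.

(** The identity written as the sum of the [fi] tensored with the vectors: this is the form in which
    traces are computed. *)
Definition dual_bases (x y z t : g) (f1 f2 f3 f4 : {scalar g}) :=
  forall u, u = f1 u *: x + f2 u *: y + f3 u *: z + f4 u *: t.

Definition bracket_trace (x y z t : g) (f1 f2 f3 f4 : {scalar g}) (u : g) :=
  f1 (bracket u x) + f2 (bracket u y) + f3 (bracket u z) + f4 (bracket u t).

(** By Jacobi, [ad] of a bracket is a commutator of operators, and a commutator has trace zero. *)
Lemma bracket_trace_bracket x y z t f1 f2 f3 f4 u v :
  dual_bases x y z t f1 f2 f3 f4 ->
  bracket_trace x y z t f1 f2 f3 f4 (bracket u v) = 0.
Proof.
move=> dec.
have J s : bracket (bracket u v) s = bracket u (bracket v s) - bracket v (bracket u s).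
  by rewrite [bracket u (bracket v s)]brJ addrK.
have E (f : {scalar g}) w s : f (bracket w s) = f1 s * f (bracket w x) +
    f2 s * f (bracket w y) + f3 s * f (bracket w z) + f4 s * f (bracket w t).
  by rewrite {1}(dec s) !brE !(linearD, linearZ).
rewrite /bracket_trace !J !linearB /=.
rewrite !(E _ u (bracket _ _)) !(E _ v (bracket _ _)).
by ring.
Qed.

(* The 4-form [d f4 /\ d psi = d (f4 /\ d psi)] is exact, hence zero when all the traces vanish. *)
Lemma wedge_differential_eq0 x y z t f1 f2 f3 f4 (psi : {scalar g}) :
  dual_bases x y z t f1 f2 f3 f4 ->
  (forall u, bracket_trace x y z t f1 f2 f3 f4 u = 0) ->
  f4 (bracket x y) * psi (bracket z t) + psi (bracket x y) * f4 (bracket z t) -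
  f4 (bracket x z) * psi (bracket y t) - psi (bracket x z) * f4 (bracket y t) +
  f4 (bracket x t) * psi (bracket y z) + psi (bracket x t) * f4 (bracket y z) = 0.
Proof.
move=> dec tr.
have anti (f : {scalar g}) u v : f (bracket u v) = - f (bracket v u) by rewrite brC linearN.
have E w s : psi (bracket w s) = f1 s * psi (bracket w x) + f2 s * psi (bracket w y) +
    f3 s * psi (bracket w z) + f4 s * psi (bracket w t).
  by rewrite {1}(dec s) !brE !(linearD, linearZ).
(* [psi] of the Jacobi identity for [x], [y], [z]. Expanded in the basis it becomes the goal, once
   the vanishing traces express [f4] of the brackets with [t] through the other coefficients. *)
have J : psi (bracket x (bracket y z)) + psi (bracket z (bracket x y)) -
    psi (bracket y (bracket x z)) = 0.
  by rewrite brJ linearD (anti psi (bracket x y)) /=; ring.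
rewrite (E x (bracket y z)) (E z (bracket x y)) (E y (bracket x z)) in J.
have x_trace : f4 (bracket x t) = - (f2 (bracket x y) + f3 (bracket x z)).
  by apply/eqP; rewrite -subr_eq0 -(tr x) /bracket_trace bracketxx linear0; apply/eqP; ring.
have y_trace : f4 (bracket y t) = f1 (bracket x y) - f3 (bracket y z).
  by apply/eqP; rewrite -subr_eq0 -(tr y) /bracket_trace bracketxx linear0 (anti f1 y x);
    apply/eqP; ring.
have z_trace : f4 (bracket z t) = f1 (bracket x z) + f2 (bracket y z).
  by apply/eqP; rewrite -subr_eq0 -(tr z) /bracket_trace bracketxx linear0 (anti f1 z x)
    (anti f2 z y); apply/eqP; ring.
rewrite -[RHS]J x_trace y_trace z_trace !bracketxx !linear0.
by rewrite (anti psi z x) (anti psi z y) (anti psi y x); ring.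
Qed.

Theorem derived_subalgebra_proper : exists2 n : {vspace g},
  \dim n = 3%N & forall u v : g, bracket u v \in n.
Proof.
suff [f [u fu0] fB] : exists2 f : {scalar g}, exists u, f u != 0 & forall u v, f (bracket u v) = 0.
  have [n dn nP] := scalar_hyperplane dim_g fu0.
  by exists n => // v w; rewrite nP fB.
have [x1 [x2 [x3 [x4 fr]]]] := dim4_free dim_g.
have [f1 [f2 [f3 [f4 [dec [f11 f12 f13 f14] [f21 f22 f23 f24] [f31 f32 f33 f34]
  [f41 f42 f43 f44]]]]]] := free4_dual dim_g fr.
pose tr := bracket_trace x1 x2 x3 x4 f1 f2 f3 f4.
have [[u tru]|notr] := pselect (exists u, tr u != 0).
  (* A nonzero trace is already a form that vanishes on all brackets. *)
  have [|f fE] := @scalar_of_fun _ _ tr.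
    by move=> a v w; rewrite /tr /bracket_trace !brE !(linearD, linearZ) /=; ring.
  by exists f; [exists u; rewrite fE | move=> v w; rewrite fE /tr bracket_trace_bracket].
have tr0 u : tr u = 0 by apply/eqP; apply: contraT => tru; case: notr; exists u.
have anti (f : {scalar g}) u v : f (bracket u v) = - f (bracket v u) by rewrite brC linearN.
pose fs := [:: f1; f2; f3; f4].
pose P := [:: bracket x1 x2; bracket x1 x3; bracket x1 x4;
              bracket x2 x3; bracket x2 x4; bracket x3 x4].
(* [Q] lists the pairs complementary to those of [P], with the signs that make the sum over [j] the
   wedge pairing of two 2-forms. The rows of [C] are the differentials of the [fi], so [C *m C']
   collects their wedge products. *)
pose Q := [:: bracket x3 x4; - bracket x2 x4; bracket x2 x3;
              bracket x1 x4; - bracket x1 x3; bracket x1 x2].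
pose C : 'M[K]_(4, 6) := \matrix_(i, j) nth f1 fs i (nth 0 P j).
pose C' : 'M[K]_(6, 4) := \matrix_(i, j) nth f1 fs j (nth 0 Q i).
have wedge0 (k : nat) (psi : {scalar g}) : (k < 4)%N ->
    \sum_(j < 6) nth f1 fs k (nth 0 P j) * psi (nth 0 Q j) = 0.
  rewrite !big_ord_recl big_ord0 /= addr0 !linearN.
  case: k => [|[|[|[|//]]]] _ /=.
  - rewrite -[RHS]oppr0 -(@wedge_differential_eq0 x2 x3 x4 x1 f2 f3 f4 f1 psi).
    + by rewrite !(anti _ x4 x1, anti _ x3 x1, anti _ x2 x1); ring.
    + by move=> u; rewrite {1}(dec u); vring.
    + by move=> u; rewrite -(tr0 u) /tr /bracket_trace; ring.
  - rewrite -(@wedge_differential_eq0 x1 x3 x4 x2 f1 f3 f4 f2 psi).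
    + by rewrite !(anti _ x4 x2, anti _ x3 x2); ring.
    + by move=> u; rewrite {1}(dec u); vring.
    + by move=> u; rewrite -(tr0 u) /tr /bracket_trace; ring.
  - rewrite -[RHS]oppr0 -(@wedge_differential_eq0 x1 x2 x4 x3 f1 f2 f4 f3 psi).
    + by rewrite !(anti _ x4 x3); ring.
    + by move=> u; rewrite {1}(dec u); vring.
    + by move=> u; rewrite -(tr0 u) /tr /bracket_trace; ring.
  - rewrite -(@wedge_differential_eq0 x1 x2 x3 x4 f1 f2 f3 f4 psi) //; ring.
have CC' : C *m C' = 0.
  apply/matrixP => k l; rewrite !mxE -[RHS](wedge0 k (nth f1 fs l)) //.
  by apply: eq_bigr => j _; rewrite !mxE.
have comb (c : 'I_4 -> K) : exists f : {scalar g}, forall u,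
    f u = \sum_(k < 4) c k * nth f1 fs k u.
  apply: scalar_of_fun => a v w; rewrite mulr_sumr -big_split /=; apply: eq_bigr => k _.
  by rewrite linearD linearZ /=; ring.
have comb_neq0 c (f : {scalar g}) (k : 'I_4) :
    (forall u, f u = \sum_(k < 4) c k * nth f1 fs k u) -> c k != 0 -> exists u, f u != 0.
  move=> fE ck; exists (nth 0 [:: x1; x2; x3; x4] k).
  rewrite fE (bigD1 k) //= big1 ?addr0.
    by case: k ck => [[|[|[|[|//]]]] k4] ck /=; rewrite ?f11 ?f22 ?f33 ?f44 mulr1.
  move=> i; rewrite -val_eqE.
  by case: i k {ck} => [[|[|[|[|//]]]] i4] [[|[|[|[|//]]]] k4] //= _;
    rewrite ?f12 ?f13 ?f14 ?f21 ?f23 ?f24 ?f31 ?f32 ?f34 ?f41 ?f42 ?f43 mulr0.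
have pairs (f : {scalar g}) : (forall j : 'I_6, f (nth 0 P j) = 0) \/
    (forall j : 'I_6, f (nth 0 Q j) = 0) -> forall u v, f (bracket u v) = 0.
  move=> H; suff : [/\ f (bracket x1 x2) = 0, f (bracket x1 x3) = 0, f (bracket x1 x4) = 0 &
      [/\ f (bracket x2 x3) = 0, f (bracket x2 x4) = 0 & f (bracket x3 x4) = 0]].
    move=> [h12 h13 h14 [h23 h24 h34]] u v; rewrite (dec u) (dec v) !brE.
    rewrite !(linearD, linearN, linearZ, linear0) /=.
    rewrite (anti f x2 x1) (anti f x3 x1) (anti f x4 x1).
    rewrite (anti f x3 x2) (anti f x4 x2) (anti f x4 x3).
    by rewrite h12 h13 h14 h23 h24 h34 !(oppr0, mulr0, addr0).
  case: H => H; have := (H (Ordinal (isT : (0 < 6)%N)), H (Ordinal (isT : (1 < 6)%N)),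
    H (Ordinal (isT : (2 < 6)%N)), H (Ordinal (isT : (3 < 6)%N)),
    H (Ordinal (isT : (4 < 6)%N)), H (Ordinal (isT : (5 < 6)%N))).
    by move=> [[[[[h0 h1] h2] h3] h4] h5].
  move=> /= [[[[[h0 h1] h2] h3] h4] h5]; split=> //.
    by rewrite -[LHS]opprK -linearN h4 oppr0.
  by split=> //; rewrite -[LHS]opprK -linearN h1 oppr0.
have ker (c : 'I_4 -> K) k : c k != 0 ->
    (forall j : 'I_6, \sum_(k < 4) c k * nth f1 fs k (nth 0 P j) = 0) \/
    (forall j : 'I_6, \sum_(k < 4) c k * nth f1 fs k (nth 0 Q j) = 0) ->
    exists2 f : {scalar g}, exists u, f u != 0 & forall u v, f (bracket u v) = 0.
  move=> ck H; have [f fE] := comb c; exists f; first exact: comb_neq0 fE ck.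
  by apply: pairs; case: H => H; [left | right] => j; rewrite fE.
(* From [C *m C' = 0] the ranks of [C] and [C'] add up to at most 6, so they are not both 4; a
   linear relation in either matrix is a combination of the [fi] that kills all brackets. *)
have [rC|rC] := boolP (row_free C); last first.
  move: rC; rewrite -kermx_eq0 => /rowV0Pn [c /sub_kermxP cC /rV0Pn [k ck]].
  apply: (ker (c 0) k ck); left=> j; have := congr1 (fun M : 'rV_6 => M 0 j) cC.
  by rewrite !mxE => cj; apply: etrans cj; apply: eq_bigr => i _; rewrite ?mxE.
have rC' : ~~ row_free C'^T.
  apply/negP => /eqP; rewrite mxrank_tr => rC'.
  by have := mulmx0_rank_max CC'; rewrite (eqP rC) rC'.
move: rC'; rewrite -kermx_eq0 => /rowV0Pn [c /sub_kermxP cC /rV0Pn [k ck]].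
apply: (ker (c 0) k ck); right=> j; have := congr1 (fun M : 'rV_6 => M 0 j) cC.
by rewrite !mxE => cj; apply: etrans cj; apply: eq_bigr => i _; rewrite ?mxE.
Qed.

End DerivedSubalgebra.

(** * The coarse classification, by the derived algebra of the ideal *)

Section Structure.

Variables (K : rcfType) (g : lieAlgType K).
Hypothesis dim_g : \dim {:g} = 4%N.
Hypothesis gen_g : exists q : {vspace g}, generating3 q.
Implicit Types (e u v w x y z k : g) (U W q : {vspace g}).

Definition classified_or_exceptional := [\/ hyperplanes_classified g, is_2g21 g | is_g36_g1 g].

Lemma abelian_span_hyperplanes x v1 v2 v3 (V := <<[:: v1; v2; v3]>>%VS) :
  free [:: x; v1; v2; v3] ->
  bracket v1 v2 = 0 -> bracket v1 v3 = 0 -> bracket v2 v3 = 0 ->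
  bracket x v1 \in V -> bracket x v2 \in V -> bracket x v3 \in V ->
  classified_or_exceptional.
Proof.
rewrite free_cons => /andP [xV frV] b12 b13 b23 x1 x2 x3; constructor 1.
have [q gq] := gen_g.
apply: (@abelian_ideal_hyperplanes _ _ dim_g V x _ _ xV _ q gq).
- exact/eqP.
- move=> u w uV wV; apply/eqP; rewrite -memv0.
  by apply: (bracket_in_span3 _ _ _ uV wV); rewrite ?b12 ?b13 ?b23 mem0v.
by move=> u /in_span3 [a [b [c ->]]]; rewrite !brE !memvD // memvZ.
Qed.

(* [f] acts on the plane of [w] and [y] with square [kap]: the sign of [kap] decides between
   the affine algebra of the complex line, a Heisenberg ideal and [2g_{2,1}]. *)
Lemma diagonal_pencil_hyperplanes e f w y kap :
  free [:: e; f; w; y] -> bracket e f = 0 -> bracket w y = 0 ->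
  bracket e w = w -> bracket e y = y -> bracket f w = y -> bracket f y = kap *: w ->
  classified_or_exceptional.
Proof.
move=> fr ef wy ew ey fw fy.
have fe : bracket f e = 0 by rewrite brC ef oppr0.
have yw : bracket y w = 0 by rewrite brC wy oppr0.
have we : bracket w e = - w by rewrite brC ew.
have ye : bracket y e = - y by rewrite brC ey.
have wf : bracket w f = - y by rewrite brC fw.
have yf : bracket y f = - (kap *: w) by rewrite brC fy.
have tbl := (brE, ef, wy, ew, ey, fw, fy, fe, yw, we, ye, wf, yf).
have [kap0|kap0|kap0] := ltgtP kap 0.
(* Dividing [f] by the square root of [- kap] makes it act as the imaginary unit. *)
- constructor 1; have r0 : 0 < Num.sqrt (- kap) by rewrite sqrtr_gt0 oppr_gt0.
  have rE : Num.sqrt (- kap) ^+ 2 = - kap by rewrite sqr_sqrtr // oppr_ge0 ltW.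
  move: (Num.sqrt _) r0 rE => r /gt_eqF /negbT r0 rE.
  apply: (@complex_affine_hyperplanes _ _ dim_g e (r^-1 *: f) w (r^-1 *: y)).
  split.
  + apply: (free4_sub fr) => U eU fU wU yU; split=> //.
      by rewrite -[f](scalerKV r0) memvZ.
    by rewrite -[y](scalerKV r0) memvZ.
  + by rewrite !tbl; vring.
  + by rewrite !tbl; vring.
  split; rewrite !tbl //.
  rewrite !scalerA -[kap]opprK -rE (_ : _ * _ = -1) ?scaleN1r //.
  by rewrite mulrN -expr2 exprVn mulVf // expf_neq0.
(* [f] has the eigenvectors [y + r w] and [y - r w] for [r] and [-r], and the halves of [e + f / r]
   and [e - f / r] act as the two projections. The minus signs fit the convention [[E1, E2] =
   E1]. *)
- constructor 2; have r0 : 0 < Num.sqrt kap by rewrite sqrtr_gt0.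
  have rE : Num.sqrt kap ^+ 2 = kap by rewrite sqr_sqrtr // ltW.
  move: (Num.sqrt _) r0 rE => r /gt_eqF /negbT r0 rE.
  have two0 : (2%:R : K) != 0 by rewrite pnatr_eq0.
  have E1 : bracket (y + r *: w) (- (2%:R^-1 *: (e + r^-1 *: f))) = y + r *: w.
    rewrite !tbl -rE; apply: scalar_ext => phi.
    by rewrite !(linearD, linearN, linearZ, linear0) /=; field; rewrite ?r0.
  have E2 : bracket (y - r *: w) (- (2%:R^-1 *: (e - r^-1 *: f))) = y - r *: w.
    rewrite !tbl -rE; apply: scalar_ext => phi.
    by rewrite !(linearD, linearN, linearZ, linear0) /=; field; rewrite ?r0.
  exists (y + r *: w), (- (2%:R^-1 *: (e + r^-1 *: f))).
  exists (y - r *: w), (- (2%:R^-1 *: (e - r^-1 *: f))).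
  split; last first.
    split=> //; split; rewrite !tbl -?rE; apply: scalar_ext => phi;
    by rewrite !(linearD, linearN, linearZ, linear0) /=; field; rewrite ?r0.
  rewrite basisEfree subvf dim_g andbT; apply: (free4_sub fr) => U m1 m2 m3 m4.
  have yU : y \in U.
    have -> : y = 2%:R^-1 *: ((y + r *: w) + (y - r *: w)).
      by apply: scalar_ext => phi; rewrite !(linearD, linearN, linearZ) /=; field.
    by rewrite memvZ // memvD.
  have eU : e \in U.
    have -> : e = - ((- (2%:R^-1 *: (e + r^-1 *: f))) + (- (2%:R^-1 *: (e - r^-1 *: f)))).
      by apply: scalar_ext => phi; rewrite !(linearD, linearN, linearZ) /=; field; rewrite ?r0.
    by rewrite memvN memvD.
  split=> //.
    have -> : f = - r *: ((- (2%:R^-1 *: (e + r^-1 *: f))) - (- (2%:R^-1 *: (e - r^-1 *: f)))).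
      by apply: scalar_ext => phi; rewrite !(linearD, linearN, linearZ) /=; field; rewrite ?r0.
    by rewrite memvZ // memvB.
  have -> : w = r^-1 *: ((y + r *: w) - y) by rewrite addrC addKr scalerK.
  by rewrite memvZ // memvB.
(* Here [f], [w] and [y = [f, w]] span a Heisenberg ideal, on which [e] acts by 0, 1 and 1. *)
constructor 1; apply: (@heisenberg_ideal_hyperplanes _ _ dim_g 0 0 0 1 e f w y).
split=> //; first by rewrite fy kap0 scale0r.
by split; rewrite ?ef ?ew ?ey; vring.
Qed.

Variables (n : {vspace g}) (e0 : g).
Hypothesis dim_n : \dim n = 3%N.
Hypothesis bracket_n : forall u v, bracket u v \in n.
Hypothesis e0_notin_n : e0 \notin n.

Let span_n x y z : x \in n -> y \in n -> z \in n -> free [:: x; y; z] ->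
  n = <<[:: x; y; z]>>%VS.
Proof.
by move=> *; apply: free_span_eq => // u; rewrite !inE => /or3P [] /eqP ->.
Qed.

Let free_n e x y z : e \notin n -> x \in n -> y \in n -> z \in n ->
  free [:: x; y; z] -> free [:: e; x; y; z].
Proof. by move=> en xn yn zn fr; rewrite free_cons fr andbT -(span_n xn yn zn fr). Qed.

(** If [z] is central in [n], then [n] is a Heisenberg algebra. Otherwise [n] is the affine algebra
    of the line, spanned by [x1] and [z], plus a centre [k], and the action of a vector outside [n]
    can be reduced to its effect on [k]. *)
Lemma derived_dim1_case z : z != 0 ->
  (forall u v, u \in n -> v \in n -> bracket u v \in <[z]>%VS) ->
  (exists u v, [/\ u \in n, v \in n & bracket u v != 0]) ->
  classified_or_exceptional.
Proof.
move=> z0 nz [x0 [y0 [x0n y0n xy0]]].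
have [n1 [n2 [n3 [frn nE]]]] := dim3_span dim_n.
have [n1n n2n n3n] : [/\ n1 \in n, n2 \in n & n3 \in n] by rewrite nE; apply: mem_span3.
have zn : z \in n.
  have /vlineP [a xyE] := nz _ _ x0n y0n.
  have a0 : a != 0 by apply: contraNneq xy0 => a0; rewrite xyE a0 scale0r.
  by rewrite -[z](scalerK a0) memvZ // -xyE.
have [[x [xn xz0]]|ncz] := pselect (exists x, x \in n /\ bracket x z != 0); last first.
  have zc u : u \in n -> bracket u z = 0.
    by move=> un; apply/eqP; apply: contraT => uz; case: ncz; exists u.
  have z'c u : u \in n -> bracket u (bracket x0 y0) = 0.
    by move=> un; have /vlineP [a ->] := nz _ _ x0n y0n; rewrite brZr zc // scaler0.
  have fr : free [:: x0; y0; bracket x0 y0].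
    apply/free3P => p q r E.
    have p0 : p = 0.
      have : p *: bracket x0 y0 = 0.
        by rewrite -(br0l y0) -E !brE [bracket (bracket _ _) _]brC z'c // !(oppr0, scaler0, addr0).
      by move/eqP; rewrite scaler_eq0 (negPf xy0) orbF => /eqP.
    have q0 : q = 0.
      have : q *: bracket x0 y0 = 0.
        by rewrite -(br0r x0) -E !brE z'c // !(scaler0, add0r, addr0).
      by move/eqP; rewrite scaler_eq0 (negPf xy0) orbF => /eqP.
    move: E; rewrite p0 q0 !scale0r !add0r => /eqP.
    by rewrite scaler_eq0 (negPf xy0) orbF => /eqP.
  have nE' := span_n x0n y0n (bracket_n _ _) fr.
  have [a [b [c exE]]] : exists a b c, bracket e0 x0 = a *: x0 + b *: y0 + c *: bracket x0 y0.
    by apply/in_span3; rewrite -nE'.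
  have [a' [b' [c' eyE]]] : exists a b c, bracket e0 y0 = a *: x0 + b *: y0 + c *: bracket x0 y0.
    by apply/in_span3; rewrite -nE'.
  constructor 1; apply: heisenberg_ideal_hyperplanes => //.
  apply: heisenberg_frame_correct exE eyE => //; try exact: z'c.
  exact: free_n.
have [s s0 xzE] : exists2 s, s != 0 & bracket x z = s *: z.
  have /vlineP [s xzE] := nz _ _ xn zn; exists s => //.
  by apply: contraNneq xz0 => s0; rewrite xzE s0 scale0r.
have [x1 x1n x1z] : exists2 x1, x1 \in n & bracket x1 z = z.
  by exists (s^-1 *: x); [rewrite memvZ | rewrite brZl xzE scalerK].
have /vlineP [r3 b12] := nz _ _ n1n n2n.
have /vlineP [r2 b13] := nz _ _ n1n n3n.
have /vlineP [r1 b23] := nz _ _ n2n n3n.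
have [k [kn kc k0]] : exists k, [/\ k \in n, forall u, u \in n -> bracket u k = 0 & k != 0].
  (* The bracket of [n] is [z] times a 2-form, which has a radical because the dimension 3 is odd;
     this is the vector of its coefficients. *)
  exists (r1 *: n1 - r2 *: n2 + r3 *: n3); split.
  - by rewrite memvD ?memvB // memvZ.
  - move=> u; rewrite nE => /in_span3 [a [b [c ->]]]; rewrite !brE.
    by rewrite [bracket n2 n1]brC [bracket n3 n1]brC [bracket n3 n2]brC b12 b13 b23; vring.
  apply: contraNneq xy0 => kE; have /free3P H3 := frn.
  have [|r10 /eqP r20 r30] := H3 r1 (- r2) r3; first by rewrite -kE; vring.
  rewrite oppr_eq0 in r20; move/eqP in r20.
  have := x0n; rewrite nE => /in_span3 [a [b [c ->]]].
  have := y0n; rewrite nE => /in_span3 [a' [b' [c' ->]]].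
  rewrite !brE [bracket n2 n1]brC [bracket n3 n1]brC [bracket n3 n2]brC b12 b13 b23 r10 r20 r30.
  by apply/eqP; vring.
have fr3 : free [:: x1; z; k].
  apply/free3P => p q r E.
  have p0 : p = 0.
    have : p *: z = 0.
      by rewrite -(br0l z) -E !brE x1z [bracket k z]brC kc // !(oppr0, scaler0, addr0).
    by move/eqP; rewrite scaler_eq0 (negPf z0) orbF => /eqP.
  have q0 : q = 0.
    have : q *: z = 0 by rewrite -(br0r x1) -E !brE x1z kc // !(scaler0, add0r, addr0).
    by move/eqP; rewrite scaler_eq0 (negPf z0) orbF => /eqP.
  move: E; rewrite p0 q0 !scale0r !add0r => /eqP.
  by rewrite scaler_eq0 (negPf k0) orbF => /eqP.
have nE' := span_n x1n zn kn fr3; have /free3P H3 := fr3.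
have zx1 : bracket z x1 = - z by rewrite brC x1z.
have kx1 : bracket k x1 = 0 by rewrite brC kc // oppr0.
have zk : bracket z k = 0 by rewrite kc.
have kz : bracket k z = 0 by rewrite brC zk oppr0.
have x1k : bracket x1 k = 0 by rewrite kc.
have [zeta ezE] : exists zeta, bracket e0 z = zeta *: z.
  apply/vlineP; rewrite -{1}x1z brJ memvD // nz //.
have [e1 e1n e1z] : exists2 e1, e1 \notin n & bracket e1 z = 0.
  exists (e0 - zeta *: x1); last by rewrite !brE ezE x1z subrr.
  by apply: contra e0_notin_n => m; rewrite -[e0](subrK (zeta *: x1)) memvD // memvZ.
have [gam e1k] : exists gam, bracket e1 k = gam *: k.
  have [a [b [gam E]]] : exists a b c, bracket e1 k = a *: x1 + b *: z + c *: k.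
    by apply/in_span3; rewrite -nE'.
  (* A derivation preserves the centre of [n]: the components on [x1] and [z] are killed by the
     brackets with [z] and [x1]. *)
  exists gam; have Jx := brJ e1 x1 k; have Jz := brJ e1 z k.
  rewrite x1k br0r kc // add0r E !brE x1z x1k !scaler0 add0r addr0 in Jx.
  rewrite zk e1z br0r br0l add0r E !brE zx1 zk !scaler0 !addr0 in Jz.
  rewrite E; move/esym/eqP: Jx; rewrite scaler_eq0 (negPf z0) orbF => /eqP ->.
  move/esym/eqP: Jz; rewrite scalerN oppr_eq0 scaler_eq0 (negPf z0) orbF => /eqP ->.
  by rewrite !scale0r !add0r.
have [eta [bet e1x]] : exists eta bet, bracket e1 x1 = eta *: z + bet *: k.
  have [a [eta [bet E]]] : exists a b c, bracket e1 x1 = a *: x1 + b *: z + c *: k.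
    by apply/in_span3; rewrite -nE'.
  exists eta, bet; have J := brJ e1 x1 z.
  rewrite x1z e1z br0r addr0 E !brE x1z kz !scaler0 !addr0 in J.
  rewrite E; move/esym/eqP: J; rewrite scaler_eq0 (negPf z0) orbF => /eqP ->.
  by rewrite scale0r add0r.
have [e2 [e2n e2x e2z e2k]] : exists e2, [/\ e2 \notin n, bracket e2 x1 = bet *: k,
    bracket e2 z = 0 & bracket e2 k = gam *: k].
  exists (e1 + eta *: z); split.
  - by apply: contra e1n => m; rewrite -[e1](addrK (eta *: z)) memvB // memvZ.
  - by rewrite !brE e1x zx1; vring.
  - by rewrite !brE e1z; vring.
  by rewrite !brE e1k zk; vring.
have fr4 : free [:: e2; x1; z; k] by apply: free_n.
have x1e2 : bracket x1 e2 = - (bet *: k) by rewrite brC e2x.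
(* For [gam = 0] the vectors [e2], [z], [k] span an abelian ideal. Otherwise the two affine summands
   are visible, after a correction of [x1] along [k] that makes it commute with [e2]. *)
have [gam0|gam0] := eqVneq gam 0.
  rewrite gam0 scale0r in e2k.
  have [m1 m2 m3] := mem_span3 e2 z k.
  apply: (@abelian_span_hyperplanes x1 e2 z k) => //.
  - by apply: (free4_sub fr4) => U *; split.
  - by rewrite x1e2 memvN memvZ.
  - by rewrite x1z.
  by rewrite x1k mem0v.
constructor 2; exists z, (- (x1 - (bet / gam) *: k)), k, (- (gam^-1 *: e2)).
have ze2 : bracket z e2 = 0 by rewrite brC e2z oppr0.
have ke2 : bracket k e2 = - (gam *: k) by rewrite brC e2k.
split.
  rewrite basisEfree subvf dim_g andbT; apply: (free4_sub fr4) => U zU xU kU eU; split=> //.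
    by rewrite -[e2](scalerKV gam0) memvZ // -memvN.
  rewrite -[x1](subrK ((bet / gam) *: k)) memvD ?memvZ // -memvN //.
split.
- by rewrite !brE zx1 zk; vring.
- by rewrite !brE ke2; apply: scalar_ext => phi; rewrite !(linearN, linearZ) /=; field.
split; rewrite ?brE ?zk ?ze2 ?x1k ?kx1 ?x1e2 ?ke2 ?bracketxx ?scaler0 ?subr0 ?oppr0 //.
by apply: scalar_ext => phi; rewrite !(linearD, linearN, linearZ) /=; field.
Qed.

(** Two commuting operators on a plane: if they are proportional, some combination centralises [W]
    and there is an abelian ideal; if not, a combination acts as the identity and another has a
    scalar square. *)
Lemma commuting_pencil_hyperplanes x e w1 w2 (W := <<[:: w1; w2]>>%VS) :
  free [:: e; x; w1; w2] -> bracket e x = 0 -> bracket w1 w2 = 0 ->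
  (forall w, w \in W -> bracket x w \in W) -> (forall w, w \in W -> bracket e w \in W) ->
  free [:: bracket x w1; bracket x w2] ->
  classified_or_exceptional.
Proof.
move=> fr ex w12 xW eW frx; have /free2P Hx := frx.
have [w1W w2W] : w1 \in W /\ w2 \in W by split; rewrite memv_span // !inE eqxx ?orbT.
have Wab u v : u \in W -> v \in W -> bracket u v = 0.
  move=> /in_span2 [a [b ->]] /in_span2 [c [d ->]].
  by rewrite !brE [bracket w2 w1]brC w12 !(oppr0, scaler0, addr0).
have xe : bracket x e = 0 by rewrite brC ex oppr0.
have dW : \dim W = 2%N by apply/eqP; apply: (catr_free (fr : free ([:: e; x] ++ _))).
have [[lam elam]|nlam] := pselect
    (exists lam, forall w, w \in W -> bracket e w = lam *: bracket x w).
  have pw w : w \in W -> bracket (e - lam *: x) w = 0.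
    by move=> wW; rewrite !brE elam // subrr.
  have W3 w : w \in W -> w \in <<[:: (e - lam *: x)%R; w1; w2]>>%VS.
    by move=> wW; rewrite span_cons (subvP (addvSr _ _)).
  apply: (@abelian_span_hyperplanes x (e - lam *: x) w1 w2); rewrite ?pw //.
  - apply: (free4_sub fr) => U xU pU w1U w2U; split=> //.
    by rewrite -[e](subrK (lam *: x)) memvD // memvZ.
  - by rewrite !brE xe scaler0 subr0 mem0v.
  - exact/W3/xW.
  exact/W3/xW.
(* If the images under [x] and [e] were dependent at every [w], the ratios at [w1], [w2] and
   [w1 + w2] would coincide, as [x] is injective on [W]. *)
have [w wW frw] : exists2 w, w \in W & free [:: bracket x w; bracket e w].
  apply: contra_notP nlam => nw.
  have dep w : w \in W -> bracket x w != 0 -> exists lam, bracket e w = lam *: bracket x w.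
    move=> wW xw0; apply: contra_notP nw => nl; exists w => //.
    apply/free2P => p q E; have [q0|q0] := eqVneq q 0.
      move: E; rewrite q0 scale0r addr0 => /eqP; rewrite scaler_eq0 (negPf xw0) orbF => /eqP ->.
      by [].
    case: nl; exists (- (q^-1 * p)); rewrite -[bracket e w](scalerK q0).
    by rewrite -[q *: _](addKr (p *: bracket x w)) E addr0 scalerN scalerA scaleNr.
  have xw0 a b : (a != 0) || (b != 0) -> bracket x (a *: w1 + b *: w2) != 0.
    move=> ab; apply/eqP; rewrite !brE => /Hx [a0 b0].
    by move: ab; rewrite a0 b0 eqxx.
  have [l1 E1] : exists lam, bracket e w1 = lam *: bracket x w1.
    by apply: dep => //; have := xw0 1 0; rewrite scale1r scale0r addr0 oner_eq0; apply.
  have [l2 E2] : exists lam, bracket e w2 = lam *: bracket x w2.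
    by apply: dep => //; have := xw0 0 1; rewrite scale1r scale0r add0r oner_eq0 orbT; apply.
  have [l3 E3] : exists lam, bracket e (w1 + w2) = lam *: bracket x (w1 + w2).
    apply: dep; first exact: memvD.
    by have := xw0 1 1; rewrite !scale1r oner_eq0; apply.
  have [|m1 m2] := Hx (l1 - l3) (l2 - l3).
    transitivity (bracket e (w1 + w2) - l3 *: bracket x (w1 + w2)); last by rewrite E3 subrr.
    by rewrite !brE E1 E2; vring.
  exists l3 => u /in_span2 [a [b ->]]; rewrite !brE E1 E2.
  move/eqP: m1; rewrite subr_eq0 => /eqP ->; move/eqP: m2; rewrite subr_eq0 => /eqP ->.
  by vring.
have WE : W = <<[:: bracket x w; bracket e w]>>%VS.
  by apply: free_span_eq => // u; rewrite !inE => /orP [] /eqP ->; rewrite ?xW ?eW.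
have /in_span2 [al [be wE]] : w \in <<[:: bracket x w; bracket e w]>>%VS by rewrite -WE.
(* [E] fixes [w] and commutes with [x] and [e], hence fixes the images of [w], which span [W]. *)
have [E [xE eE Ew]] : exists E, [/\ bracket x E = 0, bracket e E = 0 & bracket E w = w].
  exists (al *: x + be *: e); split; last by rewrite brDl !brZl -wE.
    by rewrite !brE xe !scaler0 addr0.
  by rewrite !brE ex !scaler0 addr0.
have EW v : v \in W -> bracket E v = v.
  rewrite WE => /in_span2 [a [b ->]].
  rewrite brDr !brZr [bracket E (bracket x w)]brJ [bracket E (bracket e w)]brJ.
  by rewrite [bracket E x]brC [bracket E e]brC xE eE !(oppr0, br0l, add0r) Ew.
have [N [NW NE frN]] : exists N, [/\ forall v, v \in W -> bracket N v \in W,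
    bracket E N = 0 & free [:: w; bracket N w]].
  have w0 : w != 0.
    apply/eqP => w0; move: frw; rewrite w0 !br0r => /free2P /(_ 1 0).
    by rewrite !scaler0 addr0 => -[] // /eqP; rewrite oner_eq0.
  have key N : ~ (exists s, bracket N w = s *: w) -> free [:: w; bracket N w].
    move=> nN; apply/free2P => p q E0; have [q0|q0] := eqVneq q 0.
      by move: E0; rewrite q0 scale0r addr0 => /eqP; rewrite scaler_eq0 (negPf w0) orbF => /eqP ->.
    case: nN; exists (- (q^-1 * p)); rewrite -[bracket N w](scalerK q0).
    by rewrite -[q *: _](addKr (p *: w)) E0 addr0 scalerN scalerA scaleNr.
  have [[s xws]|/key frx'] := pselect (exists s, bracket x w = s *: w); last first.
    by exists x; split=> //; rewrite brC xE oppr0.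
  have [[r ewr]|/key fre] := pselect (exists s, bracket e w = s *: w); last first.
    by exists e; split=> //; rewrite brC eE oppr0.
  have /free2P /(_ r (- s)) := frw; case; first by rewrite xws ewr; vring.
  move=> _ /eqP; rewrite oppr_eq0 => /eqP s0.
  by have := free_not0 frw; rewrite xws s0 scale0r => /(_ 0); rewrite inE eqxx => /(_ isT).
have WN : W = <<[:: w; bracket N w]>>%VS.
  by apply: free_span_eq => // u; rewrite !inE => /orP [] /eqP -> //; exact: NW.
have /in_span2 [b [t NNw]] : bracket N (bracket N w) \in <<[:: w; bracket N w]>>%VS.
  by rewrite -WN !NW.
have two0 : (2%:R : K) != 0 by rewrite pnatr_eq0.
(* Completing the square: [N^2 = b + t N] on [W], so [N - t / 2] has square [b + t^2 / 4]. *)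
pose y := bracket N w - (t / 2%:R) *: w.
have yW : y \in W by rewrite memvB ?NW // memvZ.
apply: (@diagonal_pencil_hyperplanes E (N - (t / 2%:R) *: E) w y (b + t ^+ 2 / 4%:R)).
- apply/free4P => p q r s E0.
  have tot : r *: w + s *: y \in W by rewrite memvD // memvZ.
  have Nw' : bracket (N - (t / 2%:R) *: E) w = y by rewrite !brE Ew.
  have frwy : free [:: w; y].
    apply/free2P => p' q' E1; have /free2P /(_ (p' - q' * (t / 2%:R)) q') := frN.
    case; first by rewrite -E1 /y; vring.
    by move=> + q0; rewrite q0 mul0r subr0.
  have /free2P Hwy := frwy.
  have [p0 q0] : p = 0 /\ q = 0.
    apply: Hwy; apply: etrans (br0l w); rewrite -E0 !brDl !brZl Ew Nw' (Wab y w) // (Wab w w) //.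
    by rewrite !scaler0 !addr0.
  have [|-> ->] := Hwy r s; last by rewrite p0 q0.
  by rewrite -E0 p0 q0 !scale0r !add0r.
- by rewrite brDr brNr brZr NE bracketxx scaler0 subr0.
- exact: Wab.
- exact: Ew.
- exact: EW.
- by rewrite brDl brNl brZl Ew.
rewrite brDl brNl brZl (EW y yW) /y brDr brNr brZr NNw.
by apply: scalar_ext => phi; rewrite !(linearD, linearN, linearZ) /=; field.
Qed.

(** Jacobi forces [W], the derived algebra of [n], to be abelian. Then [x] acts invertibly on it,
    which allows [e0] to be corrected by an element of [W] so as to commute with [x]. *)
Lemma derived_dim2_case W : \dim W = 2%N -> (W <= n)%VS ->
  (forall u v, u \in n -> v \in n -> bracket u v \in W) ->
  (forall U, (forall u v, u \in n -> v \in n -> bracket u v \in U) -> (W <= U)%VS) ->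
  classified_or_exceptional.
Proof.
move=> dW Wn nW minW.
have [w1 [w2 [frW WE]]] := dim2_span dW.
have [w1W w2W] : w1 \in W /\ w2 \in W by rewrite WE; split; rewrite memv_span // !inE eqxx ?orbT.
have [w1n w2n] := (subvP Wn w1 w1W, subvP Wn w2 w2W).
have /subvPn [x xn xW] : ~~ (n <= W)%VS by apply/negP => /dimvS; rewrite dim_n dW.
have frn y z : free [:: y; z] -> y \in W -> z \in W -> n = <<[:: x; y; z]>>%VS.
  move=> fr yW zW; apply: span_n => //; try exact: (subvP Wn).
  rewrite free_cons fr andbT; apply: contra xW => /in_span2 [a [b ->]].
  by rewrite memvD // memvZ.
have span3 y z : free [:: y; z] -> y \in W -> z \in W ->
    (W <= <<[:: bracket x y; bracket x z; bracket y z]>>)%VS.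
  move=> fr yW zW; apply: minW => u v; rewrite (frn y z fr yW zW).
  case: (mem_span3 (bracket x y) (bracket x z) (bracket y z)) => m1 m2 m3.
  exact: (bracket_in_span3 m1 m2 m3).
(* If [W] were not abelian, its brackets would span a line through [r]; since [x] acts by
   derivations, all brackets of [n] would fall in that line, against [\dim W = 2]. *)
have w12 : bracket w1 w2 = 0.
  apply/eqP; apply: contraT => r0.
  have [r w12 rW] : exists2 r, bracket w1 w2 = r & r \in W by exists (bracket w1 w2); rewrite ?nW.
  rewrite w12 in r0.
  have /subvPn [s sW sr] : ~~ (W <= <[r]>)%VS.
    by apply/negP => /dimvS; rewrite dW dim_vline r0.
  have frsr : free [:: s; r] by rewrite free_cons seq1_free r0 span_seq1 sr.
  have frrs : free [:: r; s].
    by rewrite (perm_free (_ : perm_eq _ [:: s; r])) // -[[:: r; s]]/([:: r] ++ [:: s]) perm_catC.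
  have WE' : W = <<[:: r; s]>>%VS.
    by apply: free_span_eq => // u; rewrite !inE => /orP [] /eqP ->.
  have [sig rsE] : exists sig, bracket r s = sig *: r.
    have := rW; rewrite {1}WE => /in_span2 [a [b rE]].
    have := sW; rewrite WE => /in_span2 [c [d sE]].
    by exists (a * d - b * c); rewrite {1}rE sE !brE [bracket w2 w1]brC w12; vring.
  have sig0 : sig != 0.
    apply: contraNneq r0 => sig0; rewrite sig0 scale0r in rsE.
    have [[a [b w1E]] [c [d w2E]]] : (exists a b, w1 = a *: r + b *: s) /\
        (exists a b, w2 = a *: r + b *: s) by split; apply/in_span2; rewrite -WE'.
    by rewrite -w12 w1E w2E !brE rsE [bracket s r]brC rsE !(oppr0, scaler0, addr0).
  have [rn sn] := (subvP Wn r rW, subvP Wn s sW).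
  have [[p [q xrE]] [t [v xsE]]] : (exists a b, bracket x r = a *: r + b *: s) /\
      (exists a b, bracket x s = a *: r + b *: s) by split; apply/in_span2; rewrite -WE' nW.
  have J := brJ x r s; rewrite rsE brZr xrE xsE !brE rsE in J.
  have /free2P /(_ (sig * p - p * sig - v * sig) (sig * q)) := frrs; case.
    have : sig *: (p *: r + q *: s) - (p *: (sig *: r) + v *: (sig *: r)) = 0.
      by rewrite J !(scaler0, addr0, add0r) subrr.
    by move=> <-; vring.
  move=> _ /eqP; rewrite mulf_eq0 (negPf sig0) /= => /eqP q0.
  have : (W <= <[r]>)%VS; last by move/dimvS; rewrite dW dim_vline r0.
  apply: subv_trans (span3 r s frrs rW sW) _; apply/span_subvP => u.
  have v0 : v = 0.
    move: J; rewrite q0 !(scaler0, scale0r, addr0, add0r) => /eqP; rewrite -subr_eq0 => /eqP E.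
    have : (v * sig) *: r = 0 by rewrite -[RHS]oppr0 -E; vring.
    by move/eqP; rewrite scaler_eq0 (negPf r0) orbF mulf_eq0 (negPf sig0) orbF => /eqP.
  rewrite !inE xrE xsE rsE q0 v0 !scale0r !addr0.
  by move=> /or3P [] /eqP ->; rewrite memvZ // memv_line.
have frx : free [:: bracket x w1; bracket x w2].
  rewrite /free eqn_leq dim_span /= -dW; apply: dimvS.
  apply: subv_trans (span3 w1 w2 frW w1W w2W) _; apply/span_subvP => u.
  rewrite w12 !inE => /or3P [] /eqP ->; rewrite ?mem0v //.
    by rewrite memv_span // !inE eqxx.
  by rewrite memv_span // !inE eqxx orbT.
have xWW w : w \in W -> bracket x w \in W by move=> wW; rewrite nW // (subvP Wn).
have WEx : W = <<[:: bracket x w1; bracket x w2]>>%VS.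
  by apply: free_span_eq => // u; rewrite !inE => /orP [] /eqP ->; exact: xWW.
have eWW w : w \in W -> bracket e0 w \in W.
  rewrite WEx => /in_span2 [a [b ->]]; rewrite brDr !brZr !(brJ e0 x) -WEx.
  by rewrite memvD // memvZ // memvD // nW.
have [s [u uW exE]] : exists s, exists2 u, u \in W & bracket e0 x = s *: x + u.
  have := bracket_n e0 x; rewrite {1}(frn w1 w2 frW w1W w2W) => /in_span3 [s [a [b ->]]].
  by exists s, (a *: w1 + b *: w2); rewrite ?addrA // memvD // memvZ.
have Wab v v' : v \in W -> v' \in W -> bracket v v' = 0.
  rewrite WE => /in_span2 [a [b ->]] /in_span2 [c [d ->]].
  by rewrite !brE [bracket w2 w1]brC w12 !(oppr0, scaler0, addr0).
(* On [W] the commutator of [ad e0] with the invertible [M = ad x] is [s M]. Multiplying by the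
   cofactors of [M] and taking the trace gives [2 s det M = 0]. *)
have s0 : s = 0.
  have [[m11 [m12 M1]] [m21 [m22 M2]]] : (exists a b, bracket x w1 = a *: w1 + b *: w2) /\
    (exists a b, bracket x w2 = a *: w1 + b *: w2) by split; apply/in_span2; rewrite -WE xWW.
  have [[d11 [d12 D1]] [d21 [d22 D2]]] : (exists a b, bracket e0 w1 = a *: w1 + b *: w2) /\
    (exists a b, bracket e0 w2 = a *: w1 + b *: w2) by split; apply/in_span2; rewrite -WE eWW.
  have /free2P HW := frW.
  have J1 := brJ e0 x w1; have J2 := brJ e0 x w2.
  rewrite exE brDl brZl (Wab u) // addr0 M1 D1 !brDr !brZr M1 M2 D1 D2 in J1.
  rewrite exE brDl brZl (Wab u) // addr0 M2 D2 !brDr !brZr M1 M2 D1 D2 in J2.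
  have [|e11 e12] := HW (m12 * d21 - s * m11 - d12 * m21)
     (m11 * d12 + m12 * d22 - s * m12 - d11 * m12 - d12 * m22).
    rewrite -(subrr (m11 *: (d11 *: w1 + d12 *: w2) + m12 *: (d21 *: w1 + d22 *: w2))).
    by rewrite {2}J1; vring.
  have [|e21 e22] := HW (m21 * d11 + m22 * d21 - s * m21 - d21 * m11 - d22 * m21)
     (m21 * d12 - s * m22 - d21 * m12).
    rewrite -(subrr (m21 *: (d11 *: w1 + d12 *: w2) + m22 *: (d21 *: w1 + d22 *: w2))).
    by rewrite {2}J2; vring.
  have det0 : m11 * m22 - m12 * m21 != 0.
    apply/eqP => det0; have /free2P Hx := frx.
    have [|E1 E2] := Hx m22 (- m12).
      rewrite M1 M2; transitivity ((m11 * m22 - m12 * m21) *: w1); first by vring.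
      by rewrite det0 scale0r.
    have [|E3 E4] := Hx (- m21) m11.
      rewrite M1 M2; transitivity ((m11 * m22 - m12 * m21) *: w2); first by vring.
      by rewrite det0 scale0r.
    move/eqP: E2; rewrite oppr_eq0 => /eqP E2.
    have /free2P /(_ 1 0) := frx; rewrite M1 E4 E2 !(scale0r, addr0, scaler0).
    by move=> -[] // /eqP; rewrite oner_eq0.
  apply: (mulfI det0); apply: (mulfI (_ : (-2%:R : K) != 0)); first by rewrite oppr_eq0 pnatr_eq0.
  rewrite !mulr0.
  transitivity ((m12 * d21 - s * m11 - d12 * m21) * m22
    - (m11 * d12 + m12 * d22 - s * m12 - d11 * m12 - d12 * m22) * m21
    - (m21 * d11 + m22 * d21 - s * m21 - d21 * m11 - d22 * m21) * m12
    + (m21 * d12 - s * m22 - d21 * m12) * m11); first by ring.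
  by rewrite e11 e12 e21 e22 !mul0r !subr0 addr0.
have /in_span2 [al [be uE]] : u \in <<[:: bracket x w1; bracket x w2]>>%VS by rewrite -WEx.
(* [w0] is the preimage of [u] under the invertible action of [x]. *)
pose w0 := al *: w1 + be *: w2.
have w0W : w0 \in W by rewrite memvD // memvZ.
have ex : bracket (e0 + w0) x = 0.
  by rewrite brDl exE s0 scale0r add0r [bracket w0 x]brC brDr !brZr -uE subrr.
apply: (@commuting_pencil_hyperplanes x (e0 + w0) w1 w2) => //.
- apply: free_n => //.
    apply: contra e0_notin_n => m; rewrite -[e0](addrK w0) memvB //; exact: (subvP Wn).
  rewrite free_cons frW andbT; by rewrite -WE.
- by rewrite -WE.
by rewrite -WE => w wW; rewrite brDl (Wab w0) // addr0 eWW.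
Qed.

(** * Perfect three-dimensional ideals *)

Section Perfect.

Hypothesis perfect_n : forall U,
  (forall u v, u \in n -> v \in n -> bracket u v \in U) -> (n <= U)%VS.

Let free_brackets x y z : x \in n -> y \in n -> z \in n -> free [:: x; y; z] ->
  free [:: bracket x y; bracket x z; bracket y z].
Proof.
move=> xn yn zn fr; rewrite /free eqn_leq dim_span /= -dim_n; apply/dimvS/perfect_n => u v.
rewrite (span_n xn yn zn fr).
case: (mem_span3 (bracket x y) (bracket x z) (bracket y z)) => m1 m2 m3.
exact: (bracket_in_span3 m1 m2 m3).
Qed.

Let extend_free h : h \in n -> h != 0 -> exists x y, [/\ x \in n, y \in n & free [:: h; x; y]].
Proof.
move=> hn h0.
have /subvPn [x xn xh] : ~~ (n <= <[h]>)%VS.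
  by apply/negP => /dimvS; rewrite dim_n dim_vline h0.
have frxh : free [:: x; h] by rewrite free_cons seq1_free h0 span_seq1 xh.
have /subvPn [y yn yh] : ~~ (n <= <<[:: x; h]>>)%VS.
  by apply/negP => /dimvS; rewrite dim_n (eqP frxh).
exists x, y; split=> //.
have fr : free [:: y; x; h] by rewrite free_cons yh.
by apply: (free3_sub fr) => U *; split.
Qed.

(** Such an [h] will be a complement to the image of its own [ad]. If none existed, there would be
    [[h, k] = h] and [[k, m] = k], and in the Jacobi identity for [k], [h], [m] the coefficients of
    [h] would differ by 1. *)
Lemma perfect_not_in_image : exists h, [/\ h \in n, h != 0 & forall v, v \in n -> bracket h v != h].
Proof.
apply: contrapT => nh.
have ex h : h \in n -> h != 0 -> exists2 k, k \in n & bracket h k = h.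
  move=> hn h0; apply: contrapT => nk; apply: nh; exists h; split=> // v vn.
  by apply/eqP => hv; apply: nk; exists v.
have [x0 [y0 [z0 [fr0 nE]]]] := dim3_span dim_n.
have [hn _ _] : [/\ x0 \in n, y0 \in n & z0 \in n] by rewrite nE; apply: mem_span3.
have h0 : x0 != 0 by apply: free_not0 fr0 _; rewrite inE eqxx.
move: x0 hn h0 {fr0 nE} => h hn h0.
have [k kn hk] := ex h hn h0.
have k0 : k != 0 by apply: contraNneq h0 => k0; rewrite -hk k0 br0r.
have [m mn km] := ex k kn k0.
have kh : bracket k h = - h by rewrite brC hk.
have fr : free [:: h; k; m].
  apply/free3P => p q r E.
  have E1 : r *: k - p *: h = 0 by rewrite -(br0r k) -E !brE kh km; vring.
  have : p *: h = 0 by rewrite -(br0r k) -E1 !brE kh; vring.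
  move/eqP; rewrite scaler_eq0 (negPf h0) orbF => /eqP p0.
  move: E1; rewrite p0 scale0r subr0 => /eqP; rewrite scaler_eq0 (negPf k0) orbF => /eqP r0.
  move: E; rewrite p0 r0 !scale0r add0r addr0 => /eqP.
  by rewrite scaler_eq0 (negPf k0) orbF => /eqP.
have [a [b [c hmE]]] : exists a b c, bracket h m = a *: h + b *: k + c *: m.
  by apply/in_span3; rewrite -(span_n hn kn mn fr).
have J := brJ k h m; rewrite kh km hk hmE !brE hmE kh km in J.
have /free3P /(_ (- 1) (c + b) c) := fr; case.
  apply: etrans (subrr (- (a *: h + b *: k + c *: m) + h)); rewrite -{1}J; vring.
by move=> /eqP; rewrite oppr_eq0 oner_eq0.
Qed.

(** [n] is the sum of the line of [h] and the image of [ad h]. On that image [ad h] is invertible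
    and traceless, so its square is a scalar [al], and [p] may be any vector there that is not an
    eigenvector. *)
Lemma perfect_standard_triple : exists h p s (al mu : K),
  [/\ [/\ h \in n, p \in n & s \in n], free [:: h; p; s], al != 0, mu != 0 &
      [/\ bracket h p = s, bracket h s = al *: p & bracket p s = mu *: h]].
Proof.
have [h [hn h0 him]] := perfect_not_in_image.
have [x0 [y0 [x0n y0n fr0]]] := extend_free hn h0.
have frs := free_brackets hn x0n y0n fr0.
have frxy : free [:: bracket h x0; bracket h y0].
  by apply: (@catl_free _ _ [:: bracket x0 y0]).
have imh v : v \in n -> bracket h v \in <<[:: bracket h x0; bracket h y0]>>%VS.
  rewrite (span_n hn x0n y0n fr0) => /in_span3 [a [b [c ->]]].
  by apply/in_span2; exists b, c; rewrite !brE scaler0 add0r.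
have hxy : h \notin <<[:: bracket h x0; bracket h y0]>>%VS.
  apply/negP => /in_span2 [a [b hE]].
  have := him (a *: x0 + b *: y0); rewrite !brE -hE eqxx => H.
  by have := H (memvD (memvZ a x0n) (memvZ b y0n)).
have fr : free [:: h; bracket h x0; bracket h y0] by rewrite free_cons hxy.
move: (bracket h x0) (bracket h y0) (bracket_n h x0) (bracket_n h y0) imh fr.
move=> {frxy hxy frs fr0 x0n y0n x0 y0} x y xn yn imh fr.
have [[a [b hx]] [c [d hy]]] : (exists a b, bracket h x = a *: x + b *: y) /\
    (exists a b, bracket h y = a *: x + b *: y) by split; apply/in_span2; apply: imh.
have [r0 [r1 [r2 xyE]]] : exists r0 r1 r2, bracket x y = r0 *: h + r1 *: x + r2 *: y.
  by apply/in_span3; rewrite -(span_n hn xn yn fr).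
have frs := free_brackets hn xn yn fr.
have r00 : r0 != 0.
  apply/eqP => r00; have : (\dim <<[:: bracket h x; bracket h y; bracket x y]>> <= 2)%N.
    apply: leq_trans (dim_span [:: x; y]); apply/dimvS/span_subvP => u.
    rewrite !inE => /or3P [] /eqP ->; rewrite ?imh //.
    by apply/in_span2; exists r1, r2; rewrite xyE r00 scale0r add0r.
  by rewrite (eqP frs).
(* [[x, y]] has a nonzero component [r0] on [h], while [ad h] multiplies it by the trace and has no
   component on [h] in its image. *)
have tr0 : a + d = 0.
  have J := brJ h x y.
  have yx : bracket y x = - bracket x y by rewrite brC.
  have J' : bracket h (bracket x y) = (a + d) *: bracket x y.
    by rewrite J hx hy !brE; vring.
  have /free3P H3 := fr.
  have [|E0 _ _] := H3 ((a + d) * r0) ((a + d) * r1 - (r1 * a + r2 * c))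
      ((a + d) * r2 - (r1 * b + r2 * d)).
    apply: etrans (subrr ((a + d) *: bracket x y)).
    rewrite -{2}J' xyE !brE hx hy; vring.
  by move/eqP: E0; rewrite mulf_eq0 (negPf r00) orbF => /eqP.
have hr : r1 *: bracket h x + r2 *: bracket h y = 0.
  have <- : bracket h (bracket x y) = 0.
    rewrite brJ hx hy !brE; apply: etrans (scale0r (bracket x y)).
    by rewrite -tr0; vring.
  by rewrite xyE !brE; vring.
have [r10 r20] : r1 = 0 /\ r2 = 0.
  have /free3P /(_ r1 r2 0) := frs; case; last by [].
  by rewrite hr scale0r addr0.
rewrite r10 r20 !scale0r !addr0 in xyE.
have dE : d = - a by apply/eqP; rewrite -addr_eq0 addrC tr0.
rewrite dE in hy; clear r1 r2 hr r10 r20 tr0 dE d.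
have yx : bracket y x = - (r0 *: h) by rewrite brC xyE.
have al0 : a ^+ 2 + b * c != 0.
  apply/eqP => al0; have /free3P H3 := frs.
  have [|a0 b0 _] := H3 a b 0.
    by rewrite hx hy; transitivity ((a ^+ 2 + b * c) *: x); [vring | rewrite al0 scale0r].
  have [|c0 _ _] := H3 c (- a) 0.
    by rewrite hx hy; transitivity ((a ^+ 2 + b * c) *: y); [vring | rewrite al0 scale0r].
  have /free3P /(_ 1 0 0) := frs; rewrite hx a0 b0 !(scale0r, scaler0, addr0).
  by case=> // /eqP; rewrite oner_eq0.
have trip p : p \in n -> free [:: h; p; bracket h p] ->
    bracket h (bracket h p) = (a ^+ 2 + b * c) *: p ->
    (exists2 mu, mu != 0 & bracket p (bracket h p) = mu *: h) ->
  exists h p s (al mu : K),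
  [/\ [/\ h \in n, p \in n & s \in n], free [:: h; p; s], al != 0, mu != 0 &
      [/\ bracket h p = s, bracket h s = al *: p & bracket p s = mu *: h]].
  by move=> pn frp E [mu mu0 E2]; exists h, p, (bracket h p), (a ^+ 2 + b * c), mu.
have [b0|b0] := eqVneq b 0; last first.
  apply: (trip x) => //.
  - apply: (free3_sub fr) => U hU xU; rewrite hx => sU; split=> //.
    by rewrite -[y](scalerK b0) memvZ // -[b *: y](addKr (a *: x)) memvD // memvN memvZ.
  - by rewrite hx !brE hx hy; vring.
  by exists (b * r0); [rewrite mulf_neq0 | rewrite hx !brE xyE; vring].
have [c0|c0] := eqVneq c 0; last first.
  apply: (trip y) => //.
  - apply: (free3_sub fr) => U hU yU; rewrite hy => sU; split=> //.
    by rewrite -[x](scalerK c0) memvZ // -[c *: x](addrK (- a *: y)) memvB // memvZ.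
  - by rewrite hy !brE hx hy; vring.
  by exists (- (c * r0)); [rewrite oppr_eq0 mulf_neq0 | rewrite hy !brE yx; vring].
have a0 : a != 0 by move: al0; rewrite b0 mul0r addr0 sqrf_eq0.
have two0 : (2%:R : K) != 0 by rewrite pnatr_eq0.
have hp : bracket h (x + y) = a *: (x - y) by rewrite brDr hx hy b0 c0; vring.
apply: (trip (x + y)); first exact: memvD.
- apply: (free3_sub fr) => U hU pU; rewrite hp => /(memvZ a^-1); rewrite scalerK // => sU.
  have xU : x \in U.
    rewrite -[x](scalerK two0) memvZ // (_ : _ *: x = (x + y) + (x - y)); last by vring.
    exact: memvD.
  by split=> //; rewrite -[y](addKr x) memvD // memvN.
- by rewrite hp !brE hx hy b0 c0; vring.
exists (- (2%:R * a * r0)); first by rewrite oppr_eq0 !mulf_neq0.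
by rewrite hp !brE xyE yx; vring.
Qed.

(** The squares of [ad h], [ad p] and [ad s], each on the plane of the other two vectors, are [al],
    [- mu] and [al * mu]. Their product is negative, so one of them is, and the roles are permuted
    to bring it to [h]. *)
Lemma perfect_negative_triple : exists h p s (al mu : K),
  [/\ [/\ h \in n, p \in n & s \in n], free [:: h; p; s], al < 0, mu != 0 &
      [/\ bracket h p = s, bracket h s = al *: p & bracket p s = mu *: h]].
Proof.
have [h [p [s [al [mu [[hn pn sn] fr al0 mu0 [hp hs ps]]]]]]] := perfect_standard_triple.
have [al_lt0|al_gt0|al_eq0] := ltgtP al 0; last by rewrite al_eq0 eqxx in al0.
  by exists h, p, s, al, mu.
have [ph [sh sp]] : bracket p h = - s /\ bracket s h = - (al *: p) /\ bracket s p = - (mu *: h).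
  by rewrite brC hp brC hs brC ps.
have [mu_lt0|mu_gt0|mu_eq0] := ltgtP mu 0; last by rewrite mu_eq0 eqxx in mu0.
  exists s, h, (- (al *: p)), (al * mu), (- al); split=> //.
  - by split; rewrite ?memvN ?memvZ.
  - apply: (free3_sub fr) => U sU hU; rewrite memvN => /(memvZ al^-1).
    by rewrite scalerK.
  - by rewrite pmulr_rlt0.
  - by rewrite oppr_eq0.
  by split=> //; rewrite !brE ?sp ?hp; vring.
exists p, h, (- s), (- mu), (- al); split=> //.
- by split; rewrite ?memvN.
- by apply: (free3_sub fr) => U pU hU; rewrite memvN => sU; split.
- by rewrite oppr_lt0.
- by rewrite oppr_eq0.
by split=> //; rewrite !brE ?ps ?hs; vring.
Qed.

Lemma perfect_normalized_triple : exists h a b (mu : K),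
  [/\ [/\ h \in n, a \in n & b \in n], free [:: h; a; b], mu = 1 \/ mu = -1 &
      [/\ bracket h a = b, bracket h b = - a & bracket a b = mu *: h]].
Proof.
have [h [p [s [al [mu [[hn pn sn] fr al0 mu0 [hp hs ps]]]]]]] := perfect_negative_triple.
have r0 : 0 < Num.sqrt (- al) by rewrite sqrtr_gt0 oppr_gt0.
have rE : Num.sqrt (- al) ^+ 2 = - al by rewrite sqr_sqrtr // oppr_ge0 ltW.
move: (Num.sqrt _) r0 rE => r /gt_eqF /negbT r0 rE.
have t0 : 0 < Num.sqrt `|mu| by rewrite sqrtr_gt0 normr_gt0.
have tE : Num.sqrt `|mu| ^+ 2 = `|mu| by rewrite sqr_sqrtr.
move: (Num.sqrt `|mu|) t0 tE => t /gt_eqF /negbT t0 tE.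
have tt0 : t ^+ 2 != 0 by rewrite expf_neq0.
exists (r^-1 *: h), (t^-1 *: p), ((r * t)^-1 *: s), (mu / t ^+ 2); split.
- by split; rewrite memvZ.
- apply: (free3_sub fr) => U /(memvZ r) hU /(memvZ t) pU /(memvZ (r * t)) sU.
  by rewrite !scalerKV ?mulf_neq0 // in hU pU sU.
- rewrite tE; have [mu_gt0|mu_lt0|mu_eq0] := ltgtP 0 mu.
  + by left; rewrite gtr0_norm // divff.
  + by right; rewrite ltr0_norm // invrN mulrN divff.
  by rewrite -mu_eq0 eqxx in mu0.
split.
- by rewrite !brE hp scalerA invfM.
- rewrite !brE hs !scalerA -scaleNr; congr (_ *: _).
  rewrite -[al]opprK -rE; field; by rewrite r0 t0.
by rewrite !brE ps !scalerA; congr (_ *: _); field; rewrite r0 t0.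
Qed.

(** Every derivation of [n] is inner, so some [c] outside [n] centralises it and [n] splits off. *)
Lemma derived_dim3_case : classified_or_exceptional.
Proof.
have [h [a [b [mu [[hn an bn] fr mu1 [ha hb ab]]]]]] := perfect_normalized_triple.
have mu0 : mu != 0 by case: mu1 => ->; rewrite ?oppr_eq0 oner_eq0.
have two0 : (2%:R : K) != 0 by rewrite pnatr_eq0.
have ah : bracket a h = - b by rewrite brC ha.
have bh : bracket b h = a by rewrite brC hb opprK.
have ba : bracket b a = - (mu *: h) by rewrite brC ab.
have nE := span_n hn an bn fr; have /free3P H3 := fr.
have coord_n u : u \in n -> exists k1 k2 k3 : K, u = k1 *: h + k2 *: a + k3 *: b.
  by rewrite nE => /in_span3.
have [d1 [d2 [d3 eh]]] := coord_n _ (bracket_n e0 h).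
have [f1 [f2 [f3 ea]]] := coord_n _ (bracket_n e0 a).
have [c [cn [k1 [k2 [ch ca]]]]] : exists c, c \notin n /\ exists k1 k2 : K,
    bracket c h = d1 *: h /\ bracket c a = k1 *: h + k2 *: a.
  (* Chosen to cancel the components of [[c, h]] on [a] and [b], and that of [[c, a]] on [b]; the
     derivation rule kills the rest. *)
  exists (e0 - (f3 *: h - d3 *: a + d2 *: b)); split.
    apply: contra e0_notin_n => m; rewrite -[e0](subrK (f3 *: h - d3 *: a + d2 *: b)) memvD //.
    by rewrite memvD ?memvB // memvZ.
  by exists (f1 + mu * d2), f2; split; rewrite !brE ?eh ?ea ?ah ?bh ?ha ?ba; vring.
have Jb := brJ c h a; rewrite ha ch ca !brE ha in Jb.
have cb : bracket c b = (d1 + k2) *: b by rewrite Jb; vring.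
have Jhb := brJ c h b; rewrite hb ch cb !brE ca hb in Jhb.
have Jab := brJ c a b; rewrite ab cb ca !brE ch hb ab in Jab.
have [|k10 E1 _] := H3 k1 (- (2%:R * d1)) 0.
  by move/eqP: Jhb; rewrite eq_sym -subr_eq0 => /eqP Jhb; rewrite -[RHS]Jhb; vring.
have d10 : d1 = 0 by move/eqP: E1; rewrite oppr_eq0 mulf_eq0 (negPf two0) => /eqP.
have [|E2 _ _] := H3 (2%:R * k2 * mu) 0 0.
  move/eqP: Jab; rewrite eq_sym -subr_eq0 k10 d10 => /eqP Jab; rewrite -[RHS]Jab; vring.
have k20 : k2 = 0.
  by move/eqP: E2; rewrite mulf_eq0 (negPf mu0) orbF mulf_eq0 (negPf two0) => /eqP.
rewrite k10 k20 d10 !(addr0, scale0r) in ch ca cb.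
have frame : simple_frame mu h a b c.
  split=> //; last by split; rewrite brC ?ch ?ca ?cb ?oppr0.
  by apply: (free4_sub (free_n cn hn an bn fr)) => U *; split.
case: mu1 frame => -> frame; last by constructor 3; exact: (simple_frame_g36_g1 dim_g frame).
by constructor 1; exact: (compact_hyperplanes dim_g frame).
Qed.

End Perfect.

Lemma ideal3_hyperplanes : classified_or_exceptional.
Proof.
have [n1 [n2 [n3 [frn nE]]]] := dim3_span dim_n.
have [n1n n2n n3n] : [/\ n1 \in n, n2 \in n & n3 \in n] by rewrite nE; apply: mem_span3.
pose W := <<[:: bracket n1 n2; bracket n1 n3; bracket n2 n3]>>%VS.
have [m1 m2 m3] := mem_span3 (bracket n1 n2) (bracket n1 n3) (bracket n2 n3).
have nW u v : u \in n -> v \in n -> bracket u v \in W.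
  by rewrite nE; exact: bracket_in_span3.
have minW U : (forall u v, u \in n -> v \in n -> bracket u v \in U) -> (W <= U)%VS.
  by move=> H; apply/span_subvP => u; rewrite !inE => /or3P [] /eqP ->; exact: H.
have Wn : (W <= n)%VS by apply: minW => *; exact: bracket_n.
have : (\dim W <= 3)%N by rewrite -dim_n dimvS.
case dW: (\dim W) => [|[|[|[|//]]]] _.
- have W0 : W = 0%VS by apply/eqP; rewrite -dimv_eq0 dW.
  have n0 u v : u \in n -> v \in n -> bracket u v = 0.
    by move=> un vn; apply/eqP; rewrite -memv0 -W0 nW.
  by apply: (abelian_span_hyperplanes (free_n e0_notin_n n1n n2n n3n frn));
    rewrite -?nE ?bracket_n // n0.
- have [z z0 WE] := dim1_line dW.
  apply: (derived_dim1_case z0); first by rewrite -WE.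
  apply: contrapT => nn; have : (W <= 0)%VS; last by rewrite subv0 -dimv_eq0 dW.
  apply: minW => u v un vn; rewrite memv0; apply: contraT => uv0.
  by case: nn; exists u, v.
- exact: derived_dim2_case dW Wn nW minW.
apply: derived_dim3_case => U /minW; suff -> : W = n by [].
by apply/eqP; rewrite eqEdim Wn dW dim_n.
Qed.

End Structure.

Theorem hyperplanes_trichotomy (K : rcfType) (g : lieAlgType K) :
  \dim {:g} = 4%N -> (exists q : {vspace g}, generating3 q) -> classified_or_exceptional g.
Proof.
move=> dim_g gen_g; have [n dim_n bracket_n] := derived_subalgebra_proper dim_g.
have /subvPn [e _ en] : ~~ (fullv <= n)%VS by apply/negP => /dimvS; rewrite dim_g dim_n.
exact: (ideal3_hyperplanes dim_g gen_g dim_n bracket_n en).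
Qed.

Theorem proposition17 (R : realType) (g : lieAlgType R)
    (dim_g : \dim {:g} = 4%N)
    (gen_g : exists q : {vspace g}, generating3 q) :
  (infinite_set [set I : {vspace g} | ideal_of_dim 2 I] ->
     forall q1 q2 : {vspace g},
       generating3 q1 -> generating3 q2 -> equivalent q1 q2)
  /\
  (finite_set [set I : {vspace g} | ideal_of_dim 2 I] ->
   ~ is_2g21 g -> ~ is_g36_g1 g ->
   exists m : nat, (m <= 3)%N /\
     (exists L : 'I_m -> {vspace g}, ideal1_representatives L) /\
     forall L : 'I_m -> {vspace g}, ideal1_representatives L ->
       exists C : 'I_m.+1 -> set {vspace g},
         [/\ injective C,
             range C = generating3_classes g,
             forall (i : 'I_m) (q : {vspace g}), generating3 q ->
               (L i <= q)%VS -> C (widen_ord (leqnSn m) i) q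
           & forall q : {vspace g}, generating3 q ->
               (forall I : {vspace g}, ideal_of_dim 1 I -> ~~ (I <= q)%VS) ->
               C ord_max q]).
Proof.
case: (hyperplanes_trichotomy dim_g gen_g) => [[[fin cl]|[inf eqv]]|/[dup] ex|/[dup] ex].
- by split=> // _ _ _; exact: ideal1_classification.
- by split=> // fin.
(* The exceptional algebras have finitely many plane ideals, so the first claim is vacuous for
   them. *)
- by move=> /finite_ideal2_2g21 fin; split=> // _ /(_ ex).
by move=> /(finite_ideal2_g36_g1 dim_g) fin; split=> // _ _ /(_ ex).
Qed.
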